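(* The set of Dixmier-measurable operators in $\mathcal L_{1,\infty}$ strictly contains the set of $\mathcal{PT}$-measurable operators in $\mathcal L_{1,\infty}$; that is, every $\mathcal{PT}$-measurable operator is Dixmier-measurable, and there exists a Dixmier-measurable operator in $\mathcal L_{1,\infty}$ (which can even be chosen positive) that is not $\mathcal{PT}$-measurable.
   Context: $\mu(n,A)$ denotes singular values, $\mu(t,A)=\mu(n,A)$ for $t\in[n,n+1)$; $\mathcal L_{1,\infty}=\{A\text{ compact}:\sup_n(n+1)\mu(n,A)<\infty\}$. A trace is a unitarily invariant linear functional on $\mathcal L_{1,\infty}$; $\mathcal{PT}$ is the set of positive (nonnegative on positive operators) normalised (value $1$ on $A\ge0$ with $\mu(n,A)=1/(n+1)$) traces. A Dixmier trace is the linear extension of $\mathrm{Tr}_\omega(A)=\omega\big(t\mapsto\frac1{\log(1+t)}\int_0^t\mu(s,A)ds\big)$, $0\le A\in\mathcal L_{1,\infty}$, for a dilation invariant extended limit $\omega$ on $L_\infty(0,\infty)$; Dixmier traces belong to $\mathcal{PT}$. For a set $\mathcal A$ of traces, $A\in\mathcal L_{1,\infty}$ is $\mathcal A$-measurable if all $\tau\in\mathcal A$ take the same value on $A$; Dixmier-measurable means measurable w.r.t. the set of all Dixmier traces. *)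

(* Defs.v *)
(* Hilbert space H = l^2(N) over C = R[i]. *)
From HB Require Import structures.
From mathcomp Require Import all_boot all_order all_algebra.
From mathcomp Require Import all_classical all_reals all_analysis.
From mathcomp Require Import complex.
Set Implicit Arguments. Unset Strict Implicit. Unset Printing Implicit Defensive.
Import Order.TTheory GRing.Theory Num.Theory.
Local Open Scope classical_set_scope.
Local Open Scope ring_scope.

(* ---------- vectors of l^2(N) ---------- *)
Definition vec (R : realType) := nat -> R[i].
Definition op (R : realType) := vec R -> vec R.

(* |z|^2 for a complex number z *)
Definition csq {R : realType} (z : R[i]) : R := (complex.Re z) ^+ 2 + (complex.Im z) ^+ 2.

(* x is square summable *)
Definition l2 {R : realType} (x : vec R) : Prop :=
  exists M : R, forall n, \sum_(k < n) csq (x k) <= M.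

(* sum of a real series (limit of its partial sums) *)
Definition rsum {R : realType} (u : nat -> R) : R := limn (fun n => \sum_(k < n) u k).

(* the l^2 norm *)
Definition vnorm {R : realType} (x : vec R) : R :=
  Num.sqrt (rsum (fun k => csq (x k))).

(* the inner product <x, y> = sum_k x_k conj(y_k) *)
Definition cinner {R : realType} (x y : vec R) : R[i] :=
  Complex (rsum (fun k => complex.Re (x k * (y k)^*)))
          (rsum (fun k => complex.Im (x k * (y k)^*))).

(* ---------- bounded operators on l^2(N) ----------
   An operator is represented by a function on all sequences which is
   zero outside l^2 (canonical representative), linear and bounded on l^2. *)
Definition bounded_op {R : realType} (A : op R) : Prop :=
  [/\ (forall x, ~ l2 x -> A x = (fun _ => 0)),
      (forall x, l2 x -> l2 (A x)),
      (forall (a : R[i]) x y, l2 x -> l2 y ->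
          A (fun k => a * x k + y k) = (fun k => a * A x k + A y k)) &
      exists M : R, forall x, l2 x -> vnorm (A x) <= M * vnorm x].

(* operator norm *)
Definition opnorm {R : realType} (A : op R) : R :=
  sup [set vnorm (A x) | x in [set x | l2 x /\ vnorm x <= 1]].

(* linear combinations and composition of operators *)
Definition opcomb {R : realType} (a : R[i]) (A B : op R) : op R :=
  fun x k => a * A x k + B x k.
Definition opsub {R : realType} (A B : op R) : op R :=
  fun x k => A x k - B x k.

(* rank F <= n : the range of F lies in the span of n vectors *)
Definition rank_le {R : realType} (F : op R) (n : nat) : Prop :=
  exists v : 'I_n -> vec R, forall x, l2 x ->
    exists c : 'I_n -> R[i], F x = (fun k => \sum_(i < n) c i * v i k).

(* singular values mu(n, A) = inf { ||A - F|| : rank F <= n } *)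
Definition smu {R : realType} (n : nat) (A : op R) : R :=
  inf [set opnorm (opsub A F) | F in [set F | bounded_op F /\ rank_le F n]].

(* mu(t, A) = mu(n, A) for t in [n, n+1) *)
Definition smu_t {R : realType} (t : R) (A : op R) : R := smu (Num.truncn t) A.

(* compact: the image of the unit ball is totally bounded *)
Definition compact_op {R : realType} (A : op R) : Prop :=
  forall e : R, 0 < e -> exists (m : nat) (y : 'I_m -> vec R),
    forall x, l2 x -> vnorm x <= 1 ->
      exists i, vnorm (fun k => A x k - y i k) < e.

(* the weak trace ideal L_{1,oo} *)
Definition L1inf {R : realType} (A : op R) : Prop :=
  [/\ bounded_op A, compact_op A &
      exists M : R, forall n : nat, n.+1%:R * smu n A <= M].

(* positive operators *)
Definition pos_op {R : realType} (A : op R) : Prop :=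
  bounded_op A /\ forall x, l2 x -> 0 <= cinner (A x) x.

(* U unitary with inverse V *)
Definition unitary_pair {R : realType} (U V : op R) : Prop :=
  [/\ bounded_op U, bounded_op V,
      (forall x, l2 x -> U (V x) = x /\ V (U x) = x) &
      (forall x, l2 x -> vnorm (U x) = vnorm x)].

(* ---------- traces ---------- *)
Definition is_trace {R : realType} (tau : op R -> R[i]) : Prop :=
  (forall a A B, L1inf A -> L1inf B -> tau (opcomb a A B) = a * tau A + tau B) /\
  (forall U V A, unitary_pair U V -> L1inf A -> tau (U \o A \o V) = tau A).

(* positive normalised traces *)
Definition PT {R : realType} (tau : op R -> R[i]) : Prop :=
  [/\ is_trace tau,
      (forall A, L1inf A -> pos_op A -> 0 <= tau A) &
      (forall A, L1inf A -> pos_op A -> (forall n : nat, smu n A = n.+1%:R^-1) ->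
           tau A = 1)].

(* A is measurable with respect to a set of traces *)
Definition measurable_wrt {R : realType} (S : (op R -> R[i]) -> Prop) (A : op R) :=
  forall tau1 tau2, S tau1 -> S tau2 -> tau1 A = tau2 A.

(* ---------- extended limits on L_oo(0,oo) ---------- *)
Definition Linf {R : realType} (f : R -> R) : Prop :=
  measurable_fun `](0:R), +oo[%classic f /\
  exists M : R, \forall t \ae (@lebesgue_measure R), `](0:R), +oo[%classic t -> `|f t| <= M.

(* a positive normalised linear functional on L_oo(0,oo) vanishing on functions
   supported in a bounded interval, i.e. omega f <= ess limsup_{t->oo} f t *)
Definition ext_lim {R : realType} (om : (R -> R) -> R) : Prop :=
  [/\ (forall (a : R) f g, Linf f -> Linf g ->
         om (fun t => a * f t + g t) = a * om f + om g),
      (forall f, Linf f ->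
         (\forall t \ae (@lebesgue_measure R), `](0:R), +oo[%classic t -> 0 <= f t) ->
         0 <= om f),
      om (fun _ => 1) = 1 &
      (forall f (T : R), Linf f ->
         (\forall t \ae (@lebesgue_measure R), `]T, +oo[%classic t -> f t = 0) ->
         om f = 0)].

Definition dilation_inv {R : realType} (om : (R -> R) -> R) : Prop :=
  forall (s : R) f, 0 < s -> Linf f -> om (fun t => f (t / s)) = om f.

(* t |-> 1/log(1+t) \int_0^t mu(s, A) ds *)
Definition dix_fun {R : realType} (A : op R) (t : R) : R :=
  (ln (1 + t))^-1 * \int[(@lebesgue_measure R)]_(s in `[(0:R), t]%classic) smu_t s A.

(* Dixmier traces: linear extensions to L_{1,oo} of Tr_omega *)
Definition Dixmier {R : realType} (tau : op R -> R[i]) : Prop :=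
  exists om, [/\ ext_lim om, dilation_inv om,
    (forall a A B, L1inf A -> L1inf B -> tau (opcomb a A B) = a * tau A + tau B) &
    (forall A, L1inf A -> pos_op A -> tau A = (om (dix_fun A))%:C%C)].

(* Main.v *)
(** An operator [T] of the weak trace ideal has, for every [n], an orthonormal family of
    at most [n] vectors off which [T] and its adjoint have norm [O(1 / n)].  Let [t n] be
    the sum of [<T e, e>] over that family.  By
    [Tr (T P) - Tr (T Q) = Tr ((1 - Q) T P) - Tr (T (1 - P) Q)] the sequence [t] is
    independent of the choices up to a bounded error, hence additive and unitarily
    invariant up to a bounded error, and [t (2 ^ n)] has bounded increments in [n].
    Therefore any extended limit of [(t (2 ^ (a m + m)) - t (2 ^ a m)) / (m ln 2)] is a
    trace, whatever the windows [a m, a m + m] of levels are.  For [T >= 0], almost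
    maximisers of the quadratic form, taken successively on orthogonal complements, are
    almost eigenvectors, which gives [t n = sum_{k < n} mu(k, T) + O(1)]; so these traces
    are positive and normalised.

    The separating operator is diagonal with [mu(k) = x_n / 2 ^ n] for
    [2 ^ n <= k < 2 ^ (n + 1)], where [x_n = 2] on the intervals [2 ^ m <= n < 2 ^ m + m]
    and [x_n = 1] elsewhere.  These intervals have density zero, so the Dixmier averages
    converge to [1 / ln 2]; the windows with [a m = 2 ^ m] give a trace with value
    [2 / ln 2], those with [a m = 0] a trace with value [1 / ln 2].

    Conversely a Dixmier trace belongs to [PT] as soon as it is unitarily invariant, and
    on positive operators it is, as it only depends on singular values.  The positive
    operators span the ideal: in an orthonormal sequence adapted to [T], a diagonal
    operator [B] with entries [O(1 / (j + 1))] satisfies [|<T x, x>| <= <B x, x>], so that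
    [B + Re T], [B + Im T] and [B] are positive. *)
From HB Require Import structures.
Require Import Defs.
From mathcomp Require Import all_boot all_order all_algebra.
From mathcomp Require Import all_classical all_reals all_analysis.
From mathcomp Require Import complex sesquilinear ring lra zify.
From mathcomp Require Import measurable_realfun.
Set Implicit Arguments. Unset Strict Implicit. Unset Printing Implicit Defensive.
Import Order.TTheory GRing.Theory Num.Theory numFieldNormedType.Exports Normc.
Local Open Scope classical_set_scope.
Local Open Scope ring_scope.

(** * Complex numbers and sesquilinear forms *)

Section ComplexModulus.
Variable R : realType.
Implicit Types z w : R[i].

Lemma csqE z : csq z = normc z ^+ 2.
Proof. by case: z => a b; rewrite sqr_sqrtr // addr_ge0 ?sqr_ge0. Qed.

Lemma csq_ge0 z : 0 <= csq z.
Proof. by rewrite csqE sqr_ge0. Qed.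

Lemma csq_eq0 z : (csq z == 0) = (z == 0).
Proof.
rewrite csqE sqrf_eq0; apply/eqP/eqP => [/eq0_normc //|->]; exact: normc0.
Qed.

Lemma csq0 : csq (0 : R[i]) = 0.
Proof. by apply/eqP; rewrite csq_eq0. Qed.

Lemma csqM z w : csq (z * w) = csq z * csq w.
Proof. by rewrite !csqE normcM exprMn. Qed.

Lemma csq_real (r : R) : csq r%:C%C = r ^+ 2.
Proof. by rewrite /csq /= expr0n addr0. Qed.

Lemma mul_conjC_csq z : z * z^* = (csq z)%:C%C.
Proof. by rewrite -normCK csqE rmorphXn; case: z. Qed.

Lemma normc_ge0 z : 0 <= normc z.
Proof. by case: z => a b; exact: sqrtr_ge0. Qed.

Lemma normcJ_conj z : normc z^* = normc z.
Proof. by case: z => a b; rewrite /= sqrrN. Qed.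

Lemma normc_real (r : R) : normc r%:C%C = `|r|.
Proof. by rewrite /= expr0n addr0 sqrtr_sqr. Qed.

Lemma normcB z w : normc (z - w) <= normc z + normc w.
Proof. by rewrite -(normcN w) le_normcD. Qed.

Lemma normc_sum (I : Type) (s : seq I) (P : pred I) (F : I -> R[i]) :
  normc (\sum_(i <- s | P i) F i) <= \sum_(i <- s | P i) normc (F i).
Proof. exact: (@ler_norm_sum _ (Rcomplex R)). Qed.

Lemma normRe_le z : `|complex.Re z| <= normc z.
Proof. by case: z => a b; rewrite -sqrtr_sqr ler_wsqrtr //= lerDl sqr_ge0. Qed.

Lemma normIm_le z : `|complex.Im z| <= normc z.
Proof. by case: z => a b; rewrite -sqrtr_sqr ler_wsqrtr //= lerDr sqr_ge0. Qed.

Lemma Re_le_normc z : complex.Re z <= normc z.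
Proof. exact: le_trans (ler_norm _) (normRe_le z). Qed.

Lemma csqD z w : csq (z + w) <= 2 * (csq z + csq w).
Proof.
rewrite !csqE; apply: le_trans (_ : (normc z + normc w) ^+ 2 <= _).
  by rewrite lerXn2r ?nnegrE ?addr_ge0 ?normc_ge0 ?le_normcD.
by have := sqr_ge0 (normc z - normc w); lra.
Qed.

End ComplexModulus.

Section NonnegativeForms.
Variables (C : numClosedFieldType) (U : lmodType C).
Variable q : {bilinear U -> U -> C | *%R & (@Num.conj C : C -> C) \; *%R}.
Hypothesis q_ge0 : forall u, 0 <= q u u.

Let scalel a u v : q (a *: u) v = a * q u v.
Proof. exact: linearZl_LR. Qed.

Let scaler a u v : q u (a *: v) = a^* * q u v.
Proof. exact: linearZr_LR. Qed.

Lemma sesquilinear_ge0_conj u v : q v u = (q u v)^*.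
Proof.
have real w : (q w w)^* = q w w by exact: geC0_conj.
have sumE : (q u v)^* + (q v u)^* = q u v + q v u.
  have /eqP := real (u + v); rewrite linearDl !linearDr /= !rmorphD /= !real.
  rewrite -subr_eq0 => sum0; apply/eqP; rewrite -subr_eq0; congr (_ == 0): sum0; ring.
have diffE : (q u v)^* - (q v u)^* = q v u - q u v.
  have /eqP := real ('i *: u + v); rewrite linearDl !linearDr /=.
  rewrite !scalel !scaler !rmorphD !rmorphM /= !conjCK !real.
  rewrite conjCi -subr_eq0 => diff0; apply: (mulfI (neq0Ci C)); apply/eqP.
  by rewrite eq_sym -subr_eq0; congr (_ == 0): diff0; ring.
have two_neq0 : (2 : C) != 0 by rewrite pnatr_eq0.
apply: (mulfI two_neq0); transitivity ((q u v + q v u) + (q v u - q u v)); first ring.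
by rewrite -sumE -diffE; ring.
Qed.

(* [q] is evaluated at [q v v *: u - q u v *: v], or at the vector obtained by
   exchanging [u] and [v], or at [u - q u v *: v] when [q u u = q v v = 0]. *)
Lemma sesquilinear_CauchySchwarz u v : `|q u v| ^+ 2 <= q u u * q v v.
Proof.
rewrite normCK; set c := q u v; set a := q u u; set b := q v v.
have aC : a^* = a := geC0_conj (q_ge0 u).
have bC : b^* = b := geC0_conj (q_ge0 v).
have q_comb (x y : C) : 0 <= x * x^* * a + x * y^* * c + y * x^* * c^* + y * y^* * b.
  have := q_ge0 (x *: u + y *: v); rewrite linearDl !linearDr /=.
  rewrite !scalel !scaler -/a -/b -/c (sesquilinear_ge0_conj u v) -/c.
  by congr (0 <= _); ring.
have [b0|b0] := eqVneq b 0; last first.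
  have bp : 0 < b by rewrite lt_def b0 q_ge0.
  rewrite -subr_ge0 -(pmulr_rge0 _ bp).
  have := q_comb b (- c); rewrite rmorphN bC.
  by congr (0 <= _); ring.
have [a0|a0] := eqVneq a 0; last first.
  have ap : 0 < a by rewrite lt_def a0 q_ge0.
  rewrite -subr_ge0 -(pmulr_rge0 _ ap).
  have := q_comb (- c^*) a; rewrite rmorphN /= conjCK aC.
  by congr (0 <= _); ring.
have := q_comb 1 (- c); rewrite rmorphN rmorph1 a0 b0 mul0r.
have -> : 1 * 1 * 0 + 1 * - c^* * c + - c * 1 * c^* + - c * - c^* * 0 = - (2 * (c * c^*)).
  by ring.
by rewrite oppr_ge0 pmulr_rle0.
Qed.

End NonnegativeForms.

(** * The Hilbert space of square summable sequences *)

Section RealSeries.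
Variable R : realType.
Implicit Types u v : nat -> R.

Definition rsummable u := cvgn (fun n => \sum_(k < n) u k).

Lemma partial_sumE u : (fun n => \sum_(k < n) u k) = series u.
Proof. by apply/funext => n; rewrite seriesEord. Qed.

Lemma rsummable_ge0 u (M : R) : (forall k, 0 <= u k) ->
  (forall n, \sum_(k < n) u k <= M) -> rsummable u.
Proof.
move=> u0 uM; apply: nondecreasing_is_cvgn.
  by rewrite partial_sumE; apply/nondecreasing_series.
by exists M => _ [n _ <-].
Qed.

Lemma rsummable_le u v : (forall k, `|u k| <= v k) -> rsummable v -> rsummable u.
Proof.
rewrite /rsummable !partial_sumE => uv cv; apply: normed_cvg.
by apply: series_le_cvg cv => n //=; apply: le_trans (uv n).
Qed.

Lemma rsum_cvg_linear (a : R) u v : rsummable u -> rsummable v ->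
  (fun n => \sum_(k < n) (a * u k + v k)) @ \oo --> a * rsum u + rsum v.
Proof.
move=> cu cv; rewrite (_ : (fun _ => _) =
    (cst a \* (fun n => \sum_(k < n) u k)) + (fun n => \sum_(k < n) v k)).
  by apply: cvgD => //; apply: cvgM => //; exact: cvg_cst.
by apply/funext => n; rewrite big_split /= -mulr_sumr.
Qed.

Lemma rsummable_linear (a : R) u v : rsummable u -> rsummable v ->
  rsummable (fun k => a * u k + v k).
Proof. by move=> cu cv; apply/cvg_ex; eexists; exact: rsum_cvg_linear. Qed.

Lemma rsum_linear (a : R) u v : rsummable u -> rsummable v ->
  rsum (fun k => a * u k + v k) = a * rsum u + rsum v.
Proof. by move=> cu cv; apply/cvg_lim => //; exact: rsum_cvg_linear. Qed.

Lemma rsumN u : rsummable u -> rsum (fun k => - u k) = - rsum u.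
Proof.
move=> cu; have -> : - rsum u = (-2) * rsum u + rsum u by ring.
by rewrite -rsum_linear //; congr rsum; apply/funext => k; ring.
Qed.

Lemma rsum_ge u (n : nat) : (forall k, 0 <= u k) -> rsummable u ->
  \sum_(k < n) u k <= rsum u.
Proof.
move=> u0; rewrite /rsum /rsummable partial_sumE => cu.
rewrite -[leLHS]/((fun n => \sum_(k < n) u k) n) partial_sumE.
by apply: nondecreasing_cvgn_le => //; apply/nondecreasing_series.
Qed.

Lemma rsum_le u (M : R) : rsummable u -> (forall n, \sum_(k < n) u k <= M) ->
  rsum u <= M.
Proof. by move=> cu uM; apply: limr_le => //; apply: nearW. Qed.

Lemma rsum_delta u (k : nat) : rsum (fun j => if j == k then u j else 0) = u k.
Proof.
apply: cvg_lim => //; apply: (@cvg_near_cst _ R); exists k.+1 => // n /= kn.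
by rewrite -big_mkcond /= (big_ord1_eq _ u k) kn.
Qed.

End RealSeries.

Section HilbertSpace.
Variable R : realType.
Local Notation C := R[i].

Lemma l2_rsummable (x : vec R) : l2 x -> rsummable (fun k => csq (x k)).
Proof. by move=> [M xM]; apply: rsummable_ge0 xM => k; exact: csq_ge0. Qed.

Definition l2_pred : {pred nat -> C} := fun x => `[< l2 x >].

Lemma l2_submod_closed : submod_closed l2_pred.
Proof.
split.
  by apply/asboolP; exists 0 => n; rewrite big1 // => k _; rewrite csq0.
move=> a x y /asboolP [M xM] /asboolP [N yN]; apply/asboolP.
exists (2 * (csq a * M + N)) => n.
apply: le_trans (_ : \sum_(k < n) 2 * (csq a * csq (x k) + csq (y k)) <= _).
  by apply: ler_sum => k _; apply: le_trans (csqD _ _) _; rewrite csqM.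
rewrite -mulr_sumr ler_pM2l // big_split /= -mulr_sumr lerD ?yN //.
by rewrite ler_wpM2l ?csq_ge0 ?xM.
Qed.

HB.instance Definition _ := GRing.isSubmodClosed.Build _ _ l2_pred l2_submod_closed.

Record ell2 := Ell2 { ell2_val :> nat -> C; ell2_valP : ell2_val \in l2_pred }.

HB.instance Definition _ := [isSub for ell2_val].
HB.instance Definition _ := [Choice of ell2 by <:].
HB.instance Definition _ := [SubChoice_isSubLmodule of ell2 by <:].

Definition mk_ell2 (x : vec R) (lx : l2 x) : ell2 := @Ell2 x (introT (asboolP _) lx).

Implicit Types (x y z : ell2) (a : C).

Lemma ell2_l2 x : l2 x.
Proof. exact/asboolP/ell2_valP. Qed.

Lemma l2_ell2 (v : vec R) : l2 v -> exists x : ell2, v = x.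
Proof. by move=> lv; exists (mk_ell2 lv). Qed.

Lemma ell2P x y : (forall k, x k = y k) -> x = y.
Proof. by move=> xy; apply/val_inj/funext. Qed.

Lemma ell2D x y k : (x + y : ell2) k = x k + y k. Proof. by []. Qed.
Lemma ell2Z a x k : (a *: x : ell2) k = a * x k. Proof. by []. Qed.

Definition dot x y : C := cinner x y.

Lemma dot_rsummable x y :
  rsummable (fun k => complex.Re (x k * (y k)^*)) /\
  rsummable (fun k => complex.Im (x k * (y k)^*)).
Proof.
have sumxy : rsummable (fun k => 1 * csq (x k) + csq (y k)).
  by apply: rsummable_linear; exact/l2_rsummable/ell2_l2.
have bound k : normc (x k * (y k)^*) <= 1 * csq (x k) + csq (y k).
  rewrite normcM normcJ_conj mul1r !csqE.
  have := sqr_ge0 (normc (x k) - normc (y k)).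
  have := sqr_ge0 (normc (x k)); have := sqr_ge0 (normc (y k)); nra.
split; apply: rsummable_le sumxy => k; apply: le_trans (bound k).
- exact: normRe_le.
- exact: normIm_le.
Qed.

Lemma dot_linearl a x y z : dot (a *: x + y) z = a * dot x z + dot y z.
Proof.
have [xR xI] := dot_rsummable x z; have [yR yI] := dot_rsummable y z.
have comb (c d : R) u v w : rsummable u -> rsummable v -> rsummable w ->
    rsum (fun k => c * u k + (d * v k + w k)) = c * rsum u + (d * rsum v + rsum w).
  by move=> su sv sw; rewrite !rsum_linear //; exact: rsummable_linear.
rewrite /dot /cinner (_ : ell2_val (a *: x + y) = fun k => a * x k + y k) //.
case: a => a b; apply/eqP; rewrite eq_complex /=.
apply/andP; split; apply/eqP.
  rewrite -addrA -mulNr -comb //; congr rsum; apply/funext => k.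
  by move: (x k) (y k) (z k) => [x1 x2] [y1 y2] [z1 z2] /=; ring.
rewrite -addrA -comb //; congr rsum; apply/funext => k.
by move: (x k) (y k) (z k) => [x1 x2] [y1 y2] [z1 z2] /=; ring.
Qed.

Lemma dotC x y : dot y x = (dot x y)^*.
Proof.
have [xR xI] := dot_rsummable x y.
rewrite /dot /cinner; apply/eqP; rewrite eq_complex /=.
apply/andP; split; apply/eqP.
  congr rsum; apply/funext => k.
  by move: (x k) (y k) => [x1 x2] [y1 y2] /=; ring.
rewrite -rsumN //; congr rsum; apply/funext => k.
by move: (x k) (y k) => [x1 x2] [y1 y2] /=; ring.
Qed.

Lemma dot_bilinear : bilinear_for *%R ((@Num.conj C : C -> C) \; *%R) dot.
Proof.
split=> [z a x y|x a y z] /=; first exact: dot_linearl.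
by rewrite dotC dot_linearl rmorphD rmorphM /= -!dotC.
Qed.

HB.instance Definition _ := bilinear_isBilinear.Build C ell2 ell2 C
  *%R ((@Num.conj C : C -> C) \; *%R) dot dot_bilinear.

Lemma dot_hermitian x y : dot x y = (-1) ^+ false * (dot y x)^*.
Proof. by rewrite mul1r -dotC. Qed.

HB.instance Definition _ := isHermitianSesquilinear.Build C ell2 false
  (@Num.conj C : C -> C) dot dot_hermitian.

Lemma dotDl x y z : dot (x + y) z = dot x z + dot y z.
Proof. exact: linearDl. Qed.

Lemma dotDr x y z : dot x (y + z) = dot x y + dot x z.
Proof. exact: linearDr. Qed.

Lemma dotBl x y z : dot (x - y) z = dot x z - dot y z.
Proof. exact: linearBl. Qed.

Lemma dotBr x y z : dot x (y - z) = dot x y - dot x z.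
Proof. exact: linearBr. Qed.

Lemma dot0l x : dot 0 x = 0.
Proof. exact: linear0l. Qed.

Lemma dot0r x : dot x 0 = 0.
Proof. exact: linear0r. Qed.

Lemma dot_suml (I : Type) (s : seq I) (P : pred I) (F : I -> ell2) y :
  dot (\sum_(i <- s | P i) F i) y = \sum_(i <- s | P i) dot (F i) y.
Proof. exact: linear_sumlz. Qed.

Lemma dot_sumr (I : Type) (s : seq I) (P : pred I) (F : I -> ell2) x :
  dot x (\sum_(i <- s | P i) F i) = \sum_(i <- s | P i) dot x (F i).
Proof. exact: linear_sumr. Qed.

Lemma dotZl a x y : dot (a *: x) y = a * dot x y.
Proof. exact: linearZl_LR. Qed.

Lemma dotZr a x y : dot x (a *: y) = a^* * dot x y.
Proof. exact: linearZr_LR. Qed.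

Lemma vnorm_ge0 x : 0 <= vnorm x.
Proof. exact: sqrtr_ge0. Qed.

Lemma sqr_vnorm x : vnorm x ^+ 2 = rsum (fun k => csq (x k)).
Proof.
rewrite sqr_sqrtr //; apply: le_trans (rsum_ge 0 _ (l2_rsummable (ell2_l2 x))).
  by rewrite big_ord0.
by move=> k; exact: csq_ge0.
Qed.

Lemma sum_csq_le x (n : nat) : \sum_(k < n) csq (x k) <= vnorm x ^+ 2.
Proof.
rewrite sqr_vnorm; apply: rsum_ge => [k|]; first exact: csq_ge0.
exact/l2_rsummable/ell2_l2.
Qed.

Lemma dotxx_vnorm x : dot x x = (vnorm x ^+ 2)%:C%C.
Proof.
have real_xx : dot x x \is Num.real by apply/CrealP; rewrite -dotC.
rewrite -[LHS]RRe_real // sqr_vnorm; congr (rsum _)%:C%C.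
by apply/funext => k; rewrite mul_conjC_csq.
Qed.

Lemma vnorm_eq0 x : vnorm x = 0 -> x = 0.
Proof.
move=> x0; apply: ell2P => k; apply/eqP; rewrite -csq_eq0 eq_le csq_ge0 andbT.
have := sum_csq_le x k.+1; rewrite x0 expr0n big_ord_recr /=.
by apply: le_trans; rewrite lerDr sumr_ge0 // => i _; exact: csq_ge0.
Qed.

Lemma dot_CauchySchwarz_vnorm x y : normc (dot x y) <= vnorm x * vnorm y.
Proof.
rewrite -(@ler_pXn2r _ 2) ?nnegrE ?mulr_ge0 ?normc_ge0 ?vnorm_ge0 //.
rewrite -lecR exprMn [X in _ <= X]rmorphM /= -!dotxx_vnorm rmorphXn.
apply: (@sesquilinear_CauchySchwarz C ell2 (@dot)) => u.
by rewrite /= dotxx_vnorm ler0c sqr_ge0.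
Qed.

Lemma vnormD x y : vnorm (x + y) <= vnorm x + vnorm y.
Proof.
rewrite -(@ler_pXn2r _ 2) ?nnegrE ?addr_ge0 ?vnorm_ge0 //.
have xy := le_trans (Re_le_normc _) (dot_CauchySchwarz_vnorm x y).
have yx := le_trans (Re_le_normc _) (dot_CauchySchwarz_vnorm y x).
have := dotxx_vnorm (x + y); rewrite dotDl !dotDr !dotxx_vnorm; move: xy yx.
by move: (dot x y) (dot y x) => [a b] [c d] /= xy yx [<- _]; lra.
Qed.

Lemma vnormZ a x : vnorm (a *: x) = normc a * vnorm x.
Proof.
apply/eqP; rewrite -(@eqrXn2 _ 2) ?mulr_ge0 ?vnorm_ge0 ?normc_ge0 //.
rewrite -(inj_eq (@complexI R)) -dotxx_vnorm dotZl dotZr mulrA mul_conjC_csq.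
by rewrite dotxx_vnorm -rmorphM exprMn csqE.
Qed.

Lemma vnormMn x n : vnorm (x *+ n) = vnorm x *+ n.
Proof. by rewrite -scaler_nat vnormZ -(rmorph_nat (real_complex R))
  normc_real normr_nat mulr_natl. Qed.

Lemma vnormN x : vnorm (- x) = vnorm x.
Proof. by rewrite -scaleN1r vnormZ normcN normc1 mul1r. Qed.

HB.instance Definition _ := Num.Zmodule_isNormed.Build R ell2
  vnormD vnorm_eq0 vnormMn vnormN.

Lemma normr_vnorm x : `|x| = vnorm x. Proof. by []. Qed.

Lemma sqr_normr_rsum x : `|x| ^+ 2 = rsum (fun k => csq (x k)).
Proof. exact: sqr_vnorm. Qed.

Lemma dotxx x : dot x x = (`|x| ^+ 2)%:C%C.
Proof. exact: dotxx_vnorm. Qed.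

Lemma dot_CauchySchwarz x y : normc (dot x y) <= `|x| * `|y|.
Proof. exact: dot_CauchySchwarz_vnorm. Qed.

Lemma enormrZ a x : `|a *: x| = normc a * `|x|.
Proof. exact: vnormZ. Qed.

Lemma dot_gt0 x : x != 0 -> 0 < dot x x.
Proof. by move=> x0; rewrite dotxx (ltcR 0) exprn_gt0 // normr_gt0. Qed.

HB.instance Definition _ := isDotProduct.Build C ell2 (@dot) dot_gt0.

Lemma dot_inj x y : (forall z, dot x z = dot y z) -> x = y.
Proof.
move=> xy; apply/eqP; rewrite -subr_eq0 -normr_eq0 -sqrf_eq0.
by rewrite -(inj_eq (@complexI R)) -dotxx dotBl xy subrr.
Qed.

Lemma normr_le_dot x (c : R) : 0 <= c ->
  (forall y, normc (dot x y) <= c * `|y|) -> `|x| <= c.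
Proof.
move=> c0 /(_ x); rewrite dotxx normc_real ger0_norm ?sqr_ge0 // expr2.
have [->|x0] := eqVneq x 0; first by rewrite normr0.
by rewrite ler_pM2r // normr_gt0.
Qed.

Lemma normr_pythagoras x y : dot x y = 0 -> `|x + y| ^+ 2 = `|x| ^+ 2 + `|y| ^+ 2.
Proof.
by move=> xy; apply: (@complexI R); rewrite rmorphD /= -!dotxx hnormDd.
Qed.

Definition normalize x : ell2 := (`|x|^-1)%:C%C *: x.

Lemma normr_normalize x : x != 0 -> `|normalize x| = 1.
Proof.
move=> x0; rewrite enormrZ normc_real normfV normr_id mulVf //.
by rewrite normr_eq0.
Qed.

End HilbertSpace.

(** * Bounded operators *)

Section BoundedOperators.
Variable R : realType.
Local Notation C := R[i].
Local Notation H := (ell2 R).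

Definition blin_pred : {pred H -> H} := fun T =>
  `[< linear T /\ exists M : R, forall x, `|T x| <= M * `|x| >].

Lemma blin_submod_closed : submod_closed blin_pred.
Proof.
split; first apply/asboolP; first split.
- by move=> a x y; rewrite scaler0 addr0.
- by exists 0 => x; rewrite normr0 mul0r.
move=> a T S /asboolP[linT [M TM]] /asboolP[linS [N SN]]; apply/asboolP.
have combE x : (a *: T + S) x = a *: T x + S x by [].
split; first by move=> b x y; rewrite !combE linT linS !scalerDr !scalerA addrACA [a * b]mulrC.
exists (normc a * M + N) => x; rewrite combE; apply: le_trans (ler_normD _ _) _.
by rewrite mulrDl enormrZ lerD // -mulrA ler_wpM2l ?normc_ge0.
Qed.

HB.instance Definition _ := GRing.isSubmodClosed.Build _ _ blin_pred blin_submod_closed.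

Record blin := BLin { blin_fun :> H -> H; blin_funP : blin_fun \in blin_pred }.

HB.instance Definition _ := [isSub for blin_fun].
HB.instance Definition _ := [Choice of blin by <:].
HB.instance Definition _ := [SubChoice_isSubLmodule of blin by <:].

Definition mk_blin (T : H -> H) (linT : linear T)
    (bT : exists M : R, forall x, `|T x| <= M * `|x|) : blin :=
  @BLin T (introT (asboolP _) (conj linT bT)).

Implicit Types (T S U : blin) (x y : H) (a : C).

Lemma blin_linear T : linear T.
Proof. by have /asboolP[] := blin_funP T. Qed.

HB.instance Definition _ T := GRing.isLinear.Build C H H *:%R T (@blin_linear T).

Lemma blin_bounded T : exists2 M : R, 0 <= M & forall x, `|T x| <= M * `|x|.
Proof.
have /asboolP[_ [M TM]] := blin_funP T.
exists (Num.max M 0) => [|x]; first by rewrite le_max lexx orbT.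
by apply: le_trans (TM x) _; rewrite ler_wpM2r // le_max lexx.
Qed.

Lemma blinP T S : (forall x, T x = S x) -> T = S.
Proof. by move=> TS; apply/val_inj/funext. Qed.

Lemma blinD T S x : (T + S : blin) x = T x + S x. Proof. by []. Qed.
Lemma blinB T S x : (T - S : blin) x = T x - S x. Proof. by []. Qed.
Lemma blinZ a T x : (a *: T : blin) x = a *: T x. Proof. by []. Qed.

Lemma blin_sum (I : Type) (s : seq I) (P : pred I) (F : I -> blin) x :
  (\sum_(i <- s | P i) F i : blin) x = \sum_(i <- s | P i) F i x.
Proof. by apply: (big_morph (fun T : blin => T x)). Qed.

Definition blin1 : blin.
Proof.
by apply: (@mk_blin id) => //; exists 1 => x; rewrite mul1r.
Defined.

Definition blin_mul T S : blin.
Proof.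
apply: (@mk_blin (T \o S)) => [a x y|]; first by rewrite /= !linearP.
have [M M0 TM] := blin_bounded T; have [N _ SN] := blin_bounded S.
by exists (M * N) => x /=; apply: le_trans (TM _) _; rewrite -mulrA ler_wpM2l.
Defined.

Lemma blin_mulA : associative blin_mul. Proof. by move=> T S U; exact: blinP. Qed.
Lemma blin_mul1l : left_id blin1 blin_mul. Proof. by move=> T; exact: blinP. Qed.
Lemma blin_mul1r : right_id blin1 blin_mul. Proof. by move=> T; exact: blinP. Qed.

Lemma blin_mulDl : left_distributive blin_mul +%R.
Proof. by move=> T S U; exact: blinP. Qed.

Lemma blin_mulDr : right_distributive blin_mul +%R.
Proof. by move=> T S U; apply: blinP => x; rewrite blinD /= -linearD. Qed.

HB.instance Definition _ := GRing.Zmodule_isPzRing.Build blin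
  blin_mulA blin_mul1l blin_mul1r blin_mulDl blin_mulDr.

Lemma blinM T S x : (T * S : blin) x = T (S x). Proof. by []. Qed.
Lemma blin1E x : (1 : blin) x = x. Proof. by []. Qed.

Definition to_op T : op R :=
  fun x : vec R =>
    if pselect (l2 x) is left lx then ell2_val (T (mk_ell2 lx)) else fun _ => 0.

Lemma to_opE T x : to_op T x = T x.
Proof.
rewrite /to_op; case: pselect => [lx|/(_ (ell2_l2 x)) //].
by congr (ell2_val (T _)); exact: val_inj.
Qed.

Lemma to_op_inj : injective to_op.
Proof. by move=> T S TS; apply: blinP => x; apply: val_inj; rewrite /= -!to_opE TS. Qed.

Lemma bounded_to_op T : bounded_op (to_op T).
Proof.
split.
- by move=> x nx; rewrite /to_op; case: pselect.
- by move=> x /l2_ell2[y ->]; rewrite to_opE; exact: ell2_l2.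
- move=> a x y /l2_ell2[{}x ->] /l2_ell2[{}y ->].
  have -> : (fun k => a * x k + y k) = ell2_val (a *: x + y) by [].
  by rewrite !to_opE linearP.
- by have [M _ TM] := blin_bounded T; exists M => x /l2_ell2[{}x ->]; rewrite to_opE; exact: TM.
Qed.

Lemma bounded_opP (A : op R) : bounded_op A -> exists T, A = to_op T.
Proof.
move=> [A0 Al2 Alin [M AM]].
pose T x : H := mk_ell2 (Al2 x (ell2_l2 x)).
have linT : linear T.
  by move=> a x y; apply: val_inj; exact: (Alin a x y (ell2_l2 x) (ell2_l2 y)).
have bT : exists N : R, forall x, `|T x| <= N * `|x|.
  by exists M => x; apply: AM; exact: ell2_l2.
exists (mk_blin linT bT); apply/funext => x; rewrite /to_op.
by case: pselect => [lx|/A0].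
Qed.

Lemma opcomb_to_op a T S : opcomb a (to_op T) (to_op S) = to_op (a *: T + S).
Proof.
apply/funext => x; rewrite /opcomb /to_op; case: pselect => // nx.
by apply/funext => k; rewrite mulr0 addr0.
Qed.

Lemma opsub_to_op T S : opsub (to_op T) (to_op S) = to_op (T - S).
Proof.
apply/funext => x; rewrite /opsub /to_op; case: pselect => // nx.
by apply/funext => k; rewrite subr0.
Qed.

Lemma comp_to_op T S : to_op T \o to_op S = to_op (T * S).
Proof.
apply/funext => x /=; rewrite [to_op S x]/to_op [RHS]/to_op.
case: pselect => lx; first by rewrite to_opE.
by have -> : (fun _ : nat => (0 : C)) = ell2_val (0 : H) by []; rewrite to_opE linear0.
Qed.

Lemma opnorm_has_sup T :
  has_sup [set vnorm (to_op T x) | x in [set x | l2 x /\ vnorm x <= 1]].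
Proof.
split.
  exists (vnorm (to_op T (0 : H))), (0 : H) => //; split; first exact: ell2_l2.
  by rewrite -normr_vnorm normr0.
have [M M0 TM] := blin_bounded T; exists M => _ [_ [/l2_ell2[x ->] x1] <-].
by rewrite to_opE; apply: le_trans (TM x) _; rewrite ler_piMr.
Qed.

Lemma opnorm_le T (d : R) : 0 <= d -> (forall x, `|T x| <= d * `|x|) -> opnorm (to_op T) <= d.
Proof.
move=> d0 Td; apply: ge_sup (opnorm_has_sup T).1 _.
move=> _ [_ [/l2_ell2[x ->] x1] <-]; rewrite to_opE.
by apply: le_trans (Td x) _; rewrite ler_piMr.
Qed.

Lemma normr_le_opnorm T x : `|T x| <= opnorm (to_op T) * `|x|.
Proof.
have [->|x0] := eqVneq x 0; first by rewrite linear0 !normr0 mulr0.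
have nx : 0 < `|x| by rewrite normr_gt0.
rewrite -ler_pdivrMr //; apply: (ub_le_sup (opnorm_has_sup T).2).
exists (normalize x : H).
  by split; [exact: ell2_l2|rewrite -normr_vnorm normr_normalize].
by rewrite to_opE -normr_vnorm linearZ enormrZ normc_real ger0_norm 1?mulrC.
Qed.

Lemma opnorm_ge0 T : 0 <= opnorm (to_op T).
Proof.
apply: le_trans (_ : vnorm (to_op T (0 : H)) <= _); first exact: sqrtr_ge0.
apply: (ub_le_sup (opnorm_has_sup T).2); exists (0 : H) => //.
by split; [exact: ell2_l2|rewrite -normr_vnorm normr0].
Qed.

Lemma opnormD T S : opnorm (to_op (T + S)) <= opnorm (to_op T) + opnorm (to_op S).
Proof.
apply: opnorm_le => [|x]; first by rewrite addr_ge0 ?opnorm_ge0.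
by rewrite blinD mulrDl (le_trans (ler_normD _ _)) ?lerD ?normr_le_opnorm.
Qed.

Lemma opnorm_eq0 T : opnorm (to_op T) = 0 -> T = 0.
Proof.
move=> T0; apply: blinP => x; apply/eqP; rewrite -normr_eq0 eq_le normr_ge0 andbT.
by have := normr_le_opnorm T x; rewrite T0 mul0r.
Qed.

Lemma opnormZ a T : opnorm (to_op (a *: T)) = normc a * opnorm (to_op T).
Proof.
have opnormZ_le b S : opnorm (to_op (b *: S)) <= normc b * opnorm (to_op S).
  apply: opnorm_le => [|x]; first by rewrite mulr_ge0 ?normc_ge0 ?opnorm_ge0.
  by rewrite enormrZ -mulrA ler_wpM2l ?normc_ge0 ?normr_le_opnorm.
apply: le_anti; rewrite opnormZ_le /=; have [->|a0] := eqVneq a 0.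
  by rewrite normc0 mul0r opnorm_ge0.
have na : 0 < normc a.
  by rewrite lt_def normc_ge0 andbT; apply: contra_neq a0; exact: eq0_normc.
by rewrite -ler_pdivlMl // -normcV -{1}[T](scalerK a0) opnormZ_le.
Qed.

Lemma opnormMn T n : opnorm (to_op (T *+ n)) = opnorm (to_op T) *+ n.
Proof.
by rewrite -scaler_nat opnormZ -(rmorph_nat (real_complex R)) normc_real
  normr_nat mulr_natl.
Qed.

Lemma opnormN T : opnorm (to_op (- T)) = opnorm (to_op T).
Proof. by rewrite -scaleN1r opnormZ normcN normc1 mul1r. Qed.

HB.instance Definition _ := Num.Zmodule_isNormed.Build R blin
  opnormD opnorm_eq0 opnormMn opnormN.

Lemma opnorm_to_op T : opnorm (to_op T) = `|T|. Proof. by []. Qed.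

Lemma ler_blin_norm T x : `|T x| <= `|T| * `|x|.
Proof. exact: normr_le_opnorm. Qed.

Lemma blin_norm_le T (d : R) : 0 <= d -> (forall x, `|T x| <= d * `|x|) -> `|T| <= d.
Proof. exact: opnorm_le. Qed.

Lemma ler_blin_dot T x y : normc (dot (T x) y) <= `|T| * `|x| * `|y|.
Proof.
by apply: le_trans (dot_CauchySchwarz _ _) _; rewrite ler_wpM2r ?ler_blin_norm.
Qed.

Lemma blin_norm_le_dot T (d : R) : 0 <= d ->
  (forall x y, normc (dot (T x) y) <= d * `|x| * `|y|) -> `|T| <= d.
Proof.
move=> d0 Td; apply: blin_norm_le => // x; apply: normr_le_dot => //.
by rewrite mulr_ge0.
Qed.

Lemma blin_normM T S : `|T * S| <= `|T| * `|S|.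
Proof.
apply: blin_norm_le => [|x]; first by rewrite mulr_ge0.
by rewrite blinM (le_trans (ler_blin_norm _ _)) // -mulrA ler_wpM2l ?ler_blin_norm.
Qed.

End BoundedOperators.

(** * Orthonormal families *)

Lemma exists_left_kernel (F : fieldType) (m n : nat) (M : 'M[F]_(m, n)) : (n < m)%N ->
  exists2 a : 'rV[F]_m, a != 0 & forall j, \sum_i a 0 i * M i j = 0.
Proof.
move=> nm; have kerM : kermx M != 0.
  by rewrite -mxrank_eq0 mxrank_ker subn_eq0 -ltnNge (leq_ltn_trans (rank_leq_col M)).
exists (nz_row (kermx M)) => [|j]; first by rewrite nz_row_eq0.
have /sub_kermxP/matrixP/(_ 0 j) := nz_row_sub (kermx M).
by rewrite !mxE.
Qed.

Lemma big_mkseq (V : Type) (idx : V) (op : V -> V -> V) (T : Type) (f : nat -> T)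
    (n : nat) (F : T -> V) :
  \big[op/idx]_(x <- mkseq f n) F x = \big[op/idx]_(k < n) F (f k).
Proof. by rewrite big_map -{1}[n]subn0 -/(index_iota 0 n) big_mkord. Qed.

Section Orthonormal.
Variable R : realType.
Local Notation C := R[i].
Local Notation H := (ell2 R).
Local Notation orthonormal := (orthonormal (@dot R)).
Implicit Types (x y e : H) (es fs vs : seq H).

Lemma orthonormal_dot es : orthonormal es -> {in es &, forall e f, dot e f = (e == f)%:R}.
Proof. by case/orthonormalP. Qed.

Lemma orthonormal_normr es e : orthonormal es -> e \in es -> `|e| = 1.
Proof.
move=> oes ees; apply/eqP; rewrite -(@eqrXn2 _ 2) // expr1n.
by rewrite -(inj_eq (@complexI R)) -dotxx (orthonormal_dot oes) ?eqxx.
Qed.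

Definition perp es x := {in es, forall e, dot x e = 0}.

Lemma perp_cat es fs x : perp (es ++ fs) x <-> perp es x /\ perp fs x.
Proof.
split=> [p|[pe pf] e]; last by rewrite mem_cat => /orP[/pe|/pf].
by split=> e ee; apply: p; rewrite mem_cat ee ?orbT.
Qed.

Lemma perp_cons es e x : perp (e :: es) x <-> dot x e = 0 /\ perp es x.
Proof.
split=> [p|[xe pe] f]; last by rewrite inE => /orP[/eqP-> //|/pe].
by split=> [|f fe]; apply: p; rewrite ?mem_head // inE fe orbT.
Qed.

Lemma perpZ es a x : perp es x -> perp es (a *: x).
Proof. by move=> px e ee; rewrite dotZl px // mulr0. Qed.

Lemma orthonormal_cons es e :
  orthonormal es -> perp es e -> `|e| = 1 -> orthonormal (e :: es).
Proof.
move=> oes pe ne; rewrite -cat1s orthonormal_cat oes /= !andbT.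
by rewrite /orthonormal /= dotxx ne expr1n eqxx; apply/allP => f /pe /eqP.
Qed.

Lemma orthonormal_catC es fs : orthonormal (es ++ fs) = orthonormal (fs ++ es).
Proof.
apply/idP/idP => o; apply: (sub_orthonormal _ _ o); try by move=> e; rewrite !mem_cat orbC.
  by rewrite uniq_catC; case/orthonormalP: o.
by rewrite uniq_catC; case/orthonormalP: o.
Qed.

Definition rank_one (u v : H) : blin R.
Proof.
apply: (@mk_blin R (fun x => dot x v *: u)) => [a x y|].
  by rewrite dotDl dotZl scalerDl scalerA.
exists (`|v| * `|u|) => x; rewrite enormrZ mulrAC ler_wpM2r //.
by rewrite [leRHS]mulrC dot_CauchySchwarz.
Defined.

Definition proj es : blin R := \sum_(e <- es) rank_one e e.

Lemma projE es x : proj es x = \sum_(e <- es) dot x e *: e.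
Proof. exact: blin_sum. Qed.

Lemma proj_cons e es x : proj (e :: es) x = dot x e *: e + proj es x.
Proof. by rewrite !projE big_cons. Qed.

Lemma dot_projl es x y : dot (proj es x) y = \sum_(e <- es) dot x e * dot e y.
Proof. by rewrite projE dot_suml; apply: eq_bigr => e _; rewrite dotZl. Qed.

Lemma dot_projr es x y : dot x (proj es y) = \sum_(e <- es) dot x e * dot e y.
Proof.
by rewrite projE dot_sumr; apply: eq_bigr => e _; rewrite dotZr -dotC mulrC.
Qed.

Lemma proj_selfadjoint es x y : dot (proj es x) y = dot x (proj es y).
Proof. by rewrite dot_projl dot_projr. Qed.

Lemma proj_perp es x : perp es x -> proj es x = 0.
Proof. by move=> px; rewrite projE big_seq big1 // => e /px ->; rewrite scale0r. Qed.

Lemma dot_proj_perp es x y : perp es y -> dot (proj es x) y = 0.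
Proof. by move=> py; rewrite proj_selfadjoint proj_perp ?dot0r. Qed.

Lemma proj_mem es e : orthonormal es -> e \in es -> proj es e = e.
Proof.
move=> oes ees; have /orthonormalP[uniq_es _] := oes.
rewrite projE (bigD1_seq e) //= (orthonormal_dot oes) // eqxx scale1r.
rewrite big_seq_cond big1 ?addr0 // => f /andP[fes fe].
by rewrite (orthonormal_dot oes) // eq_sym (negbTE fe) scale0r.
Qed.

Lemma dot_proj_mem es x e : orthonormal es -> e \in es -> dot (proj es x) e = dot x e.
Proof. by move=> oes ees; rewrite proj_selfadjoint proj_mem. Qed.

Lemma proj_idem es x : orthonormal es -> proj es (proj es x) = proj es x.
Proof.
move=> oes; rewrite [LHS]projE [RHS]projE; apply: eq_big_seq => e ees.
by rewrite dot_proj_mem.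
Qed.

Lemma perp_subproj es x : orthonormal es -> perp es (x - proj es x).
Proof. by move=> oes e ees; rewrite dotBl dot_proj_mem // subrr. Qed.

Lemma normr_proj_pythagoras es x : orthonormal es ->
  `|x| ^+ 2 = `|proj es x| ^+ 2 + `|x - proj es x| ^+ 2.
Proof.
move=> oes; rewrite -normr_pythagoras; first by rewrite addrC subrK.
exact/dot_proj_perp/perp_subproj.
Qed.

Lemma normr_proj_le es x : orthonormal es -> `|proj es x| <= `|x|.
Proof.
move=> oes; rewrite -(@ler_pXn2r _ 2) ?nnegrE //.
by rewrite (normr_proj_pythagoras x oes) lerDl sqr_ge0.
Qed.

Lemma normr_subproj_le es x : orthonormal es -> `|x - proj es x| <= `|x|.
Proof.
move=> oes; rewrite -(@ler_pXn2r _ 2) ?nnegrE //.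
by rewrite (normr_proj_pythagoras x oes) lerDr sqr_ge0.
Qed.

Lemma sqr_normr_proj es x : orthonormal es ->
  `|proj es x| ^+ 2 = \sum_(e <- es) csq (dot x e).
Proof.
move=> oes; apply: (@complexI R).
rewrite -dotxx -proj_selfadjoint proj_idem // dot_projl rmorph_sum.
by apply: eq_bigr => e _ /=; rewrite (dotC x e) mul_conjC_csq.
Qed.

Lemma sqr_normr_comb (n : nat) (c : 'I_n -> C) (f : 'I_n -> H) :
  (forall i j, dot (f i) (f j) = (i == j)%:R) ->
  `|\sum_i c i *: f i| ^+ 2 = \sum_i csq (c i).
Proof.
move=> of_; apply: (@complexI R); rewrite -dotxx dot_suml rmorph_sum.
apply: eq_bigr => i _; rewrite dotZl dot_sumr (bigD1 i) //= big1 => [|j ji].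
  by rewrite addr0 dotZr of_ eqxx mulr1 mul_conjC_csq.
by rewrite dotZr of_ eq_sym (negbTE ji) mulr0.
Qed.

Lemma orthonormal_comb_eq0 (n : nat) (a : 'rV[C]_n) (f : 'I_n -> H) :
  (forall i j, dot (f i) (f j) = (i == j)%:R) -> \sum_i a 0 i *: f i = 0 -> a = 0.
Proof.
move=> of_ af0; apply/rowP => i; rewrite mxE; apply/eqP; rewrite -csq_eq0.
have := sqr_normr_comb (fun i => a 0 i) of_; rewrite af0 normr0 expr0n.
by move=> /esym/psumr_eq0P -> // j _; exact: csq_ge0.
Qed.

Lemma orthonormal_nth es (i j : 'I_(size es)) :
  orthonormal es -> dot es`_i es`_j = (i == j)%:R.
Proof.
move=> oes; have /orthonormalP[uniq_es _] := oes.
by rewrite (orthonormal_dot oes) ?mem_nth // nth_uniq.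
Qed.

Lemma gram_schmidt es vs : orthonormal es -> exists fs,
  [/\ orthonormal (es ++ fs), (size fs <= size vs)%N &
      forall x, perp (es ++ fs) x -> perp vs x].
Proof.
move=> oes; elim: vs => [|v vs [fs [ofs size_fs perp_fs]]].
  by exists [::]; rewrite cats0.
set r := v - proj (es ++ fs) v.
have perp_v x : perp (es ++ fs) x -> dot x r = 0 -> perp (v :: vs) x.
  move=> px xr; apply/perp_cons; split; last exact: perp_fs.
  by rewrite -(subrK (proj (es ++ fs) v) v) dotDr xr -proj_selfadjoint proj_perp ?dot0l ?addr0.
have [r0|r0] := eqVneq r 0.
  exists fs; split=> //; first exact: leqW.
  by move=> x px; apply: perp_v; rewrite // r0 dot0r.
exists (normalize r :: fs); split=> //.
  rewrite orthonormal_catC /= ; apply: orthonormal_cons; rewrite ?normr_normalize //.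
    by rewrite orthonormal_catC.
  by apply: perpZ => e; rewrite mem_cat orbC -mem_cat; exact: perp_subproj.
move=> x /perp_cat[px /perp_cons[xr pfx]]; apply: perp_v; first exact/perp_cat.
move/eqP: xr; rewrite dotZr mulf_eq0 conjC_eq0 => /orP[|/eqP //].
by rewrite (inj_eq (@complexI R) _ 0) invr_eq0 normr_eq0 (negbTE r0).
Qed.

Lemma orthogonalization vs : exists es,
  [/\ orthonormal es, (size es <= size vs)%N & forall x, perp es x -> perp vs x].
Proof. exact: (@gram_schmidt [::]). Qed.

End Orthonormal.

Section StandardBasis.
Variable R : realType.
Local Notation C := R[i].
Local Notation H := (ell2 R).
Local Notation orthonormal := (orthonormal (@dot R)).
Implicit Types (x : H) (e : nat -> H).

Definition orthonormal_seq e := forall i j, dot (e i) (e j) = (i == j)%:R.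

Lemma orthonormal_seq_inj e : orthonormal_seq e -> injective e.
Proof.
move=> oe i j eij; have := oe i j; rewrite eij oe eqxx.
by case: eqP => // _ /eqP; rewrite oner_eq0.
Qed.

Lemma orthonormal_mkseq e n : orthonormal_seq e -> orthonormal (mkseq e n).
Proof.
move=> oe; apply/orthonormalP; split.
  by rewrite map_inj_uniq ?iota_uniq //; exact: orthonormal_seq_inj.
move=> _ _ /mapP[i _ ->] /mapP[j _ ->].
by rewrite /= oe (inj_eq (orthonormal_seq_inj oe)).
Qed.

Lemma perp_mkseqP e n x : perp (mkseq e n) x <-> forall k, (k < n)%N -> dot x (e k) = 0.
Proof.
split=> [px k kn|xe _ /mapP[k + ->]]; last by rewrite mem_iota; exact: xe.
by apply: px; apply/mapP; exists k; rewrite ?mem_iota.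
Qed.

Lemma proj_mkseq e n x : proj (mkseq e n) x = \sum_(k < n) dot x (e k) *: e k.
Proof. by rewrite projE big_mkseq. Qed.

Lemma bessel_inequality e n x : orthonormal_seq e ->
  \sum_(k < n) csq (dot x (e k)) <= `|x| ^+ 2.
Proof.
move=> oe; have oes := orthonormal_mkseq n oe.
by rewrite -(big_mkseq _ _ e n (fun f => csq (dot x f))) -sqr_normr_proj //
  lerXn2r ?nnegrE ?normr_proj_le.
Qed.

Lemma l2_delta k : l2 (fun j => (j == k)%:R : C).
Proof.
exists 1 => n; have [kn|nk] := ltnP k n; last first.
  rewrite big1 // => j _; rewrite ltn_eqF ?(leq_trans (ltn_ord j)) //.
  by rewrite csq0.
rewrite (bigD1 (Ordinal kn)) //= eqxx big1 => [|j jk].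
  by rewrite addr0 -(rmorph1 (real_complex R)) csq_real expr1n.
by move: jk; rewrite -(inj_eq val_inj) /= => /negbTE ->; rewrite csq0.
Qed.

Definition delta k : H := mk_ell2 (l2_delta k).

Lemma deltaE k j : delta k j = (j == k)%:R.
Proof. by []. Qed.

Lemma dot_delta x k : dot x (delta k) = x k.
Proof.
have coordE j : x j * (delta k j)^* = if j == k then x j else 0.
  by rewrite deltaE rmorph_nat; case: eqP; rewrite ?mulr1 ?mulr0.
rewrite /dot /cinner; apply/eqP; rewrite eq_complex; apply/andP; split; apply/eqP => /=.
  rewrite -[RHS](rsum_delta (fun j => complex.Re (x j))); congr rsum.
  by apply/funext => j; rewrite coordE; case: eqP.
rewrite -[RHS](rsum_delta (fun j => complex.Im (x j))); congr rsum.
by apply/funext => j; rewrite coordE; case: eqP.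
Qed.

Lemma delta_orthonormal : orthonormal_seq delta.
Proof. by move=> i j; rewrite dot_delta deltaE eq_sym. Qed.

Lemma exists_proj_delta_close x (eps : R) : 0 < eps ->
  exists n, `|x - proj (mkseq delta n) x| <= eps.
Proof.
move=> eps0.
have [n tail_n] : exists n, `|x| ^+ 2 - eps ^+ 2 < \sum_(k < n) csq (x k).
  apply/not_existsP => no_n; have : `|x| ^+ 2 <= `|x| ^+ 2 - eps ^+ 2.
    rewrite [leLHS]sqr_normr_rsum; apply: rsum_le; first exact/l2_rsummable/ell2_l2.
    by move=> n; rewrite leNgt; exact/negP/no_n.
  by rewrite lerDl oppr_ge0 leNgt exprn_gt0.
exists n; rewrite -(@ler_pXn2r _ 2) ?nnegrE ?(ltW eps0) //.
have odn := orthonormal_mkseq n delta_orthonormal.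
have := normr_proj_pythagoras x odn; rewrite sqr_normr_proj // big_mkseq.
by under eq_bigr do rewrite dot_delta; move: tail_n; lra.
Qed.

Lemma exists_perp (es : seq H) : exists2 x, `|x| = 1 & perp es x.
Proof.
have [a a0 ker] := exists_left_kernel
  (\matrix_(i < (size es).+1, j < size es) dot (delta i) es`_j) (ltnSn _).
pose x := \sum_(i < (size es).+1) a 0 i *: delta i.
have x0 : x != 0.
  apply: contra_neq a0; apply: orthonormal_comb_eq0 => i j.
  by rewrite delta_orthonormal (inj_eq val_inj).
exists (normalize x); first exact: normr_normalize.
apply: perpZ => e /(nthP 0)[j jes <-]; rewrite dot_suml -[RHS](ker (Ordinal jes)).
by apply: eq_bigr => i _; rewrite dotZl mxE.
Qed.

Lemma orthonormal_extend (es : seq H) n : orthonormal es ->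
  exists2 fs, orthonormal (es ++ fs) & size fs = n.
Proof.
move=> oes; elim: n => [|n [fs ofs size_fs]]; first by exists [::]; rewrite ?cats0.
have [x x1 px] := exists_perp (es ++ fs).
exists (x :: fs); last by rewrite /= size_fs.
rewrite orthonormal_catC; apply: orthonormal_cons => //.
  by rewrite orthonormal_catC.
by move=> e; rewrite mem_cat orbC -mem_cat; exact: px.
Qed.

End StandardBasis.

(** * Adjoints *)

Section Analysis.
Variable R : realType.
Local Notation C := R[i].
Local Notation H := (ell2 R).
Implicit Types (x y : H) (e : nat -> H) (T S : blin R).

Definition bessel_bound (M : R) e := forall n (c : nat -> C),
  `|\sum_(k < n) c k *: e k| ^+ 2 <= M ^+ 2 * \sum_(k < n) csq (c k).

Lemma orthonormal_bessel e : orthonormal_seq e -> bessel_bound 1 e.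
Proof.
by move=> oe n c; rewrite expr1n mul1r sqr_normr_comb.
Qed.

Section BesselSequence.
Variables (M : R) (e : nat -> H).
Hypotheses (M_ge0 : 0 <= M) (eM : bessel_bound M e).

Lemma sum_csq_coefs_le x n : \sum_(k < n) csq (dot x (e k)) <= (M * `|x|) ^+ 2.
Proof.
set s := \sum_(_ < _) _; pose z : H := \sum_(k < n) dot x (e k) *: e k.
have s0 : 0 <= s by apply: sumr_ge0 => k _; exact: csq_ge0.
have xz : dot x z = s%:C%C.
  rewrite dot_sumr rmorph_sum; apply: eq_bigr => k _ /=.
  by rewrite dotZr mulrC mul_conjC_csq.
have zs : `|z| ^+ 2 <= M ^+ 2 * s := eM n (fun k => dot x (e k)).
have := dot_CauchySchwarz x z; rewrite xz normc_real ger0_norm // => sxz.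
have {}sxz : s ^+ 2 <= (M * `|x|) ^+ 2 * s.
  apply: le_trans (_ : (`|x| * `|z|) ^+ 2 <= _); first by rewrite lerXn2r ?nnegrE ?mulr_ge0.
  by rewrite !exprMn [leRHS]mulrAC [leLHS]mulrC ler_wpM2r ?sqr_ge0.
have [->|sn0] := eqVneq s 0; first exact: sqr_ge0.
by move: sxz; rewrite expr2 ler_pM2r // lt_def sn0.
Qed.

Lemma l2_coefs x : l2 (fun k => dot x (e k)).
Proof. by exists ((M * `|x|) ^+ 2) => n; exact: sum_csq_coefs_le. Qed.

Lemma normr_coefs_le x : `|mk_ell2 (l2_coefs x)| <= M * `|x|.
Proof.
rewrite -(@ler_pXn2r _ 2) ?nnegrE ?mulr_ge0 // sqr_normr_rsum.
by apply: rsum_le (sum_csq_coefs_le x); exact/l2_rsummable/ell2_l2.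
Qed.

Definition analysis_op : blin R.
Proof.
apply: (@mk_blin R (fun x => mk_ell2 (l2_coefs x))) => [a x y|]; last first.
  by exists M; exact: normr_coefs_le.
by apply: ell2P => k; rewrite ell2D ell2Z /= dotDl dotZl.
Defined.

Lemma analysis_opE x k : analysis_op x k = dot x (e k).
Proof. by []. Qed.

Lemma analysis_op_norm_le : `|analysis_op| <= M.
Proof. exact/blin_norm_le/normr_coefs_le. Qed.

End BesselSequence.

Lemma bessel_blin T : bessel_bound `|T| (fun k => T (delta R k)).
Proof.
move=> n c; under eq_bigr do rewrite -linearZ.
rewrite -linear_sum /= -(@sqr_normr_comb R n c (fun k => delta R k)).
  by rewrite -exprMn lerXn2r ?nnegrE ?mulr_ge0 ?ler_blin_norm.
by move=> i j; rewrite delta_orthonormal (inj_eq val_inj).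
Qed.

Definition adj T : blin R := analysis_op (normr_ge0 T) (bessel_blin T).

Lemma adjE T y k : adj T y k = dot y (T (delta R k)).
Proof. by []. Qed.

Lemma dot_adj T x y : dot (T x) y = dot x (adj T y).
Proof.
apply/eqP; rewrite -subr_eq0; apply/eqP/eq0_normc/eqP.
rewrite eq_le normc_ge0 andbT; apply/ler_addgt0Pr => eps eps0; rewrite add0r.
pose K := `|T| * `|y| + `|adj T y| + 1.
have K0 : 0 < K by rewrite ltr_wpDl // addr_ge0 ?mulr_ge0.
have [n x_near] := @exists_proj_delta_close R x (eps / K) (divr_gt0 eps0 K0).
set p := proj _ _ in x_near.
have pE : dot (T p) y = dot p (adj T y).
  rewrite /p proj_mkseq linear_sum !dot_suml; apply: eq_bigr => k _.
  by rewrite linearZ !dotZl (dotC (adj T y)) (dot_delta (adj T y)) adjE -dotC.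
have -> : dot (T x) y - dot x (adj T y) = dot (T (x - p)) y - dot (x - p) (adj T y).
  by rewrite linearB !dotBl pE opprB addrA subrK.
apply: le_trans (normcB _ _) _; apply: le_trans (_ : K * `|x - p| <= _); last first.
  by rewrite mulrC -ler_pdivlMr.
rewrite !mulrDl mul1r -addrA lerD //.
  by apply: le_trans (ler_blin_dot _ _ _) _; rewrite mulrAC.
apply: le_trans (dot_CauchySchwarz _ _) _.
by rewrite mulrC lerDl.
Qed.

Lemma dot_adjr T x y : dot (adj T x) y = dot x (T y).
Proof. by rewrite dotC -dot_adj -dotC. Qed.

Lemma adj_unique T S : (forall x y, dot (T x) y = dot x (S y)) -> adj T = S.
Proof.
move=> TS; apply: blinP => y; apply: dot_inj => x.
by rewrite dotC -dot_adj TS -dotC.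
Qed.

Lemma adjK : involutive adj.
Proof. by move=> T; apply: adj_unique => x y; rewrite dot_adjr. Qed.

Lemma adjM T S : adj (T * S) = adj S * adj T.
Proof. by apply: adj_unique => x y; rewrite !blinM !dot_adj. Qed.

Lemma adj_comb (a : C) T S : adj (a *: T + S) = a^* *: adj T + adj S.
Proof.
apply: adj_unique => x y; rewrite !blinD !blinZ dotDl dotDr dotZl dotZr conjCK.
by rewrite !dot_adj.
Qed.

Lemma adjB T S : adj (T - S) = adj T - adj S.
Proof.
by apply: adj_unique => x y; rewrite !blinB dotBl dotBr !dot_adj.
Qed.

Lemma adj_proj es : adj (proj es) = proj es.
Proof. by apply: adj_unique => x y; exact: proj_selfadjoint. Qed.

Lemma adj_norm_le T : `|adj T| <= `|T|.
Proof. exact: analysis_op_norm_le. Qed.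

End Analysis.

(** * Positive operators *)

Section PositiveOperators.
Variable R : realType.
Local Notation C := R[i].
Local Notation H := (ell2 R).
Implicit Types (x y : H) (T : blin R).

Definition positive T := forall x, 0 <= dot (T x) x.

Definition quad T x : R := complex.Re (dot (T x) x).

Lemma pos_opP T : pos_op (to_op T) <-> positive T.
Proof.
split=> [[_ pT] x|pT]; first by have := pT x (ell2_l2 x); rewrite to_opE.
split; first exact: bounded_to_op.
by move=> _ /l2_ell2[x ->]; rewrite to_opE; exact: pT.
Qed.

Lemma positive_quadE T x : positive T -> dot (T x) x = (quad T x)%:C%C.
Proof. by move=> pT; rewrite /quad RRe_real // ger0_real. Qed.

Lemma quad_ge0 T x : positive T -> 0 <= quad T x.
Proof. by move=> pT; rewrite -ler0c -positive_quadE. Qed.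

Lemma quad_le_normr T x : quad T x <= `|T| * `|x| ^+ 2.
Proof.
by apply: le_trans (Re_le_normc _) _; rewrite expr2 mulrA ler_blin_dot.
Qed.

Lemma quadZ T (a : C) x : quad T (a *: x) = csq a * quad T x.
Proof.
rewrite /quad linearZ dotZl dotZr mulrA mul_conjC_csq.
by case: (dot _ _) => u v /=; rewrite mul0r subr0.
Qed.

Definition op_form T x y : C := dot (T x) y.

Lemma op_form_bilinear T : bilinear_for *%R ((@Num.conj C : C -> C) \; *%R) (op_form T).
Proof.
split=> [z a x y|x a y z] /=; first by rewrite /op_form linearP dotDl dotZl.
by rewrite /op_form dotDr dotZr.
Qed.

HB.instance Definition _ T := bilinear_isBilinear.Build C H H C
  *%R ((@Num.conj C : C -> C) \; *%R) (op_form T) (op_form_bilinear T).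

Lemma positive_dotC T x y : positive T -> dot (T y) x = (dot (T x) y)^*.
Proof. by move=> pT; exact: (@sesquilinear_ge0_conj C H (op_form T) pT x y). Qed.

Lemma positive_adj T : positive T -> adj T = T.
Proof.
by move=> pT; apply: adj_unique => x y; rewrite (dotC (T y)) -positive_dotC.
Qed.

Lemma positive_CauchySchwarz T x y : positive T ->
  normc (dot (T x) y) ^+ 2 <= quad T x * quad T y.
Proof.
move=> pT; rewrite -lecR rmorphXn rmorphM /= -!positive_quadE //.
exact: (@sesquilinear_CauchySchwarz C H (op_form T) pT x y).
Qed.

Lemma positive_norm_le T (d : R) : positive T -> 0 <= d ->
  (forall x, quad T x <= d * `|x| ^+ 2) -> `|T| <= d.
Proof.
move=> pT d0 Td; apply: blin_norm_le_dot => // x y.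
rewrite -(@ler_pXn2r _ 2) ?nnegrE ?mulr_ge0 ?normc_ge0 //.
apply: le_trans (positive_CauchySchwarz x y pT) _.
have -> : (d * `|x| * `|y|) ^+ 2 = (d * `|x| ^+ 2) * (d * `|y| ^+ 2) by ring.
by rewrite ler_pM ?quad_ge0.
Qed.

End PositiveOperators.

(** * Singular values *)

Section SingularValues.
Variable R : realType.
Local Notation C := R[i].
Local Notation H := (ell2 R).
Local Notation orthonormal := (orthonormal (@dot R)).
Implicit Types (x y : H) (T S U V : blin R) (es : seq H).

Lemma sum_nth_widen (V : nmodType) (F : H -> V) es n : F 0 = 0 -> (size es <= n)%N ->
  \sum_(e <- es) F e = \sum_(i < n) F es`_i.
Proof.
move=> F0 es_n; rewrite (big_nth 0) big_mkord (big_ord_widen n (fun i => F es`_i)) //.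
rewrite big_mkcond; apply: eq_bigr => i _.
by case: ltnP => // ni; rewrite nth_default.
Qed.

Lemma rank_le_mul_proj U S es n : (size es <= n)%N -> rank_le (to_op (U * proj es * S)) n.
Proof.
move=> es_n; exists (fun i => U es`_i) => _ /l2_ell2[x ->].
exists (fun i => dot (S x) es`_i); rewrite to_opE !blinM projE linear_sum.
rewrite (@sum_nth_widen _ (fun e => U (dot (S x) e *: e)) _ n) ?scaler0 ?linear0 //.
by apply/funext => k; elim/big_rec2: _ => // i y z _ <-; rewrite linearZ.
Qed.

Lemma size_orthonormal_range S es n : rank_le (to_op S) n -> orthonormal es ->
  {in es, forall e, exists x, e = S x} -> (size es <= n)%N.
Proof.
move=> [v Sv] oes range_es; rewrite leqNgt; apply/negP => n_es.
have /choice[c esE] : forall i : 'I_(size es), exists c : 'I_n -> C,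
    ell2_val es`_i = (fun k => \sum_(j < n) c j * v j k).
  move=> i; have [x ->] := range_es _ (mem_nth 0 (ltn_ord i)).
  by have [c] := Sv x (ell2_l2 x); rewrite to_opE; exists c.
have [a a0 ker] := exists_left_kernel (\matrix_(i, j) c i j) n_es.
have comb0 : \sum_i a 0 i *: es`_i = 0 :> H.
  apply: ell2P => k; transitivity (\sum_i a 0 i * es`_i k).
    by elim/big_rec2: _ => // i y z _ <-.
  under eq_bigr do rewrite esE mulr_sumr.
  rewrite exchange_big big1 //= => j _; under eq_bigr do rewrite mulrA.
  rewrite -mulr_suml -[X in X * _](_ : \sum_i a 0 i * (\matrix_(i, j) c i j) i j = _).
    by rewrite ker mul0r.
  by apply: eq_bigr => i _; rewrite mxE.
case/negP: a0; apply/eqP; apply: orthonormal_comb_eq0 comb0 => i j.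
exact: orthonormal_nth.
Qed.

(* The spanning vectors in [rank_le] need not be square summable, hence the maximal
   orthonormal family inside the range of [S]. *)
Lemma rank_le_proj S n : rank_le (to_op S) n ->
  exists es, [/\ orthonormal es, (size es <= n)%N & proj es * S = S].
Proof.
move=> rS; pose in_range es := {in es, forall e, exists x, e = S x}.
pose P m := `[< exists es, [/\ orthonormal es, size es = m & in_range es] >].
have P0 : exists m, P m by exists 0%N; apply/asboolP; exists [::].
have Pn m : P m -> (m <= n)%N.
  by move=> /asboolP[es [oes <- range_es]]; exact: size_orthonormal_range range_es.
case: (ex_maxnP P0 Pn) => m /asboolP[es [oes size_es range_es]] max_m.
exists es; split=> //; first by rewrite size_es; apply: Pn; apply/asboolP; exists es.
apply: blinP => x; apply/eqP; rewrite blinM eq_sym -subr_eq0; apply/negPn/negP => r0.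
set r := S x - _ in r0.
have [w rE] : exists w, r = S w.
  have /choice[u uE] : forall e, exists u, e \in es -> e = S u.
    move=> e; have [/range_es[u ->]|ne] := boolP (e \in es); first by exists u.
    by exists 0.
  exists (x - \sum_(e <- es) dot (S x) e *: u e).
  rewrite linearB linear_sum /r projE; congr (_ - _); apply: eq_big_seq => e ees.
  by rewrite linearZ {2}(uE _ ees).
suff : P m.+1 by move/max_m; rewrite ltnn.
apply/asboolP; exists (normalize r :: es); split; last 1 first.
- move=> e; rewrite inE => /predU1P[->|/range_es //].
  by exists ((`|r|^-1)%:C%C *: w); rewrite linearZ /= -rE.
- by apply: orthonormal_cons; rewrite ?normr_normalize //; exact/perpZ/perp_subproj.
- by rewrite /= size_es.
Qed.

Lemma rank_le_mul U S V n : rank_le (to_op S) n -> rank_le (to_op (U * S * V)) n.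
Proof.
move=> /rank_le_proj[es [_ size_es <-]]; rewrite mulrA -(mulrA _ S).
exact: rank_le_mul_proj.
Qed.

Lemma rank_leS S n : rank_le (to_op S) n -> rank_le (to_op S) n.+1.
Proof.
move=> /rank_le_proj[es [_ size_es <-]]; rewrite -[proj es]mul1r.
exact/rank_le_mul_proj/leqW.
Qed.

Let dist_set n T :=
  [set opnorm (opsub (to_op T) F) | F in [set F | bounded_op F /\ rank_le F n]].

Let dist_set_lb n T : lbound (dist_set n T) 0.
Proof.
by move=> _ [_ [/bounded_opP[S ->] _] <-]; rewrite opsub_to_op opnorm_to_op.
Qed.

Let dist_set_neq0 n T : dist_set n T !=set0.
Proof.
exists (opnorm (opsub (to_op T) (to_op 0))), (to_op 0) => //; split.
  exact: bounded_to_op.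
by have := @rank_le_mul_proj 0 0 [::] n isT; rewrite mulr0.
Qed.

Lemma smu_ge0 n T : 0 <= smu n (to_op T).
Proof. exact: lb_le_inf (dist_set_neq0 n T) (@dist_set_lb n T). Qed.

Lemma smu_le_dist n T S : rank_le (to_op S) n -> smu n (to_op T) <= `|T - S|.
Proof.
move=> rS; apply: ge_inf; first by exists 0; exact: dist_set_lb.
exists (to_op S); last by rewrite opsub_to_op.
by split=> //; exact: bounded_to_op.
Qed.

Lemma smu_lt n T (d : R) : smu n (to_op T) < d ->
  exists2 S, rank_le (to_op S) n & `|T - S| < d.
Proof.
move=> /inf_lt => /(_ (dist_set_neq0 n T)) [_ [_ [/bounded_opP[S ->] rS] <-]].
by rewrite opsub_to_op; exists S.
Qed.

Lemma smu_nonincreasing T : nonincreasing_seq (fun n => smu n (to_op T)).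
Proof.
apply/nonincreasing_seqP => n; apply/ler_addgt0Pr => eps eps0.
have [|S rS TS] := @smu_lt n T (smu n (to_op T) + eps); first by rewrite ltrDl.
exact: le_trans (smu_le_dist T (rank_leS rS)) (ltW TS).
Qed.

Lemma smu_mul_le U T V n : smu n (to_op (U * T * V)) <= `|U| * smu n (to_op T) * `|V|.
Proof.
apply/ler_addgt0Pr => eps eps0; pose K := `|U| * `|V|.
have K1 : 0 < K + 1 by rewrite ltr_wpDl ?mulr_ge0.
have [|S rS TS] := @smu_lt n T (smu n (to_op T) + eps / (K + 1)).
  by rewrite ltrDl divr_gt0.
apply: le_trans (smu_le_dist _ (rank_le_mul U V rS)) _.
rewrite -mulrBl -mulrBr; apply: le_trans (blin_normM _ _) _.
apply: le_trans (ler_wpM2r _ (blin_normM _ _)) _ => //.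
rewrite mulrAC -/K; apply: le_trans (ler_wpM2l _ (ltW TS)) _; first by rewrite mulr_ge0.
rewrite mulrDr -/K [`|U| * _ * _]mulrAC -/K lerD2l mulrCA.
by rewrite ler_piMr ?(ltW eps0) // ler_pdivrMr // mul1r lerDl.
Qed.

Lemma smu_le_perp n T es (d : R) : orthonormal es -> (size es <= n)%N -> 0 <= d ->
  (forall x, perp es x -> `|T x| <= d * `|x|) -> smu n (to_op T) <= d.
Proof.
move=> oes es_n d0 Td; apply: le_trans (smu_le_dist T (rank_le_mul_proj T 1 es_n)) _.
apply: blin_norm_le => // x; rewrite mulr1 blinB blinM -linearB.
apply: le_trans (Td _ (perp_subproj x oes)) _.
by rewrite ler_wpM2l ?normr_subproj_le.
Qed.

Lemma smu_ge n T es (d : R) : orthonormal es -> size es = n.+1 ->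
  (forall x, proj es x = x -> d * `|x| <= `|T x|) -> d <= smu n (to_op T).
Proof.
move=> oes size_es Td; rewrite leNgt; apply/negP => mu_d.
have [S rS TS] := smu_lt mu_d.
have [fs [_ size_fs SE]] := rank_le_proj rS.
have [|a a0 ker] := exists_left_kernel
  (\matrix_(i < size es, j < size fs) dot (S es`_i) fs`_j); first by rewrite size_es.
pose x := \sum_(i < size es) a 0 i *: es`_i.
have px : proj es x = x.
  by rewrite linear_sum; apply: eq_bigr => i _; rewrite linearZ /= proj_mem ?mem_nth.
have x0 : 0 < `|x|.
  rewrite normr_gt0; apply: contra_neq a0; apply: orthonormal_comb_eq0 => i j.
  exact: orthonormal_nth.
have Sx : S x = 0.
  rewrite -SE blinM proj_perp // => _ /(nthP 0)[j jfs <-].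
  rewrite linear_sum dot_suml -[RHS](ker (Ordinal jfs)).
  by apply: eq_bigr => i _; rewrite linearZ dotZl mxE.
have := Td x px; rewrite leNgt => /negP; apply.
rewrite -[T x](subr0) -Sx -blinB; apply: le_lt_trans (ler_blin_norm _ _) _.
by rewrite ltr_pM2r.
Qed.

End SingularValues.

(** * Diagonal operators *)

Section DiagonalOperators.
Variable R : realType.
Local Notation C := R[i].
Local Notation H := (ell2 R).
Variables (e : nat -> H) (w : nat -> R).
Hypotheses (oe : orthonormal_seq e) (w_ge0 : forall k, 0 <= w k).
Hypothesis w_anti : nonincreasing_seq w.
Implicit Types x : H.

Let csqwM k (z : C) n : (n <= k)%N -> csq ((w k)%:C%C * z) <= w n ^+ 2 * csq z.
Proof.
move=> nk; rewrite csqM csq_real ler_wpM2r ?csq_ge0 //.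
by rewrite lerXn2r ?nnegrE ?w_ge0 ?w_anti.
Qed.

Lemma weighted_bessel : bessel_bound (w 0%N) (fun k => (w k)%:C%C *: e k).
Proof.
move=> n c; under eq_bigr do rewrite scalerA mulrC.
rewrite sqr_normr_comb //.
by rewrite mulr_sumr; apply: ler_sum => k _; exact: csqwM.
Qed.

Let coefs := analysis_op ler01 (orthonormal_bessel oe).
Let weighted_coefs := analysis_op (w_ge0 0) weighted_bessel.

Let weighted_coefsE x k : weighted_coefs x k = (w k)%:C%C * dot x (e k).
Proof. by rewrite analysis_opE dotZr; congr (_ * _); exact: conjc_real. Qed.

Definition diag_op : blin R := adj coefs * weighted_coefs.

Lemma dot_diagE x :
  dot (diag_op x) x = (rsum (fun k => w k * csq (dot x (e k))))%:C%C.
Proof.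
have coordE k : weighted_coefs x k * (coefs x k)^* = (w k * csq (dot x (e k)))%:C%C.
  by rewrite weighted_coefsE -mulrA mul_conjC_csq -rmorphM.
rewrite blinM dot_adjr /dot /cinner; congr Complex.
  by congr rsum; apply/funext => k; rewrite coordE.
rewrite -[RHS](rsum_delta (fun=> 0) 0); congr rsum; apply/funext => k.
by rewrite coordE if_same.
Qed.

Lemma diag_rsummable x : rsummable (fun k => w k * csq (dot x (e k))).
Proof.
apply: rsummable_ge0 (w 0%N * `|x| ^+ 2) _ _ => [k|n]; first by rewrite mulr_ge0 ?csq_ge0.
apply: le_trans (_ : \sum_(k < n) w 0%N * csq (dot x (e k)) <= _).
  by apply: ler_sum => k _; rewrite ler_wpM2r ?csq_ge0 ?w_anti.
by rewrite -mulr_sumr ler_wpM2l // bessel_inequality.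
Qed.

Lemma positive_diag : positive diag_op.
Proof.
move=> x; rewrite dot_diagE ler0c; apply: le_trans (rsum_ge 0 _ (@diag_rsummable x)).
  by rewrite big_ord0.
by move=> k; rewrite mulr_ge0 ?csq_ge0.
Qed.

Lemma sum_le_quad_diag n x : \sum_(k < n) w k * csq (dot x (e k)) <= quad diag_op x.
Proof.
rewrite /quad dot_diagE; apply: rsum_ge (@diag_rsummable x) => k.
by rewrite mulr_ge0 ?csq_ge0.
Qed.

Lemma normr_diag_perp n x : perp (mkseq e n) x -> `|diag_op x| <= w n * `|x|.
Proof.
move=> /perp_mkseqP px; have coefs_le1 : `|adj coefs| <= 1.
  exact: le_trans (adj_norm_le _) (analysis_op_norm_le _ _).
rewrite blinM; apply: le_trans (ler_blin_norm _ _) _.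
apply: le_trans (_ : 1 * `|weighted_coefs x| <= _); first by rewrite ler_wpM2r.
rewrite mul1r -(@ler_pXn2r _ 2) ?nnegrE ?mulr_ge0 // exprMn sqr_normr_rsum.
apply: rsum_le => [|N]; first exact/l2_rsummable/ell2_l2.
apply: le_trans (_ : \sum_(k < N) w n ^+ 2 * csq (dot x (e k)) <= _).
  apply: ler_sum => k _; rewrite weighted_coefsE.
  have [/px ->|nk] := ltnP k n; last exact: csqwM.
  by rewrite mulr0 csq0 mulr_ge0 ?sqr_ge0 ?csq_ge0.
by rewrite -mulr_sumr ler_wpM2l ?sqr_ge0 // bessel_inequality.
Qed.

Lemma smu_diag n : smu n (to_op diag_op) = w n.
Proof.
apply: le_anti; apply/andP; split.
  apply: (smu_le_perp (orthonormal_mkseq n oe)); rewrite ?size_mkseq //.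
  by move=> x; exact: normr_diag_perp.
have oes := orthonormal_mkseq n.+1 oe.
apply: (smu_ge oes); rewrite ?size_mkseq // => x px.
have [->|x0] := eqVneq x 0; first by rewrite linear0 !normr0 mulr0.
rewrite -(@ler_pM2r _ `|x|) ?normr_gt0 // -mulrA -expr2.
apply: le_trans (le_trans (Re_le_normc _) (dot_CauchySchwarz (diag_op x) x)).
apply: le_trans (sum_le_quad_diag n.+1 x).
rewrite -{1}px sqr_normr_proj // big_mkseq mulr_sumr; apply: ler_sum => k _.
by rewrite ler_wpM2r ?csq_ge0 // w_anti // -ltnS.
Qed.

End DiagonalOperators.

(** * The weak trace ideal *)

Section TotallyBounded.
Variable R : realType.

Definition totally_bounded (V : normedZmodType R) (A : set V) := forall eps : R, 0 < eps ->
  exists s : seq V, forall x, A x -> exists2 y, y \in s & `|x - y| < eps.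

Lemma totally_bounded_segment (K : R) : totally_bounded [set r : R | `|r| <= K].
Proof.
move=> eps eps0.
exists [seq - K + i%:R * eps | i <- iota 0 (Num.truncn (2 * K / eps)).+1] => r r_le.
have /andP[Kr rK] : - K <= r <= K by rewrite -ler_norml.
have rK0 : 0 <= (r + K) / eps by rewrite divr_ge0 ?(ltW eps0) //; lra.
exists (- K + (Num.truncn ((r + K) / eps))%:R * eps).
  apply/mapP; exists (Num.truncn ((r + K) / eps)) => //.
  rewrite mem_iota add0n ltnS; apply: le_truncn.
  by rewrite ler_pM2r ?invr_gt0 //; lra.
have /andP[] := truncn_itv rK0; rewrite ler_pdivlMr // ltr_pdivrMr // -natr1.
by move=> lo hi; rewrite ltr_norml; apply/andP; split; lra.
Qed.

Lemma totally_bounded_lipschitz (V W : normedZmodType R) (f : V -> W) (L : R) (A : set V) :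
  (forall x y, `|f x - f y| <= L * `|x - y|) -> totally_bounded A -> totally_bounded (f @` A).
Proof.
move=> fL tA eps eps0; have L0 : 0 < `|L| + 1 by rewrite ltr_wpDl.
have [s sA] := tA _ (divr_gt0 eps0 L0).
exists (map f s) => _ [x /sA[y ys xy] <-]; exists (f y); first exact: map_f.
apply: le_lt_trans (fL x y) _; rewrite ltr_pdivlMr // mulrC in xy.
by apply: le_lt_trans xy; rewrite ler_wpM2r // (le_trans (ler_norm L)) // lerDl.
Qed.

Lemma totally_boundedD (V : normedZmodType R) (A B : set V) :
  totally_bounded A -> totally_bounded B ->
  totally_bounded [set z | exists x y, [/\ A x, B y & z = x + y]].
Proof.
move=> tA tB eps eps0; have eps2 : 0 < eps / 2 by rewrite divr_gt0.
have [s sA] := tA _ eps2; have [t tB'] := tB _ eps2.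
exists [seq a + b | a <- s, b <- t] => _ [x [y [/sA[a sa xa] /tB'[b tb yb] ->]]].
exists (a + b); first by apply/allpairsP; exists (a, b).
rewrite opprD addrACA; apply: le_lt_trans (ler_normD _ _) _.
by rewrite [eps]splitr ltrD.
Qed.

Lemma totally_bounded_sub (V : normedZmodType R) (A B : set V) :
  A `<=` B -> totally_bounded B -> totally_bounded A.
Proof.
by move=> AB tB eps /tB[s sB]; exists s => x /AB /sB.
Qed.

Lemma totally_bounded_proj (es : seq (ell2 R)) (K : R) :
  totally_bounded [set proj es x | x in [set x | `|x| <= K]].
Proof.
elim: es => [|e es IH].
  move=> eps eps0; exists [:: 0] => _ [x _ <-]; exists 0; first exact: mem_head.
  by rewrite projE big_nil subrr normr0.
have line (z : R[i]) : totally_bounded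
    ((fun r : R => (r%:C%C * z) *: e) @` [set r | `|r| <= K * `|e|]).
  apply: (@totally_bounded_lipschitz _ _ _ (normc z * `|e|)); last first.
    exact: totally_bounded_segment.
  move=> r s; rewrite -scalerBl -mulrBl -rmorphB enormrZ normcM normc_real.
  by rewrite -mulrA mulrC.
have := totally_boundedD (totally_boundedD (line 1) (line 'i%C)) IH.
apply: totally_bounded_sub => _ [x xK <-].
have xe : normc (dot x e) <= K * `|e|.
  by apply: le_trans (dot_CauchySchwarz _ _) _; rewrite ler_wpM2r.
exists (dot x e *: e), (proj es x); split; last exact: proj_cons; last by exists x.
exists (((complex.Re (dot x e))%:C%C * 1) *: e), (((complex.Im (dot x e))%:C%C * 'i%C) *: e).
split.
- by exists (complex.Re (dot x e)) => //=; apply: le_trans (normRe_le _) xe.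
- by exists (complex.Im (dot x e)) => //=; apply: le_trans (normIm_le _) xe.
- by rewrite -scalerDl mulr1 [_ * 'i%C]mulrC -complexE.
Qed.

End TotallyBounded.

Section WeakTraceIdeal.
Variable R : realType.
Local Notation C := R[i].
Local Notation H := (ell2 R).
Local Notation orthonormal := (orthonormal (@dot R)).
Implicit Types (x y : H) (T S : blin R) (es fs : seq H) (d K : R).

Definition small_off d T es := forall x, perp es x ->
  `|T x| <= d * `|x| /\ `|adj T x| <= d * `|x|.

Lemma small_off_ge0 d T es : small_off d T es -> 0 <= d.
Proof.
have [x x1 px] := exists_perp es; move=> /(_ x px)[+ _].
by rewrite x1 mulr1; exact: le_trans.
Qed.

Lemma small_off_le d d' T es : d <= d' -> small_off d T es -> small_off d' T es.
Proof.
move=> dd sT x /sT[Tx T'x].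
by split; [apply: le_trans Tx _|apply: le_trans T'x _]; rewrite ler_wpM2r.
Qed.

Lemma small_off_sub d T es fs : (forall x, perp fs x -> perp es x) ->
  small_off d T es -> small_off d T fs.
Proof. by move=> sub sT x /sub /sT. Qed.

Lemma small_off_adj d T es : small_off d T es -> small_off d (adj T) es.
Proof. by move=> sT x /sT[Tx T'x]; rewrite adjK. Qed.

Lemma small_off_positive d T es : positive T ->
  (forall x, perp es x -> `|T x| <= d * `|x|) -> small_off d T es.
Proof. by move=> pT Td x px; rewrite positive_adj //; split; exact: Td. Qed.

Lemma small_off_comb (a : C) d d' T S es : small_off d T es -> small_off d' S es ->
  small_off (normc a * d + d') (a *: T + S) es.
Proof.
move=> sT sS x px; have [Tx T'x] := sT x px; have [Sx S'x] := sS x px.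
rewrite adj_comb !blinD !blinZ; split; apply: le_trans (ler_normD _ _) _;
  by rewrite enormrZ ?normcJ_conj mulrDl -mulrA lerD // ler_wpM2l ?normc_ge0.
Qed.

Lemma small_off_rank S n : rank_le (to_op S) n -> exists es,
  [/\ orthonormal es, (size es <= 2 * n)%N & small_off 0 S es].
Proof.
move=> /rank_le_proj[fs [_ size_fs SE]].
have [es [oes size_es perp_es]] := orthogonalization (fs ++ map (adj S) fs).
exists es; split=> //.
  by apply: leq_trans size_es _; rewrite size_cat size_map addnn -mul2n leq_mul2l.
move=> x /perp_es/perp_cat[pfs pSfs]; rewrite !mul0r.
have -> : adj S x = 0 by rewrite -SE adjM adj_proj blinM proj_perp ?linear0.
rewrite -SE blinM proj_perp ?normr0 // => f ffs.
by rewrite dot_adj pSfs // map_f.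
Qed.

Lemma small_off_dist d T S es : `|T - S| <= d -> small_off 0 S es -> small_off d T es.
Proof.
move=> TS S0 x px; have [] := S0 x px; rewrite !mul0r !normr_le0 => /eqP Sx /eqP S'x.
have -> : T x = (T - S : blin R) x by rewrite blinB Sx subr0.
have -> : adj T x = adj (T - S) x by rewrite adjB blinB S'x subr0.
split; apply: le_trans (ler_blin_norm _ _) _; rewrite ler_wpM2r //.
exact: le_trans (adj_norm_le _) TS.
Qed.

Lemma small_off_norm d T es : orthonormal es -> small_off d T es ->
  `|T - T * proj es| <= d.
Proof.
move=> oes sT; have d0 := small_off_ge0 sT.
apply: blin_norm_le => // x; rewrite blinB blinM -linearB.
have [Tx _] := sT _ (perp_subproj x oes); apply: le_trans Tx _.
by rewrite ler_wpM2l ?normr_subproj_le.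
Qed.

Lemma small_off_norm_adj d T es : orthonormal es -> small_off d T es ->
  `|T - proj es * T| <= d.
Proof.
move=> oes /small_off_adj/(small_off_norm oes); apply: le_trans.
by rewrite -(adjK (T - _)) adjB adjM adj_proj adj_norm_le.
Qed.

Definition approx_family K n T es :=
  [/\ orthonormal es, (size es <= n)%N & small_off (K / n.+1%:R) T es].

Definition approximable T := exists K, forall n, exists es, approx_family K n T es.

Lemma approx_family_ge0 K n T es : approx_family K n T es -> 0 <= K.
Proof. by move=> [_ _ /small_off_ge0]; rewrite pmulr_lge0 // invr_gt0. Qed.

Lemma approx_family_le K K' n T es : K <= K' ->
  approx_family K n T es -> approx_family K' n T es.
Proof.
move=> KK [oes size_es sT]; split=> //; apply: small_off_le sT.
by rewrite ler_pM2r // invr_gt0.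
Qed.

Lemma approximable_adj T : approximable T -> approximable (adj T).
Proof.
move=> [K TK]; exists K => n; have [es [oes size_es sT]] := TK n.
by exists es; split=> //; exact: small_off_adj.
Qed.

Lemma inv_half_le n : (n./2.+1%:R)^-1 <= 2 / n.+1%:R :> R.
Proof.
rewrite ler_pdivlMr // mulrC ler_pdivrMr // -natrM ler_nat.
by have := odd_double_half n; case: (odd n) => /= <-; lia.
Qed.

(* Families for [T] and [S] at the index [n./2] are merged into one at [n]. *)
Lemma approximable_merge T S : approximable T -> approximable S -> exists K,
  forall n, exists es, approx_family K n T es /\ approx_family K n S es.
Proof.
move=> [K TK] [L SL]; exists (2 * (K + L)) => n.
have [es [oes size_es sT]] := TK n./2; have [fs [ofs size_fs sS]] := SL n./2.
have K0 := approx_family_ge0 (And3 oes size_es sT).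
have L0 := approx_family_ge0 (And3 ofs size_fs sS).
have [gs [ogs size_gs pgs]] := orthogonalization (es ++ fs).
have size_n : (size gs <= n)%N.
  apply: leq_trans size_gs _; rewrite size_cat; apply: leq_trans (leq_add size_es size_fs) _.
  by rewrite addnn -[leqRHS]odd_double_half leq_addl.
have weaken K' : 0 <= K' -> K' <= K + L -> K' / n./2.+1%:R <= 2 * (K + L) / n.+1%:R.
  move=> K'0 K'KL; rewrite [2 * _]mulrC -mulrA.
  by apply: ler_pM => //; exact: inv_half_le.
exists gs; split; split=> //.
  apply: small_off_le (weaken K K0 _) _; first by rewrite lerDl.
  by apply: small_off_sub sT => x /pgs/perp_cat[].
apply: small_off_le (weaken L L0 _) _; first by rewrite lerDr.
by apply: small_off_sub sS => x /pgs/perp_cat[].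
Qed.

Lemma approx_family_comb (a : C) K n T S es :
  approx_family K n T es -> approx_family K n S es ->
  approx_family ((normc a + 1) * K) n (a *: T + S) es.
Proof.
move=> [oes size_es sT] [_ _ sS]; split=> //.
by rewrite -mulrA mulrDl mul1r; exact: small_off_comb.
Qed.

Lemma approximable_comb (a : C) T S :
  approximable T -> approximable S -> approximable (a *: T + S).
Proof.
move=> aT aS; have [K TSK] := approximable_merge aT aS.
exists ((normc a + 1) * K) => n; have [es [Tes Ses]] := TSK n.
by exists es; exact: approx_family_comb.
Qed.

Lemma approximable_diag (e : nat -> H) (w : nat -> R) K (oe : orthonormal_seq e)
    (w_ge0 : forall k, 0 <= w k) (w_anti : nonincreasing_seq w) :
  (forall n, w n <= K / n.+1%:R) -> approximable (diag_op oe w_ge0 w_anti).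
Proof.
move=> wK; exists K => n; exists (mkseq e n); split.
- exact: orthonormal_mkseq.
- by rewrite size_mkseq.
- apply: small_off_positive; first exact: positive_diag.
  move=> x px; apply: le_trans (normr_diag_perp oe w_ge0 w_anti px) _.
  by rewrite ler_wpM2r.
Qed.

Lemma ltr_div_truncnS K (eps : R) : 0 < eps -> K / (Num.truncn (K / eps)).+1%:R < eps.
Proof.
by move=> eps0; rewrite ltr_pdivrMr // mulrC -ltr_pdivrMr // truncnS_gt.
Qed.

Lemma compact_approximable T : approximable T -> compact_op (to_op T).
Proof.
move=> [K TK] eps eps0; have eps2 : 0 < eps / 2 by rewrite divr_gt0.
have [es [oes _ sT]] := TK (Num.truncn (K / (eps / 2))).
have [s sP] := totally_bounded_proj es `|T| eps2.
exists (size s), (fun i : 'I_(size s) => ell2_val (s`_i : H)) => _ /l2_ell2[x ->].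
rewrite -normr_vnorm => x1.
have [|y ys Txy] := sP (proj es (T x)).
  by exists (T x) => //; apply: le_trans (ler_blin_norm _ _) _; rewrite ler_piMr.
have ys_size : (index y s < size s)%N by rewrite index_mem.
exists (Ordinal ys_size); rewrite to_opE /= nth_index //.
rewrite -[X in vnorm X]/(ell2_val (T x - y)) -normr_vnorm.
rewrite -(subrK (proj es (T x)) (T x)) -addrA [eps]splitr.
apply: le_lt_trans (ler_normD _ _) _; apply: ltrD => //.
rewrite -blinM -blinB; apply: le_lt_trans (ler_blin_norm _ _) _.
apply: le_lt_trans (ltr_div_truncnS K eps2); apply: le_trans (small_off_norm_adj oes sT).
by rewrite ler_piMr.
Qed.

Lemma smu_le_approx K n T es : approx_family K n T es -> smu n (to_op T) <= K / n.+1%:R.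
Proof.
move=> [oes size_es sT]; apply: (smu_le_perp oes) => //; first exact: small_off_ge0 sT.
by move=> x /sT[].
Qed.

Lemma L1infP (A : op R) : L1inf A <-> exists2 T, A = to_op T & approximable T.
Proof.
split=> [[/bounded_opP[T ->] _ [M muM]]|[T -> aT]].
  exists T => //; exists (2 * (M + 1)) => n.
  have mu_lt : smu n./2 (to_op T) < (M + 1) / n./2.+1%:R.
    by rewrite ltr_pdivlMr // mulrC (le_lt_trans (muM _)) // ltrDl.
  have [S rS TS] := smu_lt mu_lt.
  have [es [oes size_es sS]] := small_off_rank rS.
  exists es; split=> //.
    by apply: leq_trans size_es _; rewrite mul2n -[leqRHS]odd_double_half leq_addl.
  apply: small_off_dist sS; apply: le_trans (ltW TS) _.
  rewrite [2 * _]mulrC -mulrA ler_wpM2l ?inv_half_le //.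
  by rewrite addr_ge0 // (le_trans _ (muM 0%N)) // mulr_ge0 ?smu_ge0.
have [K TK] := aT; split; [exact: bounded_to_op|exact: compact_approximable|].
exists K => n; have [es Tes] := TK n.
by rewrite mulrC -ler_pdivlMr //; exact: smu_le_approx Tes.
Qed.

End WeakTraceIdeal.

(** * Partial traces *)

Section PartialTraces.
Variable R : realType.
Local Notation C := R[i].
Local Notation H := (ell2 R).
Local Notation orthonormal := (orthonormal (@dot R)).
Implicit Types (x y : H) (T S u : blin R) (es fs : seq H) (t s : nat -> C).

Definition partial_tr T es : C := \sum_(e <- es) dot (T e) e.

Lemma partial_tr_comb (a : C) T S es :
  partial_tr (a *: T + S) es = a * partial_tr T es + partial_tr S es.
Proof.
rewrite /partial_tr mulr_sumr -big_split; apply: eq_bigr => e _.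
by rewrite blinD blinZ dotDl dotZl.
Qed.

Lemma normc_sum_le_size (s : seq H) (F : H -> C) (d : R) :
  {in s, forall e, normc (F e) <= d} -> normc (\sum_(e <- s) F e) <= d * (size s)%:R.
Proof.
move=> Fd; apply: le_trans (normc_sum _ _ _) _.
rewrite big_seq; apply: le_trans (ler_sum _ Fd) _.
by rewrite -big_seq big_const_seq count_predT iter_addr addr0 mulr_natr.
Qed.

(* [Tr(TP) - Tr(TQ) = Tr((1 - Q)TP) - Tr(T(1 - P)Q)] for the projections P and Q. *)
Lemma partial_trB T es fs : partial_tr T es - partial_tr T fs =
  \sum_(e <- es) dot (T e) (e - proj fs e) - \sum_(f <- fs) dot (T (f - proj es f)) f.
Proof.
have commonE : \sum_(e <- es) dot (T e) (proj fs e) = \sum_(f <- fs) dot (T (proj es f)) f.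
  transitivity (\sum_(e <- es) \sum_(f <- fs) dot (T e) f * dot f e).
    by apply: eq_bigr => e _; rewrite dot_projr.
  rewrite exchange_big; apply: eq_bigr => f _ /=.
  rewrite projE linear_sum dot_suml; apply: eq_bigr => e _.
  by rewrite linearZ dotZl mulrC.
have -> : \sum_(e <- es) dot (T e) (e - proj fs e) =
    partial_tr T es - \sum_(e <- es) dot (T e) (proj fs e).
  by rewrite -sumrB; apply: eq_bigr => e _; rewrite dotBr.
have -> : \sum_(f <- fs) dot (T (f - proj es f)) f =
    partial_tr T fs - \sum_(f <- fs) dot (T (proj es f)) f.
  by rewrite -sumrB; apply: eq_bigr => f _; rewrite linearB dotBl.
by rewrite commonE opprB addrA subrK.
Qed.

Lemma partial_tr_close T es fs (d : R) : orthonormal es -> orthonormal fs ->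
  small_off d T es -> small_off d T fs ->
  normc (partial_tr T es - partial_tr T fs) <= d * (size es + size fs)%:R.
Proof.
move=> oes ofs sT_es sT_fs; have d0 := small_off_ge0 sT_es.
have unit_le (gs hs : seq H) (S : blin R) g : orthonormal gs -> orthonormal hs ->
    g \in gs -> (forall x, perp hs x -> `|S x| <= d * `|x|) -> `|S (g - proj hs g)| <= d.
  move=> ogs ohs ggs Sd; apply: le_trans (Sd _ (perp_subproj g ohs)) _.
  rewrite ler_piMr // (le_trans (normr_subproj_le _ ohs)) //.
  by rewrite (orthonormal_normr ogs).
rewrite partial_trB natrD mulrDr; apply: le_trans (normcB _ _) _; rewrite lerD //.
  apply: normc_sum_le_size => e ees; rewrite dot_adj.
  apply: le_trans (dot_CauchySchwarz _ _) _.
  rewrite (orthonormal_normr oes ees) mul1r; apply: unit_le oes ofs ees _.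
  by move=> x /sT_fs[].
apply: normc_sum_le_size => f ffs; apply: le_trans (dot_CauchySchwarz _ _) _.
rewrite (orthonormal_normr ofs ffs) mulr1; apply: unit_le ofs oes ffs _.
by move=> x /sT_es[].
Qed.

Definition partial_trace T t := exists K, forall n, exists2 es,
  approx_family K n T es & normc (t n - partial_tr T es) <= K.

Lemma partial_traceI T t (K L : R) :
  (forall n, exists2 es, approx_family K n T es & normc (t n - partial_tr T es) <= L) ->
  partial_trace T t.
Proof.
move=> tKL; exists (K + `|L|) => n; have [es Tes tes] := tKL n.
have K0 := approx_family_ge0 Tes; exists es.
  by apply: approx_family_le Tes; rewrite lerDl.
by apply: le_trans tes _; rewrite (le_trans (ler_norm L)) // lerDr.
Qed.

Lemma partial_trace_family T (es : nat -> seq H) K :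
  (forall n, approx_family K n T (es n)) -> partial_trace T (fun n => partial_tr T (es n)).
Proof.
by move=> Tes; apply: (@partial_traceI _ _ K 0) => n; exists (es n); rewrite ?subrr ?normc0.
Qed.

Lemma partial_trace_exists T : approximable T -> exists t, partial_trace T t.
Proof.
by move=> [K /choice[es Tes]]; eexists; exact: partial_trace_family Tes.
Qed.

Lemma partial_trace_approximable T t : partial_trace T t -> approximable T.
Proof. by move=> [K tK]; exists K => n; have [es Tes _] := tK n; exists es. Qed.

Lemma partial_trace_close T t s : partial_trace T t -> partial_trace T s ->
  exists M, forall m n, (n <= m <= 2 * n)%N -> normc (t m - s n) <= M.
Proof.
move=> [K tK] [L sL]; exists (K + 3 * (K + L) + L) => m n /andP[nm mn].
have [es Tes tes] := tK m; have [fs Tfs sfs] := sL n.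
have K0 := approx_family_ge0 Tes; have L0 := approx_family_ge0 Tfs.
have /(approx_family_le (_ : K <= K + L))[|oes size_es sT_es] := Tes; first by rewrite lerDl.
have /(approx_family_le (_ : L <= K + L))[|ofs size_fs sT_fs] := Tfs; first by rewrite lerDr.
have KL0 : 0 <= K + L by rewrite addr_ge0.
have {}sT_es : small_off ((K + L) / n.+1%:R) T es.
  by apply: small_off_le sT_es; rewrite ler_wpM2l // lef_pV2 ?posrE // ler_nat.
have -> : t m - s n = (t m - partial_tr T es) + (partial_tr T es - partial_tr T fs) -
    (s n - partial_tr T fs) by ring.
apply: le_trans (normcB _ _) _; apply: lerD => //.
apply: le_trans (le_normcD _ _) _; apply: lerD => //.
apply: le_trans (partial_tr_close oes ofs sT_es sT_fs) _.
rewrite mulrAC ler_pdivrMr // [3 * _]mulrC -mulrA ler_wpM2l // -natrM ler_nat; lia.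
Qed.

Lemma partial_trace_comb (a : C) T S t s : partial_trace T t -> partial_trace S s ->
  partial_trace (a *: T + S) (fun n => a * t n + s n).
Proof.
move=> Tt Ss.
have [K] := approximable_merge (partial_trace_approximable Tt) (partial_trace_approximable Ss).
move=> /choice[es TSes].
have [M tM] := partial_trace_close Tt (partial_trace_family (fun n => (TSes n).1)).
have [N sN] := partial_trace_close Ss (partial_trace_family (fun n => (TSes n).2)).
have nn n : (n <= n <= 2 * n)%N by rewrite leqnn leq_pmull.
apply: (@partial_traceI _ _ ((normc a + 1) * K) (normc a * M + N)) => n; exists (es n).
  by have [Tes Ses] := TSes n; exact: approx_family_comb.
rewrite partial_tr_comb opprD addrACA -mulrBr; apply: le_trans (le_normcD _ _) _.
by rewrite normcM lerD ?ler_wpM2l ?normc_ge0 ?tM ?sN.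
Qed.

Definition unitary u := adj u * u = 1 /\ u * adj u = 1.

Lemma isometry_adjK u : (forall x, `|u x| = `|x|) -> adj u * u = 1.
Proof.
move=> iso; have quad0 x : dot ((1 - adj u * u : blin R) x) x = 0.
  by rewrite blinB blinM dotBl dot_adjr !dotxx iso subrr.
apply/esym/eqP; rewrite -subr_eq0 -normr_le0; apply: positive_norm_le => // x.
  by rewrite quad0.
by rewrite /quad quad0 mul0r.
Qed.

Lemma unitary_pairP (U V : op R) : unitary_pair U V ->
  exists u, [/\ U = to_op u, V = to_op (adj u) & unitary u].
Proof.
move=> [/bounded_opP[u ->] /bounded_opP[v ->] UV nU].
have adju : adj u * u = 1.
  apply: isometry_adjK => x; rewrite !normr_vnorm -(nU x (ell2_l2 x)).
  by rewrite to_opE.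
have uv : u * v = 1.
  apply: blinP => x; apply: val_inj; have [+ _] := UV x (ell2_l2 x).
  by rewrite !to_opE.
have vE : v = adj u by rewrite -[LHS]mul1r -adju -mulrA uv mulr1.
by exists u; rewrite -vE; split=> //; split; rewrite -?vE // vE.
Qed.

Lemma unitary_adj u : unitary u -> unitary (adj u).
Proof. by move=> [adju uadj]; split; rewrite adjK. Qed.

Lemma unitary_dot u x y : unitary u -> dot (u x) (u y) = dot x y.
Proof. by move=> [adju _]; rewrite dot_adj -blinM adju. Qed.

Lemma unitary_normr u x : unitary u -> `|u x| = `|x|.
Proof.
move=> uu; apply/eqP; rewrite -(@eqrXn2 _ 2) //.
by rewrite -(inj_eq (@complexI R)) -!dotxx unitary_dot.
Qed.

Lemma unitary_norm_le1 u : unitary u -> `|u| <= 1.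
Proof.
by move=> uu; apply: blin_norm_le => // x; rewrite unitary_normr // mul1r.
Qed.

Lemma unitary_adjK u x : unitary u -> adj u (u x) = x.
Proof. by move=> [adju _]; rewrite -blinM adju. Qed.

Lemma orthonormal_unitary u es : unitary u -> orthonormal es -> orthonormal (map u es).
Proof.
move=> uu oes; have u_inj : injective u.
  by move=> x y uxy; rewrite -(unitary_adjK x uu) uxy unitary_adjK.
have /orthonormalP[uniq_es _] := oes; apply/orthonormalP; split.
  by rewrite map_inj_uniq.
move=> _ _ /mapP[e ees ->] /mapP[f fes ->] /=.
by rewrite unitary_dot // (orthonormal_dot oes) // (inj_eq u_inj).
Qed.

Lemma partial_tr_unitary u T es : unitary u ->
  partial_tr (u * T * adj u) (map u es) = partial_tr T es.
Proof.
move=> uu; rewrite /partial_tr big_map; apply: eq_bigr => e _.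
by rewrite !blinM unitary_adjK // unitary_dot.
Qed.

Lemma small_off_unitary u T es (d : R) : unitary u -> small_off d T es ->
  small_off d (u * T * adj u) (map u es).
Proof.
move=> uu sT x px; have pux : perp es (adj u x).
  by move=> e ees; rewrite dot_adjr px // map_f.
have [Tx T'x] := sT _ pux; rewrite (unitary_normr x (unitary_adj uu)) in Tx T'x.
by rewrite !adjM adjK mulrA !blinM !(unitary_normr _ uu).
Qed.

Lemma partial_trace_unitary u T t : unitary u ->
  partial_trace T t -> partial_trace (u * T * adj u) t.
Proof.
move=> uu [K tK]; exists K => n; have [es [oes size_es sT] tes] := tK n.
exists (map u es); last by rewrite partial_tr_unitary.
split; [exact: orthonormal_unitary|by rewrite size_map|exact: small_off_unitary].
Qed.

Lemma approximable_unitary u T : unitary u -> approximable T ->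
  approximable (u * T * adj u).
Proof.
move=> uu /partial_trace_exists[t Tt].
exact: partial_trace_approximable (partial_trace_unitary uu Tt).
Qed.

Lemma smu_unitary u T n : unitary u -> smu n (to_op (u * T * adj u)) = smu n (to_op T).
Proof.
have conj_le v S : unitary v -> smu n (to_op (v * S * adj v)) <= smu n (to_op S).
  move=> vv; apply: le_trans (smu_mul_le _ _ _ _) _; have vv' := unitary_adj vv.
  rewrite -[leRHS]mulr1; apply: ler_pM; rewrite ?mulr_ge0 ?smu_ge0 ?unitary_norm_le1 //.
  by rewrite -[leRHS]mul1r ler_wpM2r ?smu_ge0 ?unitary_norm_le1.
move=> uu; apply/le_anti/andP; split; first exact: conj_le.
have [adju _] := uu; have := conj_le _ (u * T * adj u) (unitary_adj uu).
by rewrite adjK !mulrA adju mul1r -mulrA adju mulr1.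
Qed.

End PartialTraces.

(** * Almost maximisers of a positive form *)

Section Compression.
Variable R : realType.
Local Notation H := (ell2 R).
Local Notation orthonormal := (orthonormal (@dot R)).
Implicit Types (x y : H) (T : blin R) (es : seq H).

Definition compress es T : blin R := (1 - proj es) * T * (1 - proj es).

Lemma dot_compress es T x y :
  dot (compress es T x) y = dot (T (x - proj es x)) (y - proj es y).
Proof. by rewrite !blinM !blinB dotBl proj_selfadjoint -dotBr. Qed.

Lemma dot_compress_perp es T x y : perp es x -> perp es y ->
  dot (compress es T x) y = dot (T x) y.
Proof. by move=> px py; rewrite dot_compress !proj_perp // !subr0. Qed.

Lemma positive_compress es T : orthonormal es ->
  (forall x, perp es x -> 0 <= dot (T x) x) -> positive (compress es T).
Proof. by move=> oes pT x; rewrite dot_compress; apply/pT/perp_subproj. Qed.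

End Compression.

Section GreedyFamilies.
Variable R : realType.
Local Notation C := R[i].
Local Notation H := (ell2 R).
Local Notation orthonormal := (orthonormal (@dot R)).
Implicit Types (x y e f : H) (es fs : seq H).
Variables (T : blin R) (eta eps : R).
Hypotheses (pT : positive T) (eta_gt0 : 0 < eta).
Hypotheses (eps_eta : eps <= eta) (epsT : eps * `|T| <= eta ^+ 2).

Let quad_set es := [set quad T x | x in [set x | `|x| = 1 /\ perp es x]].

Definition quad_sup es : R := sup (quad_set es).

Let quad_set_ub es : has_ubound (quad_set es).
Proof.
exists `|T| => _ [x [x1 _] <-].
by have := quad_le_normr T x; rewrite x1 expr1n mulr1.
Qed.

Let quad_set_neq0 es : quad_set es !=set0.
Proof. by have [x x1 px] := exists_perp es; exists (quad T x), x. Qed.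

Lemma quad_sup_ge0 es : 0 <= quad_sup es.
Proof.
have [r [x x_unit _]] := quad_set_neq0 es; apply: le_trans (quad_ge0 x pT) _.
by apply: ub_le_sup; [exact: quad_set_ub|exists x].
Qed.

Lemma quad_sup_le_norm es : quad_sup es <= `|T|.
Proof.
apply: ge_sup; first exact: quad_set_neq0.
move=> _ [x [x1 _] <-]; have := quad_le_normr T x.
by rewrite x1 expr1n mulr1.
Qed.

Lemma quad_le_sup es x : perp es x -> quad T x <= quad_sup es * `|x| ^+ 2.
Proof.
move=> px; have [->|x0] := eqVneq x 0.
  by rewrite /quad linear0 dot0l normr0 expr0n mulr0.
have nx : 0 < `|x| by rewrite normr_gt0.
rewrite -ler_pdivrMr ?exprn_gt0 //; apply: ub_le_sup; first exact: quad_set_ub.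
exists (normalize x).
  by split; [exact: normr_normalize|exact: perpZ].
by rewrite quadZ csq_real exprVn mulrC.
Qed.

Lemma quad_sup_cons e es : quad_sup (e :: es) <= quad_sup es.
Proof.
apply: ge_sup; first exact: quad_set_neq0.
move=> _ [x [x1 /perp_cons[_ px]] <-]; apply: ub_le_sup; first exact: quad_set_ub.
by exists x.
Qed.

Fixpoint greedy es : Prop :=
  if es is e :: es' then
    [/\ greedy es', `|e| = 1, perp es' e & quad_sup es' - eps <= quad T e]
  else True.

Lemma greedy_exists n : 0 < eps -> exists2 es, greedy es & size es = n.
Proof.
move=> eps_gt0; elim: n => [|n [es ges size_es]]; first by exists [::].
have sup_es : has_sup (quad_set es) by split; [exact: quad_set_neq0|exact: quad_set_ub].
have [_ [x [x1 px] <-] quad_x] := sup_adherent eps_gt0 sup_es.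
by exists (x :: es); rewrite /= ?size_es //; split=> //; exact: ltW.
Qed.

Lemma greedy_orthonormal es : greedy es -> orthonormal es.
Proof.
elim: es => //= e es IH [ges e1 pe _].
by apply: orthonormal_cons => //; exact: IH.
Qed.

Let gap es : blin R := compress es ((quad_sup es)%:C%C *: (1 : blin R) - T).

Let dot_gap es x y : perp es x -> perp es y ->
  dot (gap es x) y = (quad_sup es)%:C%C * dot x y - dot (T x) y.
Proof.
by move=> px py; rewrite dot_compress_perp // blinB blinZ blin1E dotBl dotZl.
Qed.

Let quad_gap es x : perp es x -> quad (gap es) x = quad_sup es * `|x| ^+ 2 - quad T x.
Proof.
by move=> px; rewrite {1}/quad dot_gap // dotxx positive_quadE // -rmorphM -rmorphB.
Qed.

Let positive_gap es : orthonormal es -> positive (gap es).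
Proof.
move=> oes; apply: positive_compress => // x px.
rewrite blinB blinZ blin1E dotBl dotZl dotxx positive_quadE // -rmorphM -rmorphB.
by rewrite ler0c subr_ge0 quad_le_sup.
Qed.

(* Cauchy-Schwarz for the form [quad_sup es - T], nonnegative on the complement of
   [es]: an almost maximiser is an almost eigenvector. *)
Lemma greedy_head_off e es y : greedy (e :: es) -> perp (e :: es) y ->
  normc (dot (T e) y) <= eta * `|y|.
Proof.
move=> [ges e1 pe sup_le] /perp_cons[ye py]; have oes := greedy_orthonormal ges.
have ey : dot e y = 0 by rewrite dotC ye rmorph0.
have := positive_CauchySchwarz e y (positive_gap oes).
rewrite dot_gap // ey mulr0 sub0r normcN !quad_gap // e1 expr1n mulr1 => CS.
rewrite -(@ler_pXn2r _ 2) ?nnegrE ?normc_ge0 ?mulr_ge0 ?(ltW eta_gt0) //.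
apply: le_trans CS _; rewrite exprMn.
apply: le_trans (_ : eps * (`|T| * `|y| ^+ 2) <= _); last first.
  by rewrite mulrA ler_wpM2r ?sqr_ge0.
apply: ler_pM.
- by have := quad_le_sup pe; rewrite e1 expr1n mulr1 subr_ge0.
- by rewrite subr_ge0 quad_le_sup.
- by rewrite lerBlDr addrC -lerBlDr.
- rewrite lerBlDr -[leLHS]addr0 lerD ?quad_ge0 //.
  by rewrite ler_wpM2r ?sqr_ge0 ?quad_sup_le_norm.
Qed.

Lemma greedy_off es e y : greedy es -> e \in es -> perp es y ->
  normc (dot (T e) y) <= eta * `|y|.
Proof.
elim: es => // f es IH ges; rewrite inE => /predU1P[->|ees] py.
  exact: greedy_head_off ges py.
by have /perp_cons[_ py'] := py; case: ges => ges _ _ _; exact: IH.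
Qed.

Lemma greedy_off_diagonal es e f : greedy es -> e \in es -> f \in es -> e != f ->
  normc (dot (T e) f) <= eta.
Proof.
elim: es => // g es IH ges; have [ges' g1 pg _] := ges.
rewrite !inE => /predU1P[->|ees] /predU1P[->|fes] ef.
- by rewrite eqxx in ef.
- by rewrite positive_dotC // normcJ_conj -[eta]mulr1 -g1; exact: greedy_off fes pg.
- by rewrite -[eta]mulr1 -g1; exact: greedy_off ees pg.
- exact: IH.
Qed.

Lemma greedy_diagonal e es f : greedy (e :: es) -> f \in e :: es ->
  quad_sup es - eps <= quad T f.
Proof.
elim: es e f => [|e' es IH] e f ges; first by rewrite inE => /eqP->; case: ges.
rewrite inE => /predU1P[->|fes]; first by case: ges.
have [ges' _ _ _] := ges; apply: le_trans (IH e' f ges' fes).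
by rewrite lerD2r quad_sup_cons.
Qed.

Lemma greedy_normr_upper es y : greedy es -> perp es y ->
  `|T y| <= (quad_sup es + eta * (size es)%:R) * `|y|.
Proof.
move=> ges py; have oes := greedy_orthonormal ges.
have compress_le : `|compress es T| <= quad_sup es.
  apply: positive_norm_le; [exact: positive_compress|exact: quad_sup_ge0|move=> x].
  rewrite /quad dot_compress; apply: le_trans (quad_le_sup (perp_subproj x oes)) _.
  by rewrite ler_wpM2l ?quad_sup_ge0 // lerXn2r ?nnegrE ?normr_subproj_le.
have -> : T y = compress es T y + proj es (T y).
  by rewrite !blinM !blinB proj_perp // subr0 subrK.
rewrite mulrDl; apply: le_trans (ler_normD _ _) _; apply: lerD.
  by apply: le_trans (ler_blin_norm _ _) _; rewrite ler_wpM2r.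
rewrite projE mulrAC.
apply: le_trans (ler_norm_sum _ _ _) _; rewrite mulr_natr -iter_addr_0 -count_predT.
rewrite -big_const_seq big_seq [leRHS]big_seq; apply: ler_sum => e ees.
rewrite enormrZ (orthonormal_normr oes ees) mulr1 positive_dotC // normcJ_conj.
exact: greedy_off ges ees py.
Qed.

Lemma greedy_quad_span fs x : greedy fs -> proj fs x = x ->
  normc (dot (T x) x - (\sum_(f <- fs) quad T f * csq (dot x f))%:C%C) <=
    eta * `|x| ^+ 2 * (size fs)%:R * (size fs)%:R.
Proof.
move=> gfs px; have ofs := greedy_orthonormal gfs.
have /orthonormalP[uniq_fs _] := ofs.
pose entry f h := dot x f * (dot x h)^* * dot (T f) h.
have diagE f : (quad T f * csq (dot x f))%:C%C = entry f f.
  by rewrite rmorphM /= -mul_conjC_csq /entry -positive_quadE // mulrC.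
have dotE : dot (T x) x = \sum_(f <- fs) \sum_(h <- fs) entry f h.
  rewrite -{1 2}px projE linear_sum dot_suml; apply: eq_bigr => f _.
  rewrite dot_sumr; apply: eq_bigr => h _.
  by rewrite linearZ dotZl dotZr mulrA.
have -> : dot (T x) x - (\sum_(f <- fs) quad T f * csq (dot x f))%:C%C =
    \sum_(f <- fs) \sum_(h <- fs) (if h == f then 0 else entry f h).
  rewrite dotE rmorph_sum -sumrB; apply: eq_big_seq => f ffs /=.
  rewrite diagE (bigD1_seq f) //= [RHS](bigD1_seq f) //= eqxx add0r addrAC subrr add0r.
  by apply: eq_bigr => h /negbTE ->.
apply: normc_sum_le_size => f ffs; apply: normc_sum_le_size => h hfs.
case: eqP => [_|/eqP hf]; first by rewrite normc0 mulr_ge0 ?sqr_ge0 // ltW.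
have coef_le g : g \in fs -> normc (dot x g) <= `|x|.
  by move=> gfs'; have := dot_CauchySchwarz x g; rewrite (orthonormal_normr ofs gfs') mulr1.
rewrite !normcM normcJ_conj mulrC; apply: ler_pM; rewrite ?mulr_ge0 ?normc_ge0 //.
  by apply: greedy_off_diagonal gfs ffs hfs _; rewrite eq_sym.
by rewrite expr2 ler_pM ?normc_ge0 ?coef_le.
Qed.

Lemma greedy_normr_lower e es x : greedy (e :: es) -> proj (e :: es) x = x ->
  (quad_sup es - eps - eta * (size es).+1%:R * (size es).+1%:R) * `|x| <= `|T x|.
Proof.
move=> ges px; have oes := greedy_orthonormal ges.
have [->|x0] := eqVneq x 0; first by rewrite normr0 mulr0.
rewrite -(@ler_pM2r _ `|x|) ?normr_gt0 //.
apply: le_trans (le_trans (Re_le_normc _) (dot_CauchySchwarz (T x) x)).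
have diagonal_ge : (quad_sup es - eps) * `|x| ^+ 2 <=
    \sum_(f <- e :: es) quad T f * csq (dot x f).
  rewrite -{1}px sqr_normr_proj // mulr_sumr.
  rewrite big_seq [leRHS]big_seq; apply: ler_sum => f fes.
  by rewrite ler_wpM2r ?csq_ge0 // (greedy_diagonal ges).
have := le_trans (normRe_le _) (greedy_quad_span ges px).
rewrite raddfB /= ler_norml => /andP[+ _]; rewrite lerBrDr; apply: le_trans.
by move: diagonal_ge => /=; move: (\sum_(f <- _) _) (`|x|) => S r *; lra.
Qed.

Lemma greedy_smu e es : greedy (e :: es) -> let k := size es in
  quad_sup es <= smu k (to_op T) + (k.+1%:R ^+ 2 + 1) * eta /\
  `|quad T e - smu k (to_op T)| <= (k.+1%:R ^+ 2 + 1) * eta.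
Proof.
move=> ges k; have [ges' e1 pe quad_e] := ges; have oes := greedy_orthonormal ges'.
have upper : smu k (to_op T) <= quad_sup es + eta * k%:R.
  apply: (smu_le_perp oes) => //; last by move=> y; exact: greedy_normr_upper.
  by rewrite addr_ge0 ?quad_sup_ge0 // mulr_ge0 // ltW.
have lower : quad_sup es - eps - eta * k.+1%:R * k.+1%:R <= smu k (to_op T).
  apply: (smu_ge (greedy_orthonormal ges)) => // x.
  exact: greedy_normr_lower.
have quad_e_le : quad T e <= quad_sup es.
  by have := quad_le_sup pe; rewrite e1 expr1n mulr1.
have k_le : eta * k%:R <= eta * k.+1%:R * k.+1%:R.
  by rewrite -mulrA ler_pM2l // -natrM ler_nat; nia.
rewrite ler_norml; move: upper lower quad_e_le quad_e k_le eps_eta.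
by move: (smu k _) (quad_sup es) (quad T e) => *; split; last (apply/andP; split); lra.
Qed.

Lemma greedy_partial_tr es (N : nat) : greedy es -> (size es <= N)%N ->
  normc (partial_tr T es - (\sum_(k < size es) smu k (to_op T))%:C%C)
    <= (size es)%:R * ((N%:R ^+ 2 + 1) * eta).
Proof.
elim: es => [|e es IH] ges es_N.
  by rewrite /partial_tr big_nil big_ord0 subrr normc0 mul0r.
rewrite /partial_tr big_cons -/(partial_tr T es) /= big_ord_recr /= positive_quadE //.
have [ges' _ _ _] := ges; set S := \sum_(_ < _) _.
have -> : (quad T e)%:C%C + partial_tr T es - (S + smu (size es) (to_op T))%:C%C =
    (partial_tr T es - S%:C%C) + (quad T e - smu (size es) (to_op T))%:C%C.
  by rewrite rmorphD rmorphB; ring.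
apply: le_trans (le_normcD _ _) _; rewrite -natr1 mulrDl mul1r; apply: lerD.
  by apply: IH => //; exact: ltnW.
rewrite normc_real; have [_ quad_e] := greedy_smu ges; apply: le_trans quad_e _.
by rewrite ler_pM2r // lerD2r lerXn2r ?nnegrE // ler_nat.
Qed.

End GreedyFamilies.

Section PositivePartialTrace.
Variable R : realType.
Implicit Types T : blin R.

Lemma partial_trace_positive T : positive T -> approximable T ->
  partial_trace T (fun n => (\sum_(k < n) smu k (to_op T))%:C%C).
Proof.
move=> pT [K TK]; apply: (@partial_traceI _ _ _ (K + 1) 1) => n.
pose eta : R := (n.+2%:R ^+ 3)^-1; have eta0 : 0 < eta by rewrite invr_gt0 exprn_gt0.
pose eps := Num.min eta (eta ^+ 2 / (`|T| + 1)).
have T1 : 0 < `|T| + 1 by rewrite ltr_wpDl.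
have eps0 : 0 < eps by rewrite lt_min eta0 divr_gt0 ?exprn_gt0.
have eps_eta : eps <= eta by rewrite ge_min lexx.
have epsT : eps * `|T| <= eta ^+ 2.
  rewrite -[leRHS](divfK (lt0r_neq0 T1)); apply: ler_pM; rewrite ?(ltW eps0) ?lerDl //.
  by rewrite ge_min lexx orbT.
have [[//|e es] ges [size_es]] := greedy_exists T n.+1 eps0.
have [ges' _ _ _] := ges; have oes := greedy_orthonormal ges'.
have eta_small (m : nat) : (m <= n.+2 ^ 2)%N -> m%:R * eta <= n.+1%:R^-1.
  move=> m_le; apply: le_trans (_ : n.+2%:R ^+ 2 * eta <= _).
    by rewrite ler_pM2r // -natrX ler_nat.
  rewrite /eta exprS invfM mulrCA divff ?expf_neq0 ?gt_eqF // mulr1.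
  by rewrite lef_pV2 ?posrE // ler_nat.
exists es; last first.
  rewrite -normcN opprB -size_es.
  apply: le_trans (greedy_partial_tr pT eta0 eps_eta epsT ges' (leqnn _)) _.
  rewrite size_es -natrX natr1; apply: le_trans (ler_wpM2l (ler0n _ _) (eta_small _ _)) _.
    by rewrite !expnS; nia.
  by rewrite ler_pdivrMr // mul1r ler_nat.
split; [by []|by rewrite size_es|apply: small_off_positive => // y py].
have [fs Tfs] := TK n; have mu_le := smu_le_approx Tfs.
apply: le_trans (greedy_normr_upper pT eta0 epsT ges' py) _.
rewrite ler_wpM2r //; have [+ _] := greedy_smu pT eta0 eps_eta epsT ges.
rewrite /= size_es -natrX natr1 => sup_le.
apply: le_trans (lerD sup_le (lexx _)) _; rewrite -addrA [eta * _]mulrC -mulrDl -natrD.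
by rewrite [leRHS]mulrDl mul1r lerD // eta_small // !expnS; nia.
Qed.

End PositivePartialTrace.

(** * Extended limits along windows *)

Section WindowMeans.
Variable R : realType.
Implicit Types u v f g : nat -> R.

Definition bounded_seq u := exists M, forall n, `|u n| <= M.

Definition seq_ext_lim (L : (nat -> R) -> R) :=
  [/\ forall a u v, bounded_seq u -> bounded_seq v ->
        L (fun n => a * u n + v n) = a * L u + L v,
      forall u, bounded_seq u -> (forall n, 0 <= u n) -> 0 <= L u &
      forall u l, u @ \oo --> l -> L u = l].

Lemma ultra_cvg_bounded (G : set_system nat) u :
  UltraFilter G -> bounded_seq u -> cvg (u @ G).
Proof.
move=> ultraG [M uM].
have GM : (u @ G) `[- M, M]%classic.
  apply: (@filterS _ G _ setT); last exact: filterT.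
  by move=> n _ /=; rewrite in_itv /= -ler_norml.
have [l [_ cluster_l]] := segment_compact (fmap_proper_filter u ultra_proper) GM.
apply/cvg_ex; exists l => V Vl.
have [//|GC] := in_ultra_setVsetC (u @^-1` V) ultraG.
by have [x [nVx /nVx]] := cluster_l (~` V) V GC Vl.
Qed.

Lemma exists_seq_ext_lim : exists L, seq_ext_lim L.
Proof.
have [G [ultraG oo_sub]] := @ultraFilterLemma nat \oo _.
exists (fun u => lim (u @ G)); split.
- move=> a u v /(ultra_cvg_bounded ultraG) cu /(ultra_cvg_bounded ultraG) cv.
  apply: cvg_lim => //; apply: cvgD => //.
  by apply: cvgM => //; exact: cvg_cst.
- move=> u /(ultra_cvg_bounded ultraG) cu u0; apply: limr_ge => //.
  exact: nearW.
- move=> u l ul; apply: cvg_lim => //.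
  by move=> V Vl; apply: oo_sub; exact: ul.
Qed.

(* [f n] stands for the level [2 ^ n], so that the window [a m, a m + m] has logarithmic
   length [m * ln 2]; at [m = 0] the quotient is [0]. *)
Definition window_mean (a : nat -> nat) f m : R :=
  (f (a m + m)%N - f (a m)) / (m%:R * ln 2).

Definition bounded_increments f := exists M, forall n, `|f n.+1 - f n| <= M.

Lemma ln2_gt0 : 0 < ln 2 :> R.
Proof. by rewrite ln_gt0 // ltr1n. Qed.

Lemma bounded_incrementsD f M n m : (forall n, `|f n.+1 - f n| <= M) ->
  `|f (n + m)%N - f n| <= M * m%:R.
Proof.
move=> fM; elim: m => [|m IH]; first by rewrite addn0 subrr normr0 mulr0.
rewrite addnS -natr1 mulrDr mulr1 -(subrK (f (n + m)%N) (f _)) -addrA addrC.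
by apply: le_trans (ler_normD _ _) _; rewrite lerD.
Qed.

Lemma normr_window_mean_le a f m (D : R) : `|f (a m + m)%N - f (a m)| <= D ->
  `|window_mean a f m| <= D / (m%:R * ln 2).
Proof.
have m_ln2 : 0 <= m%:R * ln 2 :> R by rewrite mulr_ge0 // ltW ?ln2_gt0.
by move=> fD; rewrite normrM normfV (ger0_norm m_ln2) ler_wpM2r ?invr_ge0.
Qed.

Lemma window_mean_comb a c f g m :
  window_mean a (fun n => c * f n + g n) m = c * window_mean a f m + window_mean a g m.
Proof. by rewrite /window_mean mulrA -mulrDl; congr (_ / _); ring. Qed.

Lemma bounded_window_mean a f : bounded_increments f -> bounded_seq (window_mean a f).
Proof.
move=> [M fM]; have M0 : 0 <= M by apply: le_trans (fM 0%N).
exists (M / ln 2) => m.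
apply: le_trans (normr_window_mean_le (bounded_incrementsD (a m) m fM)) _.
have [->|m_gt0] := posnP m; first by rewrite mulr0 mul0r divr_ge0 // ltW ?ln2_gt0.
by rewrite invfM mulrA mulfK // pnatr_eq0 -lt0n.
Qed.

Lemma cvg_div_nat (c : R) : (fun m => c / m%:R) @ \oo --> 0.
Proof.
rewrite -(cvg_shiftS (fun m => c / m%:R)).
have : cst c \* harmonic @ \oo --> c * 0.
  by apply: cvgM; [exact: cvg_cst|exact: cvg_harmonic].
by rewrite mulr0.
Qed.

Lemma window_mean_cvg0 a f M : (forall n, `|f n| <= M) -> window_mean a f @ \oo --> 0.
Proof.
move=> fM; apply/norm_cvg0P.
apply: (squeeze_cvgr _ (cvg_cst 0) (@cvg_div_nat (2 * M / ln 2))).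
apply: nearW => m; rewrite normr_ge0 /=.
have -> : 2 * M / ln 2 / m%:R = 2 * M / (m%:R * ln 2) by rewrite [_ * ln 2]mulrC invfM mulrA.
apply: normr_window_mean_le; apply: le_trans (ler_normB _ _) _.
by rewrite mulrDl mul1r lerD.
Qed.

Lemma bounded_increments_comb c f g : bounded_increments f -> bounded_increments g ->
  bounded_increments (fun n => c * f n + g n).
Proof.
move=> [M fM] [N gN]; exists (`|c| * M + N) => n.
rewrite opprD addrACA -mulrBr; apply: le_trans (ler_normD _ _) _.
by rewrite normrM lerD // ler_wpM2l.
Qed.

Section WindowLimit.
Variables (L : (nat -> R) -> R) (L_lim : seq_ext_lim L) (a : nat -> nat).

Definition window_lim f := L (window_mean a f).

Lemma window_lim_comb c f g : bounded_increments f -> bounded_increments g ->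
  window_lim (fun n => c * f n + g n) = c * window_lim f + window_lim g.
Proof.
move=> /(bounded_window_mean a) bf /(bounded_window_mean a) bg; have [lin _ _] := L_lim.
by rewrite /window_lim -lin //; congr L; apply/funext => m; rewrite window_mean_comb.
Qed.

Lemma window_lim_cvg f l : window_mean a f @ \oo --> l -> window_lim f = l.
Proof. by have [_ _ cvgL] := L_lim; exact: cvgL. Qed.

Lemma window_lim_close f g M : bounded_increments f -> bounded_increments g ->
  (forall n, `|f n - g n| <= M) -> window_lim f = window_lim g.
Proof.
move=> bf bg fgM; have : window_lim (fun n => (-1) * g n + f n) = 0.
  apply/window_lim_cvg/(@window_mean_cvg0 _ _ M) => n.
  by rewrite mulN1r addrC.
by rewrite window_lim_comb // mulN1r addrC => /eqP; rewrite subr_eq0 => /eqP.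
Qed.

Lemma window_lim_ge0 f : bounded_increments f -> nondecreasing_seq f -> 0 <= window_lim f.
Proof.
move=> bf f_nd; have [_ pos _] := L_lim; apply: pos; first exact: bounded_window_mean.
by move=> m; rewrite divr_ge0 ?subr_ge0 ?f_nd ?leq_addr // mulr_ge0 // ltW ?ln2_gt0.
Qed.

Lemma window_lim0 : window_lim (fun=> 0) = 0.
Proof. by apply/window_lim_cvg/(@window_mean_cvg0 _ _ 0) => n; rewrite normr0. Qed.

End WindowLimit.

Lemma harmonic_sum_ge n : ln n.+1%:R <= \sum_(k < n) k.+1%:R^-1 :> R.
Proof.
elim: n => [|n IH]; first by rewrite big_ord0 ln1.
rewrite big_ord_recr /=.
have -> : n.+2%:R = n.+1%:R * (1 + n.+1%:R^-1) :> R.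
  by rewrite mulrDr mulr1 mulfV ?gt_eqF // natr1.
rewrite lnM ?posrE ?addr_gt0 ?invr_gt0 // lerD // le_ln1Dx //.
by rewrite (@lt_trans _ _ 0) ?invr_gt0 // ltrN10.
Qed.

Lemma harmonic_sum_le n : \sum_(k < n.+1) k.+1%:R^-1 <= 1 + ln n.+1%:R :> R.
Proof.
elim: n => [|n IH]; first by rewrite big_ord1 ln1 addr0 invr1.
rewrite big_ord_recr /= -lerBrDr; apply: le_trans IH _.
have -> : n.+1%:R = n.+2%:R * (1 - n.+2%:R^-1) :> R.
  by rewrite mulrBr mulr1 mulfV ?gt_eqF // -[n.+2%:R]natr1 addrK.
have n1 : n.+2%:R^-1 < 1 :> R by rewrite invf_lt1 // ltr1n.
rewrite lnM ?posrE ?subr_gt0 // -addrA lerD2l lerD2l.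
by apply: le_ln1Dx; rewrite ltrN2.
Qed.

Lemma harmonic_sum_pow2 n :
  n%:R * ln (2 : R) <= \sum_(k < 2 ^ n) k.+1%:R^-1 <= 1 + n%:R * ln (2 : R).
Proof.
have -> : n%:R * ln 2 = ln (2 ^ n)%N%:R :> R by rewrite natrX lnXn // mulr_natl.
have -> : (2 ^ n = (2 ^ n).-1.+1)%N by rewrite prednK ?expn_gt0.
rewrite harmonic_sum_le andbT; apply: le_trans (harmonic_sum_ge _).
by rewrite ler_ln ?posrE // ler_nat.
Qed.

End WindowMeans.

Section WindowTrace.
Variable R : realType.
Local Notation C := R[i].
Implicit Types (T S : blin R) (t s : nat -> C).
Variables (L : (nat -> R) -> R) (L_lim : seq_ext_lim L) (a : nat -> nat).

Let re t n := complex.Re (t (2 ^ n)%N).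
Let im t n := complex.Im (t (2 ^ n)%N).

Definition window_value t : C := Complex (window_lim L a (re t)) (window_lim L a (im t)).

Definition window_trace (A : op R) : C :=
  window_value (xget (fun=> 0) [set t | exists2 T, A = to_op T & partial_trace T t]).

Lemma partial_trace_increments T t : partial_trace T t ->
  bounded_increments (re t) /\ bounded_increments (im t).
Proof.
move=> Tt; have [M tM] := partial_trace_close Tt Tt.
have tM_pow n : normc (t (2 ^ n.+1)%N - t (2 ^ n)%N) <= M.
  by apply: tM; rewrite expnS leqnn leq_pmull.
split; exists M => n; apply: le_trans (tM_pow n); rewrite /re /im -raddfB.
- exact: normRe_le.
- exact: normIm_le.
Qed.

Lemma window_traceE T t : partial_trace T t -> window_trace (to_op T) = window_value t.
Proof.
move=> Tt; rewrite /window_trace.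
case: xgetP => [s _ [S /to_op_inj <- Ts]|/(_ t) []]; last by exists T.
have [M sM] := partial_trace_close Ts Tt.
have stM n : normc (s (2 ^ n)%N - t (2 ^ n)%N) <= M.
  by apply: sM; rewrite leqnn leq_pmull.
have [sR sI] := partial_trace_increments Ts; have [tR tI] := partial_trace_increments Tt.
congr Complex; apply: (window_lim_close L_lim) => // n;
  apply: le_trans (stM n); rewrite /re /im -raddfB.
- exact: normRe_le.
- exact: normIm_le.
Qed.

Lemma window_value_comb (c : C) T S t s : partial_trace T t -> partial_trace S s ->
  window_value (fun n => c * t n + s n) = c * window_value t + window_value s.
Proof.
move=> /partial_trace_increments[tR tI] /partial_trace_increments[sR sI].
case: c => x y; rewrite /window_value.
have reE : re (fun n => (x +i* y)%C * t n + s n) =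
    (fun n => x * re t n + (- y * im t n + re s n)).
  by apply/funext => n; rewrite /re /im; case: (t _) (s _) => p q [p' q'] /=; ring.
have imE : im (fun n => (x +i* y)%C * t n + s n) =
    (fun n => x * im t n + (y * re t n + im s n)).
  by apply/funext => n; rewrite /re /im; case: (t _) (s _) => p q [p' q'] /=; ring.
rewrite reE imE !(window_lim_comb L_lim) //; try exact: bounded_increments_comb.
by apply/eqP; rewrite eq_complex /=; apply/andP; split; apply/eqP; ring.
Qed.

Lemma window_trace_is_trace : is_trace window_trace.
Proof.
split=> [c A B|U V A].
  move=> /L1infP[T -> /partial_trace_exists[t Tt]] /L1infP[S -> /partial_trace_exists[s Ss]].
  rewrite opcomb_to_op (window_traceE (partial_trace_comb c Tt Ss)).
  by rewrite (window_traceE Tt) (window_traceE Ss) (window_value_comb c Tt Ss).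
move=> /unitary_pairP[u [-> -> uu]] /L1infP[T -> /partial_trace_exists[t Tt]].
rewrite !comp_to_op (window_traceE (partial_trace_unitary uu Tt)).
by rewrite (window_traceE Tt).
Qed.

Lemma smu_sum_increments T : positive T -> approximable T ->
  bounded_increments (fun n => \sum_(k < 2 ^ n) smu k (to_op T)).
Proof.
by move=> pT /(partial_trace_positive pT)/partial_trace_increments[].
Qed.

Lemma window_trace_positive T : positive T -> approximable T -> window_trace (to_op T) =
  (window_lim L a (fun n => \sum_(k < 2 ^ n) smu k (to_op T)))%:C%C.
Proof.
move=> pT aT; rewrite (window_traceE (partial_trace_positive pT aT)) /window_value /im /=.
by rewrite (window_lim0 L_lim).
Qed.

Lemma window_trace_PT : PT window_trace.
Proof.
split=> [|A|A]; first exact: window_trace_is_trace.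
  move=> /L1infP[T -> aT] /pos_opP pT; rewrite window_trace_positive // ler0c.
  apply: (window_lim_ge0 L_lim); first exact: smu_sum_increments.
  move=> n m nm; have pow_le : (2 ^ n <= 2 ^ m)%N by rewrite leq_exp2l.
  rewrite (big_ord_widen _ (fun k => smu k (to_op T)) pow_le) big_mkcond.
  by apply: ler_sum => k _; case: ifP => // _; exact: smu_ge0.
move=> /L1infP[T -> aT] /pos_opP pT muT; rewrite window_trace_positive //.
have muE : (fun n => \sum_(k < 2 ^ n) smu k (to_op T)) =
    (fun n => \sum_(k < 2 ^ n) k.+1%:R^-1).
  by apply/funext => n; apply: eq_bigr => k _; rewrite muT.
have incr := smu_sum_increments pT aT; rewrite muE in incr *.
have incr_ln : bounded_increments (fun n => n%:R * ln 2 : R).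
  by exists `|ln 2| => n; rewrite -mulrBl -natr1 addrC addKr mul1r.
rewrite (@window_lim_close _ _ L_lim a _ _ 1 incr incr_ln) => [|n]; last first.
  have /andP[lo hi] := harmonic_sum_pow2 R n.
  by rewrite ger0_norm ?subr_ge0 // lerBlDr.
congr (_%:C%C); apply: (window_lim_cvg L_lim); apply: (@cvg_near_cst _ R).
exists 1%N => // m /= m1; rewrite /window_mean natrD -mulrBl addrAC subrr add0r divff //.
by rewrite mulf_neq0 ?gt_eqF ?ln2_gt0 // ltr0n.
Qed.

End WindowTrace.

(** * Domination by positive operators *)

Section OrthonormalSequence.
Variable R : realType.
Local Notation H := (ell2 R).
Local Notation orthonormal := (orthonormal (@dot R)).
Implicit Types (x : H) (es fs : seq H).

Lemma orthonormal_cover es vs n : orthonormal es -> (size es + size vs <= n)%N ->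
  exists fs, [/\ orthonormal (es ++ fs), size (es ++ fs) = n &
                 forall x, perp (es ++ fs) x -> perp vs x].
Proof.
move=> oes es_vs; have [fs [ofs size_fs perp_fs]] := gram_schmidt vs oes.
have [gs ogs size_gs] := orthonormal_extend (n - size (es ++ fs)) ofs.
exists (fs ++ gs); rewrite catA; split=> //.
  rewrite size_cat size_gs subnKC // size_cat.
  by apply: leq_trans es_vs; rewrite leq_add2l.
by move=> x /perp_cat[/perp_fs].
Qed.

Section Exhaustion.
Variables (vs : nat -> seq H) (extension : seq H * nat -> seq H).
Hypothesis size_vs : forall m, (size (vs m) <= 2 ^ m)%N.
Hypothesis extensionP : forall p, orthonormal p.1 ->
  (size p.1 + size (vs p.2) <= (2 ^ p.2.+1).-1)%N ->
  [/\ orthonormal (p.1 ++ extension p), size (p.1 ++ extension p) = (2 ^ p.2.+1).-1 &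
      forall x, perp (p.1 ++ extension p) x -> perp (vs p.2) x].

Fixpoint exhaustion m : seq H :=
  if m is m'.+1 then exhaustion m' ++ extension (exhaustion m', m') else [::].

Let room m n : n = (2 ^ m).-1 -> (n + size (vs m) <= (2 ^ m.+1).-1)%N.
Proof. by move=> ->; have := size_vs m; have := expn_gt0 2 m; rewrite expnS; lia. Qed.

Lemma exhaustion_orthonormal m :
  orthonormal (exhaustion m) /\ size (exhaustion m) = (2 ^ m).-1.
Proof.
elim: m => [|m [om size_m]] //=.
by have [] := @extensionP (exhaustion m, m) om (room size_m).
Qed.

Lemma exhaustion_perp m x : perp (exhaustion m.+1) x -> perp (vs m) x.
Proof.
have [om size_m] := exhaustion_orthonormal m.
by have [_ _] := @extensionP (exhaustion m, m) om (room size_m); apply.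
Qed.

Definition exhaustion_seq j := (exhaustion j.+1)`_j.

Lemma exhaustionE m : exhaustion m = mkseq exhaustion_seq (2 ^ m).-1.
Proof.
have prefix k i j : (j < size (exhaustion k))%N -> (exhaustion (k + i))`_j = (exhaustion k)`_j.
  elim: i => [|i IH] jk; first by rewrite addn0.
  rewrite addnS /= nth_cat IH // ifT //; apply: leq_trans jk _.
  have [_ ->] := exhaustion_orthonormal k; have [_ ->] := exhaustion_orthonormal (k + i).
  by rewrite -ltnS !prednK ?expn_gt0 // leq_exp2l ?leq_addr.
have [_ size_m] := exhaustion_orthonormal m.
apply: (@eq_from_nth _ 0) => [|j jm]; first by rewrite size_mkseq.
rewrite nth_mkseq -?size_m // -(prefix _ j.+1 _ jm) addnC prefix //.
have [_ ->] := exhaustion_orthonormal j.+1; rewrite -ltnS prednK ?expn_gt0 //.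
exact: ltn_expl.
Qed.

Lemma exhaustion_orthonormal_seq : orthonormal_seq exhaustion_seq.
Proof.
move=> i j; pose m := (maxn i j).+1; have [om size_m] := exhaustion_orthonormal m.
have lt_size k : (k <= maxn i j)%N -> (k < size (exhaustion m))%N.
  move=> k_le; rewrite size_m -ltnS prednK ?expn_gt0 //.
  exact: leq_ltn_trans (ltn_expl m (isT : 1 < 2)%N).
have nthE k : (k <= maxn i j)%N -> exhaustion_seq k = (exhaustion m)`_k.
  by move=> /lt_size; rewrite {1}exhaustionE size_mkseq => km; rewrite exhaustionE nth_mkseq.
have ilt := lt_size i (leq_maxl i j); have jlt := lt_size j (leq_maxr i j).
rewrite !nthE ?leq_maxl ?leq_maxr //.
exact: (@orthonormal_nth _ _ (Ordinal ilt) (Ordinal jlt) om).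
Qed.

End Exhaustion.

Lemma exists_orthonormal_seq (vs : nat -> seq H) : (forall m, (size (vs m) <= 2 ^ m)%N) ->
  exists2 e, orthonormal_seq e &
    forall m x, perp (mkseq e (2 ^ m.+1).-1) x -> perp (vs m) x.
Proof.
move=> size_vs; have /choice[extension extensionP] : forall p : seq H * nat, exists fs,
    orthonormal p.1 -> (size p.1 + size (vs p.2) <= (2 ^ p.2.+1).-1)%N ->
    [/\ orthonormal (p.1 ++ fs), size (p.1 ++ fs) = (2 ^ p.2.+1).-1 &
        forall x, perp (p.1 ++ fs) x -> perp (vs p.2) x].
  move=> [es m]; have [[oes es_vs]|no] := pselect
      (orthonormal es /\ (size es + size (vs m) <= (2 ^ m.+1).-1)%N).
    by have [fs] := orthonormal_cover oes es_vs; exists fs.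
  by exists [::] => oes es_vs; case: no.
exists (exhaustion_seq extension); first exact: exhaustion_orthonormal_seq extensionP.
by move=> m x; rewrite -(exhaustionE size_vs extensionP); exact: exhaustion_perp.
Qed.

End OrthonormalSequence.

Section Domination.
Variable R : realType.
Local Notation H := (ell2 R).
Local Notation orthonormal := (orthonormal (@dot R)).
Implicit Types (x : H) (T B : blin R) (es fs : seq H).

Lemma approximable_seq T : approximable T -> exists2 e : nat -> H, orthonormal_seq e &
  exists K, forall n, small_off (K / n.+1%:R) T (mkseq e n).
Proof.
move=> [K /choice[es Tes]].
have [e oe perp_e] := @exists_orthonormal_seq R (fun m => es (2 ^ m)%N)
  (fun m => let: And3 _ size_es _ := Tes (2 ^ m)%N in size_es).
have K0 := approx_family_ge0 (Tes 0%N).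
exists e => //; exists (4 * K + `|T|) => -[|n] x px.
  rewrite divr1; split; (apply: le_trans (ler_blin_norm _ _) _; rewrite ler_wpM2r //).
    by rewrite lerDr mulr_ge0.
  by apply: le_trans (adj_norm_le T) _; rewrite lerDr mulr_ge0.
pose m := (trunc_log 2 n.+2).-1.
have /andP[lo hi] : (2 ^ m.+1 <= n.+2 < 2 ^ m.+2)%N.
  by rewrite prednK //; exact: trunc_log_bounds.
have [_ _ /small_off_le sT] := Tes (2 ^ m)%N; apply: sT.
  apply: le_trans (_ : 4 * K / n.+2%:R <= _); last first.
    by rewrite ler_pM2r ?invr_gt0 // lerDl.
  rewrite ler_pdivrMr // mulrAC ler_pdivlMr // -mulrA mulrCA ler_wpM2l //.
  by rewrite -natrM ler_nat; move: hi; rewrite !expnS; lia.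
apply: perp_e; apply/perp_mkseqP => k k_lt; move/perp_mkseqP: px; apply.
by rewrite (leq_trans k_lt) // -ltnS prednK ?expn_gt0.
Qed.

Lemma normc_dot_proj_le T es x (d : R) : orthonormal es -> small_off d T es ->
  normc (dot (T x) x) <= normc (dot (T (proj es x)) (proj es x)) + 2 * d * `|x| ^+ 2.
Proof.
move=> oes sT; have [Tr T'r] := sT _ (perp_subproj x oes); have d0 := small_off_ge0 sT.
set p := proj es x in Tr T'r *; set r := x - p in Tr T'r.
have r_le : `|r| <= `|x| by exact: normr_subproj_le.
have p_le : `|p| <= `|x| by exact: normr_proj_le.
have -> : dot (T x) x = dot (T p) p + (dot (T r) x + dot p (adj T r)).
  rewrite -dot_adj /r linearB dotBl dotBr; ring.
have d_le u v : `|u| <= d * `|r| -> `|v| <= `|x| -> `|u| * `|v| <= d * `|x| ^+ 2 :> R.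
  move=> u_le v_le; rewrite expr2 mulrA; apply: ler_pM => //.
  by apply: le_trans u_le _; rewrite ler_wpM2l.
apply: le_trans (le_normcD _ _) _; rewrite lerD2l -mulrA mulrDl mul1r.
apply: le_trans (le_normcD _ _) _; apply: lerD.
  by apply: le_trans (dot_CauchySchwarz _ _) _; exact: d_le.
by apply: le_trans (dot_CauchySchwarz _ _) _; rewrite mulrC; exact: d_le.
Qed.

Lemma proj_sub es fs x : orthonormal fs -> {subset es <= fs} ->
  proj es (proj fs x) = proj es x.
Proof.
move=> ofs es_fs; rewrite [LHS]projE [RHS]projE; apply: eq_big_seq => e /es_fs efs.
by rewrite dot_proj_mem.
Qed.

Lemma dominating_weights_step (K : R) (u : nat -> R) n : 0 <= K -> (forall j, 0 <= u j) ->
  \sum_(j < 2 ^ n) (8 * K / j.+1%:R - 4 * K / 2 ^+ n) * u j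
    + 2 * (K / 2 ^+ n) * \sum_(j < 2 ^ n.+1) u j
  <= \sum_(j < 2 ^ n.+1) (8 * K / j.+1%:R - 4 * K / 2 ^+ n.+1) * u j.
Proof.
move=> K0 u0; pose c := K / 2 ^+ n.
have cE : 4 * K / 2 ^+ n = 4 * c by rewrite mulrA.
have cSE : 4 * K / 2 ^+ n.+1 = 2 * c.
  by rewrite /c exprS; field; rewrite expf_neq0.
rewrite cE cSE -/c expnS mul2n -addnn !big_split_ord /= mulrDr addrA lerD //.
  rewrite mulr_sumr -big_split /= le_eqVlt; apply/orP; left; apply/eqP.
  by apply: eq_bigr => j _; ring.
rewrite mulr_sumr; apply: ler_sum => j _; apply: ler_wpM2r => //.
rewrite lerBrDr -mulrDl (_ : 2 + 2 = 4 :> R); last by ring.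
rewrite ler_pdivlMr // /c mulrA mulrAC ler_pdivrMr ?exprn_gt0 //.
have : (2 ^ n + j).+1%:R <= 2 * 2 ^+ n :> R.
  by rewrite -natrX -natrM ler_nat; have := ltn_ord j; lia.
by move: (_%:R) (2 ^+ n) => a b ab; rewrite -!mulrA mulrCA; nra.
Qed.

Lemma normc_dot_proj_weights T (e : nat -> H) K x n : orthonormal_seq e ->
  (forall m, small_off (K / m.+1%:R) T (mkseq e m)) ->
  normc (dot (T (proj (mkseq e (2 ^ n)) x)) (proj (mkseq e (2 ^ n)) x)) <=
    \sum_(j < 2 ^ n) (8 * K / j.+1%:R - 4 * K / 2 ^+ n) * csq (dot x (e j)).
Proof.
move=> oe sT; have K0 : 0 <= K by have := small_off_ge0 (sT 0%N); rewrite divr1.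
pose P m : blin R := proj (mkseq e (2 ^ m)).
have oes m : orthonormal (mkseq e (2 ^ m)) by exact: orthonormal_mkseq.
have normP m : `|P m x| ^+ 2 = \sum_(j < 2 ^ m) csq (dot x (e j)).
  by rewrite sqr_normr_proj // big_mkseq.
rewrite -/(P n); elim: n => [|n IH].
  have T_le : `|T (P 0%N x)| <= K * `|P 0%N x|.
    by have [] := sT 0%N (P 0%N x); rewrite ?divr1 // => f.
  apply: le_trans (dot_CauchySchwarz _ _) _; apply: le_trans (ler_wpM2r _ T_le) _ => //.
  rewrite -[leLHS]mulrA -expr2 normP !big_ord1 !divr1 -mulrBl.
  by rewrite ler_wpM2r ?csq_ge0 //; lra.
have sub_es : {subset mkseq e (2 ^ n) <= mkseq e (2 ^ n.+1)}.
  move=> _ /mapP[j + ->]; rewrite mem_iota add0n => /andP[_ jn]; apply: map_f.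
  by rewrite mem_iota (leq_trans jn) // leq_exp2l.
have := normc_dot_proj_le (P n.+1 x) (oes n) (sT (2 ^ n)%N).
rewrite proj_sub // normP => /le_trans; apply.
apply: le_trans (dominating_weights_step n K0 (fun j => csq_ge0 (dot x (e j)))).
apply: lerD => //; apply: ler_wpM2r; first by apply: sumr_ge0 => j _; exact: csq_ge0.
rewrite ler_pM2l // ler_wpM2l // lef_pV2 ?posrE ?exprn_gt0 // -natrX ler_nat.
exact: leqnSn.
Qed.

(* [quad B x] is the sum of [8 K / (j + 1)] times the squares of the coefficients of
   [x]: the weight at [j] dominates the sum of [2 K / 2 ^ n] over the levels [n] with
   [j < 2 ^ n.+1]. *)
Lemma exists_dominating T : approximable T -> exists B,
  [/\ positive B, approximable B & forall x, normc (dot (T x) x) <= quad B x].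
Proof.
move=> /approximable_seq[e oe [K sT]].
have K0 : 0 <= K by have := small_off_ge0 (sT 0%N); rewrite divr1.
pose w k := 8 * K / k.+1%:R.
have w_ge0 k : 0 <= w k by rewrite divr_ge0 // mulr_ge0.
have w_anti : nonincreasing_seq w.
  by move=> i j ij; rewrite ler_wpM2l ?mulr_ge0 // lef_pV2 ?posrE // ler_nat.
exists (diag_op oe w_ge0 w_anti); split; first exact: positive_diag.
  exact: (@approximable_diag _ _ _ (8 * K)).
move=> x; apply/ler_addgt0Pr => eps eps0.
pose N := Num.truncn (2 * K * `|x| ^+ 2 / eps).
have := normc_dot_proj_le x (orthonormal_mkseq (2 ^ N) oe) (sT (2 ^ N)%N).
move=> /le_trans; apply; apply: lerD.
  apply: le_trans (normc_dot_proj_weights x N oe sT) _.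
  apply: le_trans (sum_le_quad_diag oe w_ge0 w_anti (2 ^ N) x).
  apply: ler_sum => j _; rewrite ler_wpM2r ?csq_ge0 // gerBl.
  by rewrite divr_ge0 ?mulr_ge0 ?exprn_ge0.
rewrite [2 * _]mulrA [leLHS]mulrAC.
apply: le_trans (ltW (ltr_div_truncnS (2 * K * `|x| ^+ 2) eps0)).
rewrite ler_wpM2l ?mulr_ge0 ?sqr_ge0 // lef_pV2 ?posrE // ler_nat ltnS ltnW //.
exact: ltn_expl.
Qed.

End Domination.

Section PositiveSpan.
Variable R : realType.
Local Notation C := R[i].
Implicit Types (T B : blin R).

Lemma positive_Re_dominated T B : positive B -> (forall x, normc (dot (T x) x) <= quad B x) ->
  positive (2 *: B + (T + adj T)).
Proof.
move=> pB TB x; rewrite !blinD blinZ !dotDl dotZl positive_quadE // dot_adjr (dotC (T x)).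
have := le_trans (normRe_le _) (TB x); rewrite ler_norml.
case: (dot (T x) x) => p q /= /andP[lo _].
by rewrite lecE /=; apply/andP; split; [apply/eqP; ring|lra].
Qed.

Lemma positive_Im_dominated T B : positive B -> (forall x, normc (dot (T x) x) <= quad B x) ->
  positive (2 *: B + 'i%C *: (adj T - T)).
Proof.
move=> pB TB x; rewrite blinD !blinZ blinB dotDl !dotZl dotBl positive_quadE // dot_adjr.
rewrite (dotC (T x)); have := le_trans (normIm_le _) (TB x); rewrite ler_norml.
case: (dot (T x) x) => p q /= /andP[lo _].
by rewrite lecE /=; apply/andP; split; [apply/eqP; ring|lra].
Qed.

Definition linear_on_L1inf (f : op R -> C) := forall a (A A' : op R),
  L1inf A -> L1inf A' -> f (opcomb a A A') = a * f A + f A'.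

Lemma linear_on_L1inf_comb f (a : C) T S : linear_on_L1inf f ->
  approximable T -> approximable S ->
  f (to_op (a *: T + S)) = a * f (to_op T) + f (to_op S).
Proof. by move=> lin_f aT aS; rewrite -opcomb_to_op lin_f //; apply/L1infP; eexists. Qed.

Lemma linear_on_L1infZ f (a : C) T : linear_on_L1inf f -> approximable T ->
  f (to_op (a *: T)) = a * f (to_op T).
Proof.
move=> lin_f aT; rewrite -[in LHS](subrK 1 a) scalerDl scale1r.
by rewrite linear_on_L1inf_comb //; ring.
Qed.

Lemma positive_span T B : T =
  2^-1 *: (2 *: B + (T + adj T)) + (('i%C / 2) *: (2 *: B + 'i%C *: (adj T - T)) +
  (- (1 + 'i%C)) *: B).
Proof.
have i2 : 'i%C * 'i%C = -1 :> C by rewrite -expr2 sqr_i.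
have half : (2 : C)^-1 * 2 = 1 by rewrite mulVf ?pnatr_eq0.
apply: blinP => x; apply: ell2P => k.
apply: (@eq_trans _ _ (2^-1 * (2 * B x k + (T x k + adj T x k)) +
  (('i%C / 2) * (2 * B x k + 'i%C * (adj T x k - T x k)) + - (1 + 'i%C) * B x k))) => //.
move: (T x k) (adj T x k) (B x k) => t t' b; ring: i2 half.
Qed.

Lemma approximableZ (a : C) T : approximable T -> approximable (a *: T).
Proof.
by move=> aT; rewrite -[a](subrK 1) scalerDl scale1r; exact: approximable_comb.
Qed.

Lemma approximableD T S : approximable T -> approximable S -> approximable (T + S).
Proof. by move=> aT aS; rewrite -[T]scale1r; exact: approximable_comb. Qed.

(* [T = (B + Re T) + i (B + Im T) - (1 + i) B] with [B] dominating [T]. *)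
Lemma eq_on_L1inf (f g : op R -> C) : linear_on_L1inf f -> linear_on_L1inf g ->
  (forall A, L1inf A -> pos_op A -> f A = g A) -> forall A, L1inf A -> f A = g A.
Proof.
move=> lin_f lin_g fg _ /L1infP[T -> aT].
have [B [pB aB TB]] := exists_dominating aT; have aT' := approximable_adj aT.
have pP := positive_Re_dominated pB TB; have pQ := positive_Im_dominated pB TB.
rewrite (positive_span T B); set P := _ + (T + _) in pP *; set Q := _ + 'i%C *: _ in pQ *.
have aP : approximable P by apply: approximableD (approximableZ _ aB) (approximableD aT aT').
have aQ : approximable Q.
  apply: approximableD (approximableZ _ aB) (approximableZ _ (approximableD aT' _)).
  by rewrite -scaleN1r; exact: approximableZ.
have fg_pos S : positive S -> approximable S -> f (to_op S) = g (to_op S).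
  by move=> pS aS; apply: fg; [apply/L1infP; exists S|exact/pos_opP].
pose c : C := - (1 + 'i%C); have aC := approximableZ c aB.
have spanE h : linear_on_L1inf h -> h (to_op (2^-1 *: P + (('i%C / 2) *: Q + c *: B))) =
    2^-1 * h (to_op P) + (('i%C / 2) * h (to_op Q) + c * h (to_op B)).
  move=> lin_h; rewrite (linear_on_L1inf_comb _ lin_h aP (approximable_comb _ aQ aC)).
  by rewrite (linear_on_L1inf_comb _ lin_h aQ aC) (linear_on_L1infZ _ lin_h aB).
by rewrite (spanE f lin_f) (spanE g lin_g) !fg_pos.
Qed.

End PositiveSpan.

(** * Dixmier averages *)

Section StepIntegral.
Variable R : realType.
Local Notation mu := (@lebesgue_measure R).
Variable m : nat -> R.
Hypotheses (m_ge0 : forall k, 0 <= m k) (m_anti : nonincreasing_seq m).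

Let step (s : R) : R := m (Num.truncn s).

Lemma step_measurable (D : set R) : measurable D -> measurable_fun D step.
Proof.
move=> mD; apply: nonincreasing_measurable => // s t st.
exact/m_anti/le_truncn.
Qed.

Let bounded_integrable (f : R -> R) (x y : R) : measurable_fun `[x, y]%classic f ->
  (forall s, `|f s| <= m 0%N) -> mu.-integrable `[x, y]%classic (EFin \o f).
Proof.
move=> mf f_le; apply: measurable_bounded_integrable => //.
  by rewrite /= lebesgue_measure_itv; case: ifP => // _; exact: ltry.
exists (m 0%N); split; first exact: num_real.
by move=> M mM s _ /=; exact: le_trans (f_le s) (ltW mM).
Qed.

Lemma step_integrable (a b : itv_bound R) (x y : R) :
  [set` Interval a b] `<=` `[x, y]%classic ->
  mu.-integrable [set` Interval a b] (EFin \o step).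
Proof.
move=> sub; have int_xy : mu.-integrable `[x, y]%classic (EFin \o step).
  apply: bounded_integrable => [|s]; first exact: step_measurable.
  by rewrite ger0_norm ?m_ge0 // m_anti.
by apply: integrableS int_xy.
Qed.

Definition step_int (t : R) : R := \int[mu]_(s in `[0, t]%classic) m (Num.truncn s).

Lemma step_int_ge0 t : 0 <= step_int t.
Proof. by apply: Rintegral_ge0 => s _. Qed.

Lemma step_intB (s t : R) : 0 <= s -> s <= t ->
  step_int t - step_int s = \int[mu]_(x in `]s, t]%classic) step x.
Proof.
move=> s0 st; apply: Rintegral_itvB; rewrite ?bnd_simp //.
exact: (@step_integrable _ _ 0 t).
Qed.

Lemma step_int_le s t : 0 <= s -> s <= t -> step_int s <= step_int t.
Proof.
move=> s0 st; rewrite -subr_ge0 step_intB //.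
by apply: Rintegral_ge0 => x _; exact: m_ge0.
Qed.

Lemma step_int_nat n : step_int n%:R = \sum_(k < n) m k.
Proof.
elim: n => [|n IH]; first by rewrite big_ord0 /step_int set_itv1 Rintegral_set1.
rewrite big_ord_recr /= -IH; apply/eqP; rewrite addrC -subr_eq; apply/eqP.
rewrite step_intB ?ler_nat //; rewrite -Rintegral_itv_bndo_bndc; last first.
  by apply: (@step_integrable _ _ n%:R n.+1%:R); apply: subset_itv; rewrite bnd_simp.
rewrite (@eq_Rintegral _ _ _ _ _ (fun=> m n)).
  rewrite Rintegral_cst //= lebesgue_measure_itv /= lte_fin ltr_nat ltnSn.
  by rewrite -EFinB /= -natr1 addrC addKr mulr1.
move=> x; rewrite inE /= in_itv /= => /andP[nx xn]; congr m.
by apply/truncn_def; rewrite (ltW nx).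
Qed.

Lemma step_int_le_linear t : 0 <= t -> step_int t <= m 0%N * t.
Proof.
move=> t0; apply: le_trans (_ : \int[mu]_(s in `[0, t]%classic) m 0%N <= _).
  apply: le_Rintegral => //; first exact: (@step_integrable _ _ 0 t).
    by apply: bounded_integrable => // s; rewrite ger0_norm.
  by move=> s _; exact: m_anti.
rewrite Rintegral_cst //= lebesgue_measure_itv /= lte_fin.
by case: ltP => _ /=; rewrite ?subr0 // mulr0 mulr_ge0.
Qed.

Lemma step_int_le_sum t : 0 <= t -> step_int t <= \sum_(k < (Num.truncn t).+1) m k.
Proof.
by move=> t0; rewrite -step_int_nat step_int_le // ltW // truncnS_gt.
Qed.

End StepIntegral.

Section LinfExtendedLimit.
Variable R : realType.
Local Notation mu := (@lebesgue_measure R).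
Implicit Types f g : R -> R.

Lemma Linf_comb (a : R) f g : Linf f -> Linf g -> Linf (fun t => a * f t + g t).
Proof.
move=> [mf [M fM]] [mg [N gN]]; split.
  by apply: measurable_funD => //; apply: measurable_funM => //; exact: measurable_cst.
exists (`|a| * M + N); apply: (@filterS2 _ _ (ae_filter_ringOfSetsType mu) _ _ _ _ fM gN).
move=> t ft gt t0; apply: le_trans (ler_normD _ _) _.
by rewrite normrM lerD ?gt // ler_wpM2l ?ft.
Qed.

Lemma Linf_cst (c : R) : Linf (fun=> c).
Proof. by split; [exact: measurable_cst|exists `|c|; apply: aeW]. Qed.

Lemma Linf_tail f (T : R) : Linf f -> Linf (fun t => f t * \1_(`]T, +oo[%classic) t).
Proof.
move=> [mf [M fM]]; split; first by apply: measurable_funM => //; exact: measurable_indic.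
exists M; apply: (@filterS _ _ (ae_filter_ringOfSetsType mu) _ _ _ fM) => t ft t0.
rewrite normrM indicE; apply: le_trans (ft t0); rewrite ler_piMr //.
by case: (_ \in _); rewrite ?normr1 ?normr0.
Qed.

Section Functional.
Variables (om : (R -> R) -> R) (om_lim : ext_lim om).

Lemma ext_lim_ge0_eventually f (T : R) : Linf f -> (forall t, T < t -> 0 <= f t) -> 0 <= om f.
Proof.
move=> Lf f_ge0; have [lin pos _ van] := om_lim; have Ltail := Linf_tail T Lf.
have tailE t : T < t -> f t * \1_(`]T, +oo[%classic) t = f t.
  by move=> Tt; rewrite indicE mem_set ?mulr1 //= in_itv /= Tt.
have om_tail : om (fun t => (-1) * (f t * \1_(`]T, +oo[%classic) t) + f t) = 0.
  apply: (van _ T); first exact: Linf_comb.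
  by apply: aeW => t /=; rewrite in_itv /= andbT => /tailE ->; rewrite mulN1r addNr.
move: om_tail; rewrite lin // mulN1r addrC => /eqP; rewrite subr_eq0 => /eqP ->.
apply: pos => //; apply: aeW => t _; have [tT|/[dup] Tt /f_ge0 ft] := leP t T.
  by rewrite indicE memNset ?mulr0 //= in_itv /= andbT ltNge tT.
by rewrite tailE.
Qed.

Lemma ext_lim_cst (c : R) : om (fun=> c) = c.
Proof.
have [lin _ one _] := om_lim; have -> : (fun=> c) = (fun t : R => (c - 1) * 1 + 1).
  by apply/funext => t; ring.
by rewrite (lin _ (fun=> 1) (fun=> 1)) ?one; [ring|exact: Linf_cst|exact: Linf_cst].
Qed.

Lemma ext_lim_cvg f (c : R) : Linf f -> f t @[t --> +oo] --> c -> om f = c.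
Proof.
move=> Lf /cvgrPdist_le fc; have [lin _ _ _] := om_lim.
apply/eqP; rewrite -subr_eq0 -normr_le0; apply/ler_addgt0Pr => e e0; rewrite add0r.
have [T [_ f_near]] := fc e e0.
have ge0 (a b : R) : (forall t, T < t -> 0 <= a * f t + b) -> 0 <= a * om f + b.
  move=> ab_ge0; rewrite -{1}(ext_lim_cst b) -lin //; last exact: Linf_cst.
  by apply: (@ext_lim_ge0_eventually _ T) => //; apply: Linf_comb => //; exact: Linf_cst.
have upper : 0 <= (-1) * om f + (c + e).
  by apply: ge0 => t /f_near; rewrite ler_norml; lra.
have lower : 0 <= 1 * om f + (e - c).
  by apply: ge0 => t /f_near; rewrite ler_norml; lra.
by rewrite ler_norml; apply/andP; split; lra.
Qed.

End Functional.

End LinfExtendedLimit.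

Section DyadicLimits.
Variable R : realType.

Lemma cvg_div_natS2 (s : nat -> R) (c : R) : (fun n => s n / n%:R) @ \oo --> c ->
  (fun n => s n / n.+2%:R) @ \oo --> c.
Proof.
move=> sc; have two_small : (fun n => 2 / n.+2%:R : R) @ \oo --> 0.
  by rewrite (cvg_shiftS (fun n => 2 / n.+1%:R : R)) (cvg_shiftS (fun n => 2 / n%:R : R));
    exact: cvg_div_nat.
have prod_cvg : (fun n => s n / n%:R * (1 - 2 / n.+2%:R)) @ \oo --> c.
  have -> : c = c * (1 - 0) by rewrite subr0 mulr1.
  by apply: cvgM => //; apply: cvgB => //; exact: cvg_cst.
apply: cvg_trans prod_cvg; apply: near_eq_cvg.
exists 1%N => // n /= n1.
have n0 : n%:R != 0 :> R by rewrite pnatr_eq0 -lt0n.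
by rewrite /= -[n.+2]addn2 natrD; field; rewrite n0 -natrD pnatr_eq0 addn2.
Qed.

Lemma cvg_succ_div_nat (s : nat -> R) (c : R) : (fun n => s n / n%:R) @ \oo --> c ->
  (fun n => s n.+1 / n%:R) @ \oo --> c.
Proof.
rewrite -(cvg_shiftS (fun n => s n / n%:R)) => sc.
have prod_cvg : (fun n => s n.+1 / n.+1%:R * (1 + 1 / n%:R)) @ \oo --> c.
  have -> : c = c * (1 + 0) by rewrite addr0 mulr1.
  by apply: cvgM => //; apply: cvgD; [exact: cvg_cst|exact: cvg_div_nat].
apply: cvg_trans prod_cvg; apply: near_eq_cvg.
exists 1%N => // n /= n1.
have n0 : n%:R != 0 :> R by rewrite pnatr_eq0 -lt0n.
by rewrite /= -natr1; field; rewrite n0 natr1 pnatr_eq0.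
Qed.

Definition dyadic_level (t : R) : nat := trunc_log 2 (Num.truncn t).

Lemma dyadic_level_bounds (t : R) : 1 <= t ->
  2 ^+ dyadic_level t <= t < 2 ^+ (dyadic_level t).+1.
Proof.
move=> t1; have t0 : 0 <= t by exact: le_trans t1.
have /andP[lo hi] := truncn_itv t0.
have t_gt0 : (0 < Num.truncn t)%N by rewrite truncn_gt0.
have /andP[log_lo log_hi] := trunc_log_bounds (isT : 1 < 2)%N t_gt0.
apply/andP; split; first by apply: le_trans lo; rewrite -natrX ler_nat.
by apply: lt_le_trans hi _; rewrite -natrX ler_nat.
Qed.

Lemma dyadic_level_cvg : dyadic_level t @[t --> (+oo : set_system R)] --> \oo.
Proof.
move=> A [N _ NA]; exists (2 ^+ N); split; first exact: num_real.
move=> t Nt; apply: NA => /=; rewrite -(@trunc_expnK 2 N) //; apply: leq_trunc_log.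
have t0 : 0 <= t by apply: le_trans (ltW Nt); exact: exprn_ge0.
by rewrite truncn_ge_nat // natrX ltW.
Qed.

End DyadicLimits.

Section DixmierFunction.
Variable R : realType.
Implicit Types (A : op R) (t : R).

Lemma L1inf_smu A : L1inf A ->
  (forall k, 0 <= smu k A) /\ nonincreasing_seq (fun k => smu k A).
Proof.
by move=> /L1infP[T -> _]; split=> [k|]; [exact: smu_ge0|exact: smu_nonincreasing].
Qed.

Lemma dix_funE A t : dix_fun A t = (ln (1 + t))^-1 * step_int (fun k => smu k A) t.
Proof. by []. Qed.

Lemma ln1D_gt0 t : 0 < t -> 0 < ln (1 + t).
Proof. by move=> t0; rewrite ln_gt0 // ltrDl. Qed.

Lemma ln1D_ge t : 0 <= t -> t / (1 + t) <= ln (1 + t).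
Proof.
move=> t0; have t1 : 0 < 1 + t by rewrite ltr_pwDl.
have := @le_ln1Dx R (- (t / (1 + t))) _.
rewrite (_ : 1 + - (t / (1 + t)) = (1 + t)^-1); last by field; rewrite gt_eqF.
by rewrite lnV ?posrE // lerN2 ltrN2 ltr_pdivrMr // mul1r ltrDr ltr01 => /(_ isT).
Qed.

Lemma dix_fun_ge0 A t : L1inf A -> 0 < t -> 0 <= dix_fun A t.
Proof.
move=> /L1inf_smu[mu_ge0 _] t0; rewrite dix_funE mulr_ge0 ?step_int_ge0 //.
by rewrite invr_ge0 ltW // ln1D_gt0.
Qed.

Lemma step_int_le_ln (m : nat -> R) (B : R) t : (forall k, 0 <= m k) ->
  nonincreasing_seq m -> (forall k, m k <= B / k.+1%:R) -> 0 <= t ->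
  step_int m t <= B * (1 + ln (1 + t)).
Proof.
move=> m_ge0 m_anti mB t0; have B0 : 0 <= B by have := le_trans (m_ge0 0%N) (mB 0%N); rewrite divr1.
apply: le_trans (step_int_le_sum m_ge0 m_anti t0) _.
apply: le_trans (ler_sum _ (fun (k : 'I__) _ => mB k)) _; rewrite -mulr_sumr ler_wpM2l //.
apply: le_trans (harmonic_sum_le R _) _; rewrite lerD2l ler_ln ?posrE ?ltr_pwDl //.
by rewrite -natr1 addrC lerD2l; have /andP[] := truncn_itv t0.
Qed.

Lemma dix_fun_bounded A : L1inf A -> exists M, forall t, 0 < t -> `|dix_fun A t| <= M.
Proof.
move=> LA; have [mu_ge0 mu_anti] := L1inf_smu LA; have [_ _ [B AB]] := LA.
have muB k : smu k A <= B / k.+1%:R by rewrite ler_pdivlMr // mulrC AB.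
have B0 : 0 <= B by have := le_trans (mu_ge0 0%N) (muB 0%N); rewrite divr1.
have l2 := ln2_gt0 R.
exists (2 * smu 0 A + B * ((ln 2)^-1 + 1)) => t t0; have l0 := ln1D_gt0 t0.
rewrite ger0_norm ?dix_fun_ge0 // dix_funE mulrC ler_pdivrMr // mulrDl.
have B_ln : 0 <= B * ((ln 2)^-1 + 1) * ln (1 + t).
  by rewrite mulr_ge0 ?(ltW l0) // mulr_ge0 // addr_ge0 // invr_ge0 ltW.
have mu_ln : 0 <= 2 * smu 0 A * ln (1 + t) by rewrite !mulr_ge0 // ltW.
have [t1|t1] := leP t 1.
  apply: le_trans (step_int_le_linear mu_ge0 mu_anti (ltW t0)) _.
  apply: le_trans (_ : 2 * smu 0 A * ln (1 + t) <= _); last by rewrite lerDl.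
  rewrite [2 * _]mulrC -mulrA ler_wpM2l // mulrC -ler_pdivrMr //.
  apply: le_trans (ln1D_ge (ltW t0)); rewrite ler_pM2l // lef_pV2 ?posrE //; lra.
apply: le_trans (step_int_le_ln mu_ge0 mu_anti muB (ltW t0)) _.
rewrite -[leLHS]add0r lerD // -mulrA ler_wpM2l // mulrDl mul1r lerD2r.
by rewrite mulrC ler_pdivlMr // mul1r ler_ln ?posrE ?addr_gt0 //; lra.
Qed.

Lemma dix_fun_measurable A : L1inf A -> measurable_fun `](0 : R), +oo[%classic (dix_fun A).
Proof.
move=> /L1inf_smu[mu_ge0 mu_anti].
pose I t := if t < 0 then 0 else step_int (fun k => smu k A) t.
have mI : measurable_fun `](0 : R), +oo[%classic I.
  apply: nondecreasing_measurable => // s t st; rewrite /I.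
  case: ltP => s0; case: ltP => t0 //; first exact: step_int_ge0.
    by move: (lt_le_trans t0 s0); rewrite ltNge st.
  exact: step_int_le.
have mln : measurable_fun `](0 : R), +oo[%classic (fun t => expR (- ln (ln (1 + t)))).
  apply: measurableT_comp => //; apply: measurableT_comp => //.
  apply: measurableT_comp; first exact: measurable_ln.
  apply: measurableT_comp; first exact: measurable_ln.
  by apply: measurable_funD => //; exact: measurable_cst.
apply: eq_measurable_fun (measurable_funM mln mI) => t.
rewrite inE /= in_itv /= andbT => t0.
by rewrite dix_funE /I ltNge (ltW t0) expRN lnK // posrE ln1D_gt0.
Qed.

Lemma dix_fun_Linf A : L1inf A -> Linf (dix_fun A).
Proof.
move=> LA; split; first exact: dix_fun_measurable.
have [M dix_le] := dix_fun_bounded LA; exists M; apply: aeW => t /=.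
by rewrite in_itv /= andbT; exact: dix_le.
Qed.

Lemma dix_fun_sandwich A t (n := dyadic_level t) : L1inf A -> 2 <= t ->
  (\sum_(k < 2 ^ n) smu k A) / n.+2%:R / ln 2 <= dix_fun A t <=
  (\sum_(k < 2 ^ n.+1) smu k A) / n%:R / ln 2.
Proof.
move=> LA t2; have [mu_ge0 mu_anti] := L1inf_smu LA; have l2 := ln2_gt0 R.
have t1 : 1 <= t by apply: le_trans t2; rewrite ler1n.
have t0 : 0 <= t by exact: le_trans t1.
have /andP[lo hi] := dyadic_level_bounds t1; rewrite -/n in lo hi.
have n_gt0 : (0 < n)%N by apply: contraTT t2; rewrite -eqn0Ngt -ltNge => /eqP n0; rewrite n0 in hi.
have lnX k : ln (2 ^+ k) = k%:R * ln 2 :> R by rewrite lnXn // mulr_natl.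
have ln_lo : n%:R * ln 2 <= ln (1 + t).
  by rewrite -lnX ler_ln ?posrE ?exprn_gt0 ?ltr_pwDl // (le_trans lo) // lerDr.
have ln_hi : ln (1 + t) <= n.+2%:R * ln 2.
  rewrite -lnX ler_ln ?posrE ?exprn_gt0 ?ltr_pwDl // exprS mulrDl mul1r.
  by rewrite lerD ?(ltW hi) // (le_trans t1 (ltW hi)).
have ln0 : 0 < n%:R * ln 2 :> R by rewrite mulr_gt0 // ltr0n.
have sum_lo : \sum_(k < 2 ^ n) smu k A <= step_int (fun k => smu k A) t.
  by rewrite -(step_int_nat mu_ge0 mu_anti) step_int_le // natrX.
have sum_hi : step_int (fun k => smu k A) t <= \sum_(k < 2 ^ n.+1) smu k A.
  by rewrite -(step_int_nat mu_ge0 mu_anti) step_int_le // natrX ltW.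
have sum_ge0 j : 0 <= \sum_(k < j) smu k A by exact: sumr_ge0.
have divE (s : R) j : s / j%:R / ln 2 = (j%:R * ln 2)^-1 * s.
  by rewrite invfM [RHS]mulrC mulrA.
have ln_gt0 : 0 < ln (1 + t) by exact: lt_le_trans ln_lo.
rewrite dix_funE !divE; apply/andP; split; apply: ler_pM => //.
- by rewrite invr_ge0 mulr_ge0 // ltW.
- by rewrite lef_pV2 ?posrE // mulr_gt0.
- by rewrite invr_ge0 ltW.
- exact: step_int_ge0.
- by rewrite lef_pV2 ?posrE.
Qed.

Lemma dix_fun_cvg A (c : R) : L1inf A ->
  (fun n => (\sum_(k < 2 ^ n) smu k A) / n%:R) @ \oo --> c ->
  dix_fun A t @[t --> +oo] --> c / ln 2.
Proof.
move=> LA sum_c.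
have lo : (fun n => (\sum_(k < 2 ^ n) smu k A) / n.+2%:R / ln 2) @ \oo --> c / ln 2.
  by apply: cvgM; [exact: (cvg_div_natS2 sum_c)|exact: cvg_cst].
have hi : (fun n => (\sum_(k < 2 ^ n.+1) smu k A) / n%:R / ln 2) @ \oo --> c / ln 2.
  by apply: cvgM; [exact: (cvg_succ_div_nat sum_c)|exact: cvg_cst].
apply: (squeeze_cvgr _ (cvg_comp _ _ (@dyadic_level_cvg R) lo)
  (cvg_comp _ _ (@dyadic_level_cvg R) hi)).
by exists 2; split=> [|t t2]; [exact: num_real|exact/dix_fun_sandwich/ltW].
Qed.

Lemma unitary_conj_comb U V (a : R[i]) A A' : unitary_pair U V -> L1inf A -> L1inf A' ->
  U \o opcomb a A A' \o V = opcomb a (U \o A \o V) (U \o A' \o V).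
Proof.
move=> /unitary_pairP[u [-> -> _]] /L1infP[T -> _] /L1infP[S -> _].
rewrite opcomb_to_op !comp_to_op opcomb_to_op; congr to_op.
by apply: blinP => x; rewrite !(blinM, blinD, blinZ) linearP.
Qed.

Lemma unitary_conj_L1inf U V A : unitary_pair U V -> L1inf A -> L1inf (U \o A \o V).
Proof.
move=> /unitary_pairP[u [-> -> uu]] /L1infP[T -> aT]; rewrite !comp_to_op.
by apply/L1infP; eexists; [reflexivity|exact: approximable_unitary].
Qed.

Lemma unitary_conj_pos U V A : unitary_pair U V -> L1inf A -> pos_op A -> pos_op (U \o A \o V).
Proof.
move=> /unitary_pairP[u [-> -> _]] /L1infP[T -> _] /pos_opP pT; rewrite !comp_to_op.
by apply/pos_opP => x; rewrite !blinM dot_adj; exact: pT.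
Qed.

Lemma unitary_conj_smu U V A k : unitary_pair U V -> L1inf A ->
  smu k (U \o A \o V) = smu k A.
Proof.
move=> /unitary_pairP[u [-> -> uu]] /L1infP[T -> _]; rewrite !comp_to_op.
exact: smu_unitary.
Qed.

Lemma Dixmier_is_trace tau : @Dixmier R tau -> is_trace tau.
Proof.
move=> [om [_ _ lin dix]]; split=> // U V A UV LA.
apply: (eq_on_L1inf (f := fun A => tau (U \o A \o V)) _ lin _ LA) => [a A1 A2 L1 L2|B LB pB].
  have LU := unitary_conj_L1inf UV.
  by rewrite (unitary_conj_comb a UV L1 L2) (lin _ _ _ (LU _ L1) (LU _ L2)).
have LUB := unitary_conj_L1inf UV LB; have pUB := unitary_conj_pos UV LB pB.
have dixE : dix_fun (U \o B \o V) = dix_fun B.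
  apply/funext => t; rewrite !dix_funE; congr (_ * step_int _ t).
  by apply/funext => k; exact: unitary_conj_smu.
by apply: etrans (dix _ LUB pUB) _; rewrite dixE; apply/esym/dix.
Qed.

Lemma cvg_harmonic_sum_pow2 :
  (fun n => (\sum_(k < 2 ^ n) k.+1%:R^-1) / n%:R) @ \oo --> ln (2 : R).
Proof.
have hi : (fun n => ln 2 + 1 / n%:R : R) @ \oo --> ln (2 : R).
  by rewrite -[X in _ --> X]addr0; apply: cvgD; [exact: cvg_cst|exact: cvg_div_nat].
apply: squeeze_cvgr (cvg_cst _) hi; exists 1%N => // n /= n1.
have n0 : 0 < n%:R :> R by rewrite ltr0n.
have /andP[sum_lo sum_hi] := harmonic_sum_pow2 R n.
rewrite ler_pdivlMr // ler_pdivrMr // mulrDl divfK ?gt_eqF //.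
by rewrite [ln 2 * _]mulrC sum_lo addrC.
Qed.

Lemma Dixmier_PT tau : @Dixmier R tau -> PT tau.
Proof.
move=> dix_tau; have [om [om_lim _ _ dix]] := dix_tau; split=> [|A LA pA|A LA pA muA].
- exact: Dixmier_is_trace.
- rewrite (dix _ LA pA) ler0c; apply: (ext_lim_ge0_eventually om_lim (T := 0)).
    exact: dix_fun_Linf.
  by move=> t; exact: dix_fun_ge0.
- rewrite (dix _ LA pA); congr (_%:C%C).
  apply: ext_lim_cvg => //; first exact: dix_fun_Linf.
  rewrite -(divff (lt0r_neq0 (ln2_gt0 R))); apply: dix_fun_cvg => //.
  by under eq_fun do under eq_bigr do rewrite muA; exact: cvg_harmonic_sum_pow2.
Qed.

End DixmierFunction.

(** * A Dixmier-measurable operator that is not PT-measurable *)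

Section LevelDensity.
Variable R : realType.
Implicit Types (a : nat -> nat) (b : nat -> bool).

Definition has_density a b (theta : R) :=
  (fun m => (\sum_(a m <= j < a m + m) b j)%:R / m%:R : R) @ \oo --> theta.

Lemma trunc_log_block m i : (i < 2 ^ m)%N -> trunc_log 2 (2 ^ m + i) = m.
Proof.
move=> im; apply: trunc_log_eq => //.
by rewrite leq_addr /= expnS mul2n -addnn ltn_add2l.
Qed.

(* The levels in the blocks [2 ^ m, 2 ^ m + m). *)
Definition bump (j : nat) : bool := (j - 2 ^ trunc_log 2 j < trunc_log 2 j)%N.

Lemma bump_block m i : (i < 2 ^ m)%N -> bump (2 ^ m + i) = (i < m)%N.
Proof. by move=> im; rewrite /bump trunc_log_block // addKn. Qed.

Definition bump_count n := (\sum_(j < n) bump j)%N.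

Lemma bump_countD n k : bump_count (n + k) = (bump_count n + \sum_(i < k) bump (n + i))%N.
Proof. by rewrite /bump_count big_split_ord. Qed.

Lemma leq_bump_count n n' : (n <= n')%N -> (bump_count n <= bump_count n')%N.
Proof. by move=> /subnKC <-; rewrite bump_countD leq_addr. Qed.

Lemma bump_count_pow2 m : (bump_count (2 ^ m) <= m ^ 2)%N.
Proof.
elim: m => [|m IH]; first by rewrite /bump_count big_ord1.
have m_lt : (m <= 2 ^ m)%N by exact/ltnW/ltn_expl.
have block : (\sum_(i < 2 ^ m) bump (2 ^ m + i) = m)%N.
  rewrite (eq_bigr (fun i : 'I_(2 ^ m) => (i < m : nat)%N)) => [|i _]; last by rewrite bump_block.
  by rewrite -big_mkcond /= (big_ord_narrow m_lt) sum1_card card_ord.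
by rewrite expnS mul2n -addnn bump_countD block; nia.
Qed.

Lemma cube_le_pow2 l : (l.+1 ^ 3 <= 64 * 2 ^ l)%N.
Proof.
suff cubeD3 k : ((k + 3).+1 ^ 3 <= 64 * 2 ^ (k + 3))%N.
  by case: (leqP 3 l) => [/subnK <-|] //; case: l => [|[|[|]]].
elim: k => [//|k IH]; rewrite addSn (expnS 2).
apply: (@leq_trans (2 * (k + 3).+1 ^ 3)); first by rewrite !expnS !expn0; nia.
by rewrite mulnCA leq_mul2l.
Qed.

Lemma bump_count_small n : (0 < n)%N -> (bump_count n * (trunc_log 2 n).+1 <= 64 * n)%N.
Proof.
move=> n0; set l := trunc_log 2 n.
have /andP[l_le lt_l] := trunc_log_bounds (isT : (1 < 2)%N) n0.
have count_le := leq_trans (leq_bump_count (ltnW lt_l)) (bump_count_pow2 l.+1).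
apply: leq_trans (_ : (l.+1 ^ 2 * l.+1 <= _)%N); first by rewrite leq_mul2r count_le orbT.
by rewrite -expnSr; apply: leq_trans (cube_le_pow2 l) _; rewrite leq_mul2l.
Qed.

Lemma trunc_log2_cvg : trunc_log 2 @ \oo --> \oo.
Proof.
move=> A [N _ NA]; exists (2 ^ N)%N => // n Nn; apply: NA => /=.
by rewrite -(@trunc_expnK 2 N) //; exact: leq_trunc_log.
Qed.

Lemma bump_density0 : has_density (fun=> 0) bump 0.
Proof.
have small : (fun l => 64 / l.+1%:R : R) @ \oo --> 0.
  by rewrite (cvg_shiftS (fun l => 64 / l%:R : R)); exact: cvg_div_nat.
apply: squeeze_cvgr (cvg_cst 0) (cvg_comp _ _ trunc_log2_cvg small); exists 1%N => // n /= n1.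
rewrite divr_ge0 //= add0n big_mkord ler_pdivrMr ?ltr0n // mulrAC ler_pdivlMr //.
by rewrite -!natrM ler_nat bump_count_small.
Qed.

Lemma bump_density1 : has_density (expn 2) bump 1.
Proof.
apply: (@cvg_near_cst _ R); exists 1%N => // m /= m1.
rewrite -{1}[(2 ^ m)%N]add0n big_addn addnC addnK big_mkord.
rewrite (eq_bigr (fun=> 1%N)) => [|i _]; last first.
  by rewrite addnC bump_block ?ltn_ord //; exact: ltn_trans (ltn_ord i) (ltn_expl _ _).
by rewrite sum1_card card_ord divff // pnatr_eq0 -lt0n.
Qed.

End LevelDensity.

Section Staircase.
Variables (R : realType) (b : nat -> bool).

Definition staircase (k : nat) : R := (b (trunc_log 2 k)).+1%:R / 2 ^+ trunc_log 2 k.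

Lemma staircase_ge0 k : 0 <= staircase k.
Proof. by rewrite divr_ge0 ?exprn_ge0. Qed.

Lemma staircase_nonincreasing : nonincreasing_seq staircase.
Proof.
move=> i j ij; rewrite /staircase; move: (leq_trunc_log 2 ij).
set l := trunc_log 2 i; set l' := trunc_log 2 j; rewrite leq_eqVlt => /orP[/eqP-> //|ll'].
apply: (@le_trans _ _ (2 / 2 ^+ l.+1)).
  apply: ler_pM; rewrite ?invr_ge0 ?exprn_ge0 //; first by rewrite ler_nat ltnS leq_b1.
  by rewrite lef_pV2 ?posrE ?exprn_gt0 // ler_eXn2l ?ltr1n.
rewrite exprS invfM mulrA divff ?pnatr_eq0 // ler_pM2r ?invr_gt0 ?exprn_gt0 //.
by rewrite ler1n.
Qed.

Lemma staircase_le k : staircase k <= 4 / k.+1%:R.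
Proof.
have step_le : (k.+1 <= 2 * 2 ^ trunc_log 2 k)%N.
  by case: k => // k; rewrite -expnS; have /andP[] := @trunc_log_bounds 2 k.+1 isT isT.
rewrite /staircase ler_pdivrMr ?exprn_gt0 // mulrAC ler_pdivlMr // -natrX -!natrM ler_nat.
have b_le : ((b (trunc_log 2 k)).+1 <= 2)%N by rewrite ltnS leq_b1.
by rewrite (leq_trans (leq_mul b_le step_le)) // mulnA.
Qed.

Lemma staircase_sum n :
  \sum_(k < 2 ^ n) staircase k = staircase 0 + n%:R + (\sum_(0 <= j < n) b j)%:R.
Proof.
elim: n => [|n IH]; first by rewrite big_ord1 big_geq // !addr0.
rewrite expnS mul2n -addnn big_split_ord big_nat_recr //= IH.
rewrite [X in _ + X](eq_bigr (fun=> (b n).+1%:R / 2 ^+ n)) => [|i _]; last first.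
  by rewrite /staircase trunc_log_block.
rewrite sumr_const card_ord -[X in _ + X]mulr_natr natrX divfK ?expf_neq0 ?pnatr_eq0 //.
by rewrite natrD -!natr1; ring.
Qed.

Lemma staircase_window_mean a theta : has_density a b theta ->
  window_mean a (fun n => \sum_(k < 2 ^ n) staircase k) @ \oo --> (1 + theta) / ln (2 : R).
Proof.
move=> dens.
have mean : (fun m => (1 + (\sum_(a m <= j < a m + m) b j)%:R / m%:R) / ln (2 : R)) @ \oo -->
    (1 + theta) / ln (2 : R).
  by apply: cvgM; [apply: cvgD => //; exact: cvg_cst|exact: cvg_cst].
apply: cvg_trans mean; apply: near_eq_cvg; exists 1%N => // m /= m1.
have m0 : m%:R != 0 :> R by rewrite pnatr_eq0 -lt0n.
rewrite /window_mean !staircase_sum (big_cat_nat (leq0n (a m)) (leq_addr m (a m))) //= !natrD.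
by field; rewrite m0 gt_eqF // ln2_gt0.
Qed.

Definition staircase_op : blin R :=
  diag_op (@delta_orthonormal R) staircase_ge0 staircase_nonincreasing.

Lemma smu_staircase k : smu k (to_op staircase_op) = staircase k.
Proof. exact: smu_diag. Qed.

Lemma approximable_staircase : approximable staircase_op.
Proof. exact: approximable_diag staircase_le. Qed.

Lemma staircase_L1inf : L1inf (to_op staircase_op).
Proof. by apply/L1infP; exists staircase_op => //; exact: approximable_staircase. Qed.

Lemma staircase_pos : pos_op (to_op staircase_op).
Proof. exact/pos_opP/positive_diag. Qed.

Lemma staircase_window_trace L a theta : seq_ext_lim L -> has_density a b theta ->
  window_trace L a (to_op staircase_op) = ((1 + theta) / ln 2)%:C%C.
Proof.
move=> L_lim dens.
rewrite (window_trace_positive L_lim) //; first last.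
- exact: approximable_staircase.
- exact: positive_diag.
congr (_%:C%C); apply: (window_lim_cvg L_lim).
under [X in window_mean a X]eq_fun do under eq_bigr do rewrite smu_staircase.
exact: staircase_window_mean.
Qed.

Lemma staircase_Dixmier tau theta : Dixmier tau -> has_density (fun=> 0) b theta ->
  tau (to_op staircase_op) = ((1 + theta) / ln 2)%:C%C.
Proof.
move=> [om [om_lim _ _ dix]] dens; have LA := staircase_L1inf.
rewrite (dix _ LA staircase_pos); congr (_%:C%C).
apply: ext_lim_cvg => //; first exact: dix_fun_Linf.
apply: dix_fun_cvg => //; under eq_fun do under eq_bigr do rewrite smu_staircase.
have mean : (fun m => staircase 0 / m%:R + (1 + (\sum_(0 <= j < 0 + m) b j)%:R / m%:R)) @ \oo
    --> 0 + (1 + theta).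
  by apply: cvgD; [exact: cvg_div_nat|apply: cvgD => //; exact: cvg_cst].
rewrite add0r in mean; apply: cvg_trans mean; apply: near_eq_cvg; exists 1%N => // n /= n1.
have n0 : n%:R != 0 :> R by rewrite pnatr_eq0 -lt0n.
by rewrite staircase_sum add0n; field.
Qed.

End Staircase.

Section Bump.
Variable R : realType.

Definition bump_op : op R := to_op (staircase_op R bump).

Lemma bump_op_Dixmier_measurable : measurable_wrt Dixmier bump_op.
Proof.
by move=> s t Ds Dt; rewrite /bump_op !(staircase_Dixmier _ (@bump_density0 R)).
Qed.

Lemma bump_op_not_PT_measurable : ~ measurable_wrt PT bump_op.
Proof.
have [L L_lim] := exists_seq_ext_lim R.
move=> /(_ _ _ (window_trace_PT L_lim (fun=> 0%N)) (window_trace_PT L_lim (expn 2))).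
rewrite /bump_op (staircase_window_trace L_lim (@bump_density0 R)).
rewrite (staircase_window_trace L_lim (@bump_density1 R)) => -[].
move/(mulIf _); rewrite invr_eq0 gt_eqF ?ln2_gt0 // => /(_ isT)/addrI/esym/eqP.
by rewrite oner_eq0.
Qed.

End Bump.

Theorem theorem7p4 (R : realType) :
  (forall A : op R, L1inf A -> measurable_wrt PT A -> measurable_wrt Dixmier A) /\
  (exists A : op R, [/\ L1inf A, pos_op A, measurable_wrt Dixmier A &
                        ~ measurable_wrt PT A]).
Proof.
split=> [A _ mA tau1 tau2 /Dixmier_PT PT1 /Dixmier_PT PT2|]; first exact: mA.
exists (@bump_op R); split.
- exact: staircase_L1inf.
- exact: staircase_pos.
- exact: bump_op_Dixmier_measurable.
- exact: bump_op_not_PT_measurable.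
Qed.
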